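(* There is a constant $C>0$, depending only on the geometry and the discretisation, such that the following holds. Let $\sigma>0$ be a constant, let $\boldsymbol{f}\in[L^2(\Omega)]^d$, and let $\nu\in W^{1,\infty}(\Omega)$ satisfy $0<\nu_{\min}\le\nu\le\nu_{\max}<\infty$ in $\Omega$ for constants $\nu_{\min},\nu_{\max}$. If the constant stabilisation parameter $\delta>0$ satisfies $$\delta\le\min\left\{\frac{1}{3\sigma},\ \frac{\nu_{\min}h^2/12}{h^2\|\nabla\nu\|_\infty^2+C\nu_{\max}^2}\right\},$$ then the following problem has a unique solution: find $(\boldsymbol{u}_h,p_h)\in X_h\times Y_h$ such that $$\sigma(\boldsymbol{u}_h,\boldsymbol{v}_h)+(2\nu\nabla^{\mathrm{s}}\boldsymbol{u}_h,\nabla^{\mathrm{s}}\boldsymbol{v}_h)-(p_h,\nabla\cdot\boldsymbol{v}_h)=(\boldsymbol{v}_h,\boldsymbol{f}),$$ $$(q_h,\nabla\cdot\boldsymbol{u}_h)+\delta\big(\nabla q_h,\nabla p_h+\sigma\boldsymbol{u}_h-2(\nabla^{\top}\boldsymbol{u}_h)\nabla\nu-\boldsymbol{f}\big)+\delta(\nabla q_h\times\boldsymbol{n},\nu\nabla\times\boldsymbol{u}_h)_{\Gamma}=0$$ for all $\boldsymbol{v}_h\in X_h$ and all $q_h\in Y_h$.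
   Context: $\Omega\subset\mathbb{R}^d$, $d\in\{2,3\}$, is a bounded domain with Lipschitz boundary $\Gamma=\partial\Omega$ and outward unit normal $\boldsymbol{n}$, exactly covered by a simplicial triangulation $\mathcal{T}$ belonging to a shape-regular, globally quasi-uniform family: with $h_e$ the size of element $\Omega_e\in\mathcal{T}$ and $h$ the maximum element size, $1\le h/h_e\le Q$ for all elements, where $Q\ge1$ is a fixed constant. $X_h\subset[H^1_0(\Omega)]^d$ and $Y_h\subset L^2_0(\Omega)\cap H^1(\Omega)$ are standard $H^1$-conforming (continuous piecewise polynomial) finite element spaces on $\mathcal{T}$, where $L^2_0(\Omega)$ is the space of $L^2(\Omega)$ functions with zero mean. Notation: $(\cdot,\cdot)$ is the $L^2(\Omega)$ inner product (for scalars, vectors or matrices) and $(\cdot,\cdot)_\Gamma$ the $L^2(\Gamma)$ one; $\|\cdot\|_\infty$ is the $L^\infty$ norm. $(\nabla\boldsymbol{u})_{ij}=\partial_j u_i$, $(\nabla^{\top}\boldsymbol{u})_{ij}=\partial_i u_j$, and $\nabla^{\mathrm{s}}=\tfrac12(\nabla+\nabla^{\top})$. $\nabla\times$ is the curl and $\times$ the vector product; for $d=2$ both are the scalar versions, $\nabla\times\boldsymbol{u}=\partial_1u_2-\partial_2u_1$ and $\boldsymbol{a}\times\boldsymbol{b}=a_1b_2-a_2b_1$. On $\Gamma$, the derivatives of the discrete functions $q_h$, $\boldsymbol{u}_h$ are the traces taken elementwise from the adjacent elements. ''Depending only on the geometry and the discretisation'' means that $C$ may depend on $\Omega$, $d$,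 the shape-regularity constants of the mesh family, $Q$, and the polynomial degrees of $X_h,Y_h$, but not on $h,\sigma,\nu,\boldsymbol{f},\delta$. *)

(* Defs.v *)
From HB Require Import structures.
From mathcomp Require Import all_boot all_order all_algebra.
From mathcomp Require Import all_classical all_reals all_analysis.

Set Implicit Arguments.
Unset Strict Implicit.
Unset Printing Implicit Defensive.

Import Order.TTheory GRing.Theory Num.Theory.
Import numFieldNormedType.Exports.

Local Open Scope classical_set_scope.
Local Open Scope ring_scope.

Definition rV_display : measure_display. Proof. exact: default_measure_display. Qed.

(* The product sigma-algebra of 'rV[R]_n, generated by the coordinates; it is
   the Borel sigma-algebra.  Measurability of f : 'rV_n -> 'rV_m below refers
   to it, so elements of L^2 or W^{1,oo} are given by Borel representatives. *)
Section rV_measurable.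
Context {R : realType} (n : nat).

Let coords : 'I_n -> 'rV[R]_n -> measurableTypeR R := fun i x => x 0 i.

Let rV_set0 : g_sigma_preimage coords set0.
Proof. exact: sigma_algebra0. Qed.

Let rV_setC A : g_sigma_preimage coords A -> g_sigma_preimage coords (~` A).
Proof. exact: sigma_algebraC. Qed.

Let rV_bigcup (F : (set 'rV[R]_n)^nat) :
  (forall i, g_sigma_preimage coords (F i)) ->
  g_sigma_preimage coords (\bigcup_i (F i)).
Proof. exact: sigma_algebra_bigcup. Qed.

HB.instance Definition _ := @isMeasurable.Build rV_display
  'rV[R]_n (g_sigma_preimage coords) rV_set0 rV_setC rV_bigcup.

Lemma measurable_coord (i : 'I_n) :
  measurable_fun [set: 'rV[R]_n] (fun x => x 0 i : measurableTypeR R).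
Proof.
move=> _ Y mY; rewrite setTI; apply: sub_sigma_algebra => /=.
rewrite -bigcup_seq/=; exists i => /=; first by rewrite mem_index_enum.
by exists Y => //; rewrite setTI.
Qed.

Lemma measurable_rV d (T : measurableType d) (f : T -> 'rV[R]_n) :
  (forall i, measurable_fun [set: T] (fun t => f t 0 i : measurableTypeR R)) ->
  measurable_fun [set: T] f.
Proof.
move=> mf _ A mA; rewrite setTI.
have : (preimage_set_system [set: T] f (g_sigma_preimage coords)) (f @^-1` A).
  by exists A => //; rewrite setTI.
rewrite -g_sigma_preimage_comp; apply: smallest_sub.
  exact: sigma_algebra_measurable.
rewrite -bigcup_seq; apply: bigcup_sub => i _ B [C mC <-].
exact: mf.
Qed.

End rV_measurable.

Section lebesgue_step.
Context {R : realType} (n : nat).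
Variable m : {sigma_finite_measure set 'rV[R]_n -> \bar R}.

Definition rVcons (z : measurableTypeR R * 'rV[R]_n) : 'rV[R]_n.+1 :=
  \row_i oapp (fun j => z.2 0 j) z.1 (unlift ord0 i).

Definition rVuncons (x : 'rV[R]_n.+1) : measurableTypeR R * 'rV[R]_n :=
  (x 0 ord0, \row_j x 0 (lift ord0 j)).

Lemma rVconsK : cancel rVcons rVuncons.
Proof.
move=> [a v]; congr pair; first by rewrite mxE unlift_none.
by apply/rowP => j; rewrite !mxE liftK.
Qed.

Lemma measurable_rVcons : measurable_fun setT rVcons.
Proof.
apply: measurable_rV => i; under eq_fun do rewrite mxE.
case: (unlift ord0 i) => [j|]; last exact: measurable_fst.
apply: (measurableT_comp (measurable_coord j)); exact: measurable_snd.
Qed.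

Lemma measurable_rVuncons : measurable_fun setT rVuncons.
Proof.
apply: measurable_fun_pair; first exact: measurable_coord.
apply: measurable_rV => i; under eq_fun do rewrite mxE.
exact: measurable_coord.
Qed.

Definition leb_step : set 'rV[R]_n.+1 -> \bar R :=
  pushforward (@lebesgue_measure R \x m)%E rVcons.

Let leb_step0 : leb_step set0 = 0%E.
Proof. by rewrite /leb_step /pushforward preimage_set0 measure0. Qed.

Let leb_step_ge0 A : (0 <= leb_step A)%E.
Proof. by rewrite /leb_step /pushforward; exact: measure_ge0. Qed.

Let leb_step_sigma_additive : semi_sigma_additive leb_step.
Proof.
move=> F mF tF mUF; rewrite /leb_step /pushforward preimage_bigcup.
have mpre A : measurable A -> measurable (rVcons @^-1` A).
  by move=> mA; rewrite -[X in measurable X]setTI; exact: measurable_rVcons.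
apply: measure_semi_sigma_additive; first by move=> k; exact: mpre.
  apply/trivIsetP => i j _ _ ij; rewrite -preimage_setI.
  by move/trivIsetP : tF => /(_ i j I I ij) ->; rewrite preimage_set0.
by rewrite -preimage_bigcup; exact: mpre.
Qed.

HB.instance Definition _ := isMeasure.Build _ _ _ leb_step
  leb_step0 leb_step_ge0 leb_step_sigma_additive.

Let leb_step_sigma_finite : sigma_finite setT leb_step.
Proof.
have /sigma_finiteP[F [TF ndF Foo]] := sigma_finiteT (@lebesgue_measure R).
have /sigma_finiteP[G [TG ndG Goo]] := sigma_finiteT m.
exists (fun k => rVuncons @^-1` (F k `*` G k)).
  rewrite -preimage_bigcup -(preimage_setT rVuncons); congr (_ @^-1` _).
  rewrite -setXTT TF TG; apply/seteqP; split => [[a v]|[a v] [k _ []]] /=.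
    move=> [[i _ Fa] [j _ Gv]]; exists (maxn i j) => //; split => /=.
      by move: a Fa; exact/subsetPset/ndF/leq_maxl.
    by move: v Gv; exact/subsetPset/ndG/leq_maxr.
  by move=> Fa Gv; split; exists k.
move=> k; have [mF Fk] := Foo k; have [mG Gk] := Goo k.
have mFG : measurable (F k `*` G k) by exact: measurableX.
split; first by rewrite -[X in measurable X]setTI; exact: measurable_rVuncons.
rewrite /leb_step /pushforward -comp_preimage.
rewrite (_ : rVuncons \o rVcons = id); last by apply/funext; exact: rVconsK.
by rewrite preimage_id product_measure1E// lte_mul_pinfty// ge0_fin_numE.
Qed.

HB.instance Definition _ := Measure_isSigmaFinite.Build _ _ _ leb_step
  leb_step_sigma_finite.
End lebesgue_step.

(* Lebesgue measure on R^n, as the n-fold product of the one on R. *)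
Fixpoint leb {R : realType} (n : nat) :
    {sigma_finite_measure set 'rV[R]_n -> \bar R} :=
  if n is n'.+1 then leb_step (leb n') else \d_(0 : 'rV[R]_0).

(* Throughout, the space dimension d is n.+1 (so d = 2, 3 is n = 1, 2) and points
   and vectors are rows.  The norm of 'rV[R]_m in the library is the maximum
   norm, whence the Euclidean norm [enorm]. *)
Section euclidean.
Context {R : realType} {m : nat}.

Definition dot (u v : 'rV[R]_m) : R := \sum_i u 0 i * v 0 i.

Definition enorm (u : 'rV[R]_m) : R := Num.sqrt (dot u u).

Definition frob {p : nat} (A B : 'M[R]_(m, p)) : R :=
  \sum_i \sum_j A i j * B i j.

Definition diam (A : set 'rV[R]_m) : R :=
  sup [set enorm (z.1 - z.2) | z in A `*` A].

(* Diameter of the largest ball contained in A. *)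
Definition inball_diam (A : set 'rV[R]_m) : R :=
  sup [set 2 * r | r in [set r | 0 <= r /\
    exists x, [set y | enorm (y - x) <= r] `<=` A]].

End euclidean.

Section vector_calculus.
Context {R : realType} {n : nat}.
Implicit Types (f : 'rV[R]_n.+1 -> R) (u : 'rV[R]_n.+1 -> 'rV[R]_n.+1).

Definition pderive (i : 'I_n.+1) f : 'rV[R]_n.+1 -> R :=
  fun x => 'D_(delta_mx 0 i) f x.

Definition grad f (x : 'rV[R]_n.+1) : 'rV[R]_n.+1 := \row_i pderive i f x.

(* (nabla u)_{ij} = d_j u_i *)
Definition vgrad u (x : 'rV[R]_n.+1) : 'M[R]_n.+1 :=
  \matrix_(i, j) pderive j (fun y => u y 0 i) x.

Definition sgrad u (x : 'rV[R]_n.+1) : 'M[R]_n.+1 :=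
  2^-1 *: (vgrad u x + (vgrad u x)^T).

Definition diverg u (x : 'rV[R]_n.+1) : R := \tr (vgrad u x).

(* The vector product and the curl have a single component if d = 2, three if
   d = 3.  Component i involves the pair of coordinates (cidx1 i, cidx2 i): it is
   (0, 1) if d = 2, and (i + 1, i + 2) modulo 3 if d = 3. *)
Definition cdim : nat := (if n == 1 then 1 else 3)%N.

Definition cidx1 (i : 'I_cdim) : 'I_n.+1 :=
  inord (if n == 1 then 0 else i.+1 %% 3)%N.

Definition cidx2 (i : 'I_cdim) : 'I_n.+1 :=
  inord (if n == 1 then 1 else i.+2 %% 3)%N.

Definition vprod (a b : 'rV[R]_n.+1) : 'rV[R]_cdim :=
  \row_i (a 0 (cidx1 i) * b 0 (cidx2 i) - a 0 (cidx2 i) * b 0 (cidx1 i)).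

(* The curl of u in terms of G = nabla u, so that it also makes sense for traces
   of nabla u. *)
Definition curl_of (G : 'M[R]_n.+1) : 'rV[R]_cdim :=
  \row_i (G (cidx2 i) (cidx1 i) - G (cidx1 i) (cidx2 i)).

End vector_calculus.

Section domain.
Context {R : realType} {n : nat}.
Implicit Types Om : set 'rV[R]_n.+1.

Definition bdry Om : set 'rV[R]_n.+1 := closure Om `\` interior Om.

(* Near each boundary point, in suitable orthonormal coordinates z = y U, the
   set Om is the strict epigraph of a Lipschitz function of the first n
   coordinates. *)
Definition lipschitz_boundary Om := forall x, bdry Om x ->
  exists (U : 'M[R]_n.+1) (gam : 'rV[R]_n -> R) (L r : R),
    [/\ U *m U^T = 1%:M,
        forall s t, `|gam s - gam t| <= L * enorm (s - t),
        0 < r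
      & forall y, enorm (y - x) < r ->
          (Om y <-> gam (col' ord_max (y *m U)) < (y *m U) 0 ord_max)].

Definition bounded_lipschitz_domain Om :=
  [/\ Om !=set0, open Om, connected Om, bounded_set Om & lipschitz_boundary Om].

End domain.

Section function_spaces.
Context {R : realType} {n : nat}.
Variable Om : set 'rV[R]_n.+1.

Local Notation mu := (leb n.+1).

Definition L2s (f g : 'rV[R]_n.+1 -> R) : R :=
  \int[mu]_(x in Om) (f x * g x).

Definition L2v (f g : 'rV[R]_n.+1 -> 'rV[R]_n.+1) : R :=
  \int[mu]_(x in Om) dot (f x) (g x).

Definition L2m (F G : 'rV[R]_n.+1 -> 'M[R]_n.+1) : R :=
  \int[mu]_(x in Om) frob (F x) (G x).

Definition in_L2v (f : 'rV[R]_n.+1 -> 'rV[R]_n.+1) :=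
  measurable_fun Om f /\
  (\int[mu]_(x in Om) (enorm (f x) ^+ 2)%:E < +oo)%E.

Definition Linfty_norm (f : 'rV[R]_n.+1 -> R) : \bar R :=
  Lnorm mu +oo%E (EFin \o (f \_ Om)).

Definition smooth (phi : 'rV[R]_n.+1 -> R) :=
  forall (s : seq 'I_n.+1) x, differentiable (foldr pderive phi s) x.

Definition test_function (phi : 'rV[R]_n.+1 -> R) :=
  let supp := closure [set x | phi x != 0] in
  [/\ smooth phi, compact supp & supp `<=` Om].

Definition weak_gradient (nu : 'rV[R]_n.+1 -> R)
    (gnu : 'rV[R]_n.+1 -> 'rV[R]_n.+1) :=
  forall phi i, test_function phi ->
    L2s nu (pderive i phi) = - L2s (fun x => gnu x 0 i) phi.

(* nu belongs to W^{1,oo}(Om) and its gradient is gnu. *)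
Definition W1infty (nu : 'rV[R]_n.+1 -> R)
    (gnu : 'rV[R]_n.+1 -> 'rV[R]_n.+1) :=
  [/\ measurable_fun Om nu /\ measurable_fun Om gnu,
      (Linfty_norm nu < +oo)%E,
      (Linfty_norm (enorm \o gnu) < +oo)%E
    & weak_gradient nu gnu].

(* Trace of a function of W^{1,oo}(Om): the boundary values of its
   representative that is continuous on the closure of Om; it exists and is
   unique as Om is a bounded Lipschitz domain. *)
Definition boundary_trace (nu nuG : 'rV[R]_n.+1 -> R) :=
  exists w : 'rV[R]_n.+1 -> R,
    [/\ {within closure Om, continuous w},
        {ae mu, forall x, Om x -> w x = nu x}
      & forall x, bdry Om x -> nuG x = w x].

End function_spaces.

(* A simplex of R^(n.+1) is given by its vertices, a : 'I_n.+2 -> 'rV_n.+1. *)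
Section simplices.
Context {R : realType} {n : nat}.
Variable a : 'I_n.+2 -> 'rV[R]_n.+1.

Definition nondegenerate :=
  (\matrix_(j < n.+1) (a (lift ord0 j) - a ord0) \in unitmx) : Prop.

(* Convex hull of the vertices with index in J; empty if J is. *)
Definition face (J : {set 'I_n.+2}) : set 'rV[R]_n.+1 :=
  [set x | exists lam : 'I_n.+2 -> R,
    [/\ forall j, 0 <= lam j, forall j, j \notin J -> lam j = 0,
        \sum_j lam j = 1 & x = \sum_j lam j *: a j]].

Definition simplex : set 'rV[R]_n.+1 := face [set: 'I_n.+2].

(* The facet opposite to the vertex i. *)
Definition facet (i : 'I_n.+2) : set 'rV[R]_n.+1 := face (~: [set i]%SET).

Definition facet_normal (i : 'I_n.+2) : 'rV[R]_n.+1 :=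
  xget 0 [set nrm | [/\ enorm nrm = 1,
    forall j k, j != i -> k != i -> dot nrm (a j - a k) = 0
    & forall j, j != i -> dot nrm (a i - a j) < 0]].

(* The facet is parametrised over the reference simplex of R^n by the affine map
   y |-> b + y E with b one of its vertices and the rows of E the edges from b;
   the surface measure is then sqrt (det (E E^T)) dy. *)
Definition facet_base (i : 'I_n.+2) : 'rV[R]_n.+1 := a (lift i ord0).

Definition facet_edges (i : 'I_n.+2) : 'M[R]_(n, n.+1) :=
  \matrix_(k < n) (a (lift i (lift ord0 k)) - facet_base i).

Definition ref_simplex : set 'rV[R]_n :=
  [set y | (forall k, 0 <= y 0 k) /\ \sum_k y 0 k <= 1].

Definition facet_integral (i : 'I_n.+2) (f : 'rV[R]_n.+1 -> R) : R :=
  let E := facet_edges i in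
  Num.sqrt (\det (E *m E^T)) *
  \int[leb n]_(y in ref_simplex) f (facet_base i + y *m E).

(* Boundary values on the simplex of a function given in its interior. *)
Definition elem_trace {V : normedModType R} (g : 'rV[R]_n.+1 -> V)
    (x : 'rV[R]_n.+1) : V :=
  lim (g @ within (interior simplex) (nbhs x)).

End simplices.

Section meshes.
Context {R : realType} {n N : nat}.
Variables (Om : set 'rV[R]_n.+1) (T : 'I_N -> 'I_n.+2 -> 'rV[R]_n.+1).

Definition triangulation :=
  [/\ forall e, nondegenerate (T e),
      injective (fun e => simplex (T e)),
      forall e e', exists J J' : {set 'I_n.+2},
        simplex (T e) `&` simplex (T e') = face (T e) J /\
        simplex (T e) `&` simplex (T e') = face (T e') J'
    & \bigcup_e simplex (T e) = closure Om].

Definition elem_size (e : 'I_N) : R := diam (simplex (T e)).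

Definition mesh_size : R := \big[Num.max/0]_e elem_size e.

Definition shape_regular (kappa : R) :=
  forall e, elem_size e <= kappa * inball_diam (simplex (T e)).

Definition quasi_uniform (Q : R) :=
  forall e, 1 <= mesh_size / elem_size e <= Q.

(* Integral over the boundary of a function given elementwise: g e i is its
   expression on the i-th facet of element e.  A facet contained in the boundary
   belongs to exactly one element. *)
Definition boundary_integral (g : 'I_N -> 'I_n.+2 -> 'rV[R]_n.+1 -> R) : R :=
  \sum_e \sum_(i | `[< facet (T e) i `<=` bdry Om >])
    facet_integral (T e) i (g e i).

Definition polynomial_fun (k : nat) (p : 'rV[R]_n.+1 -> R) :=
  exists c : {ffun 'I_n.+1 -> 'I_k.+1} -> R, forall x,
    p x = \sum_(al : {ffun 'I_n.+1 -> 'I_k.+1} | (\sum_i al i <= k)%N)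
            c al * \prod_i x 0 i ^+ al i.

(* Functions on the closure of Om are extended by zero to the whole space, so
   that they are equal as soon as they agree on the closure of Om. *)
Definition lagrange (k : nat) (v : 'rV[R]_n.+1 -> R) :=
  [/\ {within closure Om, continuous v},
      forall x, ~ closure Om x -> v x = 0
    & forall e, exists p, polynomial_fun k p /\ {in simplex (T e), v =1 p}].

Definition Xh (k : nat) (v : 'rV[R]_n.+1 -> 'rV[R]_n.+1) :=
  (forall i, lagrange k (fun x => v x 0 i)) /\
  (forall x, bdry Om x -> v x = 0).

Definition Yh (l : nat) (q : 'rV[R]_n.+1 -> R) :=
  lagrange l q /\ \int[leb n.+1]_(x in Om) q x = 0.

(* (nabla q x n, nu curl u) on the boundary, nuG being the trace of nu *)
Definition boundary_term (nuG q : 'rV[R]_n.+1 -> R)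
    (u : 'rV[R]_n.+1 -> 'rV[R]_n.+1) : R :=
  boundary_integral (fun e i x =>
    dot (vprod (elem_trace (T e) (grad q) x) (facet_normal (T e) i))
        (nuG x *: curl_of (elem_trace (T e) (vgrad u) x))).

Definition stabilised_solution (k l : nat) (sigma delta : R)
    (nu : 'rV[R]_n.+1 -> R) (gnu : 'rV[R]_n.+1 -> 'rV[R]_n.+1)
    (nuG : 'rV[R]_n.+1 -> R) (f : 'rV[R]_n.+1 -> 'rV[R]_n.+1)
    (u : 'rV[R]_n.+1 -> 'rV[R]_n.+1) (p : 'rV[R]_n.+1 -> R) :=
  [/\ Xh k u, Yh l p,
      forall v, Xh k v ->
        sigma * L2v Om u v
        + L2m Om (fun x => (2 * nu x) *: sgrad u x) (sgrad v)
        - L2s Om p (diverg v) = L2v Om v f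
    & forall q, Yh l q ->
        L2s Om q (diverg u)
        + delta * L2v Om (grad q) (fun x =>
            grad p x + sigma *: u x
            - 2 *: ((vgrad u x)^T *m (gnu x)^T)^T - f x)
        + delta * boundary_term nuG q u = 0].

End meshes.

(* Main.v *)
(* The problem is a square linear system, so it suffices that the bilinear form is
   definite.  Testing with (v, q) = (u, p) cancels the pressure terms and leaves
     sigma |u|^2 + 2 (nu S, S) + delta (grad p, grad p + sigma u - 2 (grad u)^T grad nu)
       + delta (grad p x n, nu curl u)_Gamma,   S = sym(grad u).
   Young's inequality bounds the two cross terms by delta |grad p|^2 / 2,
   delta sigma^2 |u|^2 and 4 delta |grad nu|_oo^2 |grad u|^2.  The boundary term is
   split elementwise: the discrete trace inequality |g|^2_F <= (C1 / h) |g|^2_K for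
   polynomials on a facet F of K and Young's inequality with a weight proportional to
   h bound it by delta (|grad p|^2 / 4 + 4 C numax^2 / h^2 |grad u|^2).  Korn's
   inequality |grad u|^2 <= 2 |S|^2 on H^1_0 absorbs all multiples of |grad u|^2 into
   2 numin |S|^2, and what remains is at least
     (2/3) sigma |u|^2 + (delta / 4) |grad p|^2.
   If it vanishes then u = 0 and p is constant on each element, hence constant by
   connectedness of Om, hence zero as its mean is. *)

Require Import Defs.
From HB Require Import structures.
From mathcomp Require Import all_boot all_order all_algebra.
From mathcomp Require Import all_classical all_reals all_analysis.
From mathcomp Require Import measurable_realfun ess_sup_inf ring lra.

Set Implicit Arguments.
Unset Strict Implicit.
Unset Printing Implicit Defensive.

Import Order.TTheory GRing.Theory Num.Theory.
Import numFieldNormedType.Exports.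

Local Open Scope classical_set_scope.
Local Open Scope ring_scope.

(** * Change of variables for Lebesgue measure *)

Section LebesgueStep.
Context {R : realType}.
Local Notation lam := (@lebesgue_measure R).

(** The energy estimate is elementary; the obstacle is that its ingredients hold only almost
    everywhere or only inside elements. The bounds on [nu] and [gnu] may fail on a null set [B], and
    derivatives of discrete functions are arbitrary on the skeleton of the mesh. Every integral over
    [Om] is therefore moved to [mesh_open T] minus [B], where all integrands are under pointwise
    control.

    The trace constant must be the same for all elements. It comes from comparing two semidefinite
    forms on polynomials over the reference simplex and is carried over by an affine chart: the
    ratio of the volume factor to the facet factor is the height over the facet, which is at least
    the diameter of any inscribed ball.

    Korn's inequality rests on exchanging mixed derivatives, while discrete functions have no second
    derivatives across faces. Difference quotients of the extension by zero replace them, and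
    translation invariance of Lebesgue measure replaces integration by parts.

    The 12 in the bound on [delta] leaves room: the multiples of the full gradient use at most a
    third of the viscous term. *)

Lemma integral_lebesgue_affine (a c : R) (f : measurableTypeR R -> \bar R) : a != 0 ->
  measurable_fun setT f -> (forall x, 0 <= f x)%E ->
  (\int[lam]_x f x = `|a|%:E * \int[lam]_x f (a * x + c)%R)%E.
Proof.
move=> a0 mf f0.
pose phi : measurableTypeR R -> measurableTypeR R := fun x => a * x + c.
have mphi : measurable_fun setT phi.
  apply: measurable_funD => //; exact: measurable_funM.
have na : 0 <= `|a| by [].
pose na' := NngNum na.
pose push := measure_function_pushforward__canonical__measure_function_Measure lam mphi.
(* By uniqueness of Lebesgue measure, half-open intervals suffice. For negative [a] the preimage is
   closed at the other end, with the same length. *)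
have E X : measurable X -> lam X = mscale na' push X.
  apply: lebesgue_measure_unique => Y [[x y]] xy <-.
  change (lam `]x, y]%classic = `|a|%:E * lam (phi @^-1` `]x, y]%classic))%E.
  have [a1|a1] := ltP 0 a.
    rewrite (_ : phi @^-1` _ = `](x - c) / a, (y - c) / a]%classic); last first.
      apply/seteqP; split => t /=; rewrite !in_itv/= /phi ltr_pdivrMr// ler_pdivlMr// mulrC ltrBlDr lerBrDr//.
    rewrite !lebesgue_measure_itv/= !lte_fin ltr_pdivrMr// divfK//.
    rewrite ltrD2r; case: ifPn => // _; last by rewrite mule0.
    rewrite -!EFinD -EFinM ; congr EFin.
    rewrite gtr0_norm//. field. exact: a0.
  have {}a1 : a < 0 by rewrite lt_neqAle a0.
  rewrite (_ : phi @^-1` _ = `[(y - c) / a, (x - c) / a[%classic); last first.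
    apply/seteqP; split => t /=; rewrite !in_itv/= /phi ltr_ndivlMr// ler_ndivrMr// mulrC ltrBlDr lerBrDr// => /andP[-> ->]//.
  rewrite !lebesgue_measure_itv/= !lte_fin ltr_ndivrMr// divfK//.
  rewrite ltrD2r; case: ifPn => // _; last by rewrite mule0.
  rewrite -!EFinD -EFinM ; congr EFin.
  rewrite ltr0_norm//. field. exact: a0.
transitivity (\int[mscale na' push]_x f x)%E.
  by apply: eq_measure_integral => X mX _; exact: E.
rewrite ge0_integral_mscale//= ge0_integral_pushforward//=.
Qed.

Variable n : nat.

Lemma measurable_affine m (A : 'M[R]_(n, m)) (b : 'rV[R]_m) :
  measurable_fun [set: 'rV[R]_n] (fun x => b + x *m A).
Proof.
apply: measurable_rV => i; under eq_fun do rewrite !mxE.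
apply: measurable_funD => //; apply: measurable_sum => j.
apply: measurable_funM => //; exact: measurable_coord.
Qed.

Lemma integral_leb_step (f : 'rV[R]_n.+1 -> \bar R) :
  measurable_fun setT f -> (forall x, 0 <= f x)%E ->
  (\int[leb n.+1]_x f x = \int[lam]_t \int[leb n]_v f (rVcons (t, v)))%E.
Proof.
move=> mf f0; rewrite /= /leb_step ge0_integral_pushforward//=; last exact: measurable_rVcons.
rewrite fubini_tonelli1//=.
apply: measurableT_comp => //; exact: measurable_rVcons.
Qed.

Lemma integral_leb_step_swap (f : 'rV[R]_n.+1 -> \bar R) :
  measurable_fun setT f -> (forall x, 0 <= f x)%E ->
  (\int[leb n.+1]_x f x = \int[leb n]_v \int[lam]_t f (rVcons (t, v)))%E.
Proof.
move=> mf f0; rewrite integral_leb_step//.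
rewrite (fubini_tonelli (f \o @rVcons R n))//=.
apply: measurableT_comp => //; exact: measurable_rVcons.
Qed.

Lemma measurable_integral_rVcons1 (f : 'rV[R]_n.+1 -> \bar R) :
  measurable_fun [set: 'rV[R]_n.+1] f -> (forall x, 0 <= f x)%E ->
  measurable_fun [set: 'rV[R]_n] (fun v => \int[lam]_t f (rVcons (t, v)))%E.
Proof.
move=> mf f0; apply: (measurable_fun_fubini_tonelli_G (f \o @rVcons R n)); last by move=> x; exact: f0.
by apply: measurableT_comp => //; exact: measurable_rVcons.
Qed.

Lemma measurable_integral_rVcons2 (f : 'rV[R]_n.+1 -> \bar R) :
  measurable_fun [set: 'rV[R]_n.+1] f -> (forall x, 0 <= f x)%E ->
  measurable_fun [set: measurableTypeR R]
    (fun t => \int[leb n]_v f (rVcons (t, v)))%E.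
Proof.
move=> mf f0; apply: (measurable_fun_fubini_tonelli_F (f \o @rVcons R n)); last by move=> x; exact: f0.
by apply: measurableT_comp => //; exact: measurable_rVcons.
Qed.

(** Shows the first coordinate as a block, so that block matrices can act on [rVcons]. *)
Lemma rVconsE (t : R) (v : 'rV[R]_n) : rVcons (t, v) = row_mx t%:M v.
Proof.
apply/rowP => i; rewrite !mxE; case: splitP => j ij.
  rewrite (_ : i = ord0) ?unlift_none/= ?ord1 ?mxE//.
  by apply/val_inj; rewrite /= ij ord1.
by rewrite (_ : i = lift ord0 j) ?liftK//; apply/val_inj.
Qed.

Lemma measurable_rVcons1 (v : 'rV[R]_n) :
  measurable_fun [set: measurableTypeR R] (fun t => rVcons (t, v)).
Proof.
apply: measurable_rV => i; under eq_fun do rewrite mxE.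
case: (unlift ord0 i) => [j|] /=; first exact: measurable_cst.
exact: measurable_id.
Qed.

Lemma measurable_rVcons2 (t : R) :
  measurable_fun [set: 'rV[R]_n] (fun v => rVcons (t, v)).
Proof.
apply: measurable_rV => i; under eq_fun do rewrite mxE.
case: (unlift ord0 i) => [j|] /=; first exact: measurable_coord.
exact: measurable_cst.
Qed.

Lemma mul_rVcons_block t (v : 'rV[R]_n) (a : R) r (w : 'cV_n) (B : 'M[R]_n) :
  rVcons (t, v) *m (block_mx a%:M r w B : 'M[R]_(n.+1)) =
  rVcons (t * a + (v *m w) 0 0, t *: r + v *m B).
Proof.
rewrite !rVconsE; etransitivity; first exact: (mul_row_block t%:M v a%:M r w B).
apply: f_equal2.
- by apply/rowP => i; rewrite !ord1 !mxE big_ord1 !mxE eqxx mulr1n.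
- by rewrite mul_scalar_mx.
Qed.

End LebesgueStep.
(* The unifier otherwise unfolds the iterated product measure. *)
Opaque leb.

Section ChangeOfVariables.
Context {R : realType}.
Local Notation lam := (@lebesgue_measure R).

(** Asked of all nonnegative measurable functions, so that the property is multiplicative in [A] and
    can be built up from elementary factors. *)
Definition linear_cov n (A : 'M[R]_n) := forall f : 'rV[R]_n -> \bar R,
  measurable_fun [set: 'rV[R]_n] f -> (forall x, 0 <= f x)%E ->
  (\int[leb n]_x f x = `|\det A|%:E * \int[leb n]_x f (x *m A)%R)%E.

Lemma measurable_mulmxr n m (A : 'M[R]_(n, m)) :
  measurable_fun [set: 'rV[R]_n] (fun x : 'rV[R]_n => x *m A).
Proof.
by have := measurable_affine A 0; under eq_fun do rewrite add0r.
Qed.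

(** Tonelli and induction: the one-dimensional change of variables shifts the first coordinate at
    fixed [v], the induction hypothesis shifts the others. *)
Lemma integral_leb_translate n (b : 'rV[R]_n) (f : 'rV[R]_n -> \bar R) :
  measurable_fun [set: 'rV[R]_n] f -> (forall x, 0 <= f x)%E ->
  (\int[leb n]_x f x = \int[leb n]_x f (b + x)%R)%E.
Proof.
elim: n => [|n IH] in b f *.
  by move=> _ _; apply: eq_integral => x _; congr f; apply/rowP => -[].
move=> mf f0.
have mg (c : 'rV[R]_n.+1) : measurable_fun [set: 'rV[R]_n.+1] (fun x => f (c + x)).
  apply: (measurableT_comp mf).
  by have := measurable_affine 1%:M c; under eq_fun do rewrite mulmx1.
have E t v : b + rVcons (t, v) =
    rVcons (t + b 0 ord0, (\row_j b 0 (lift ord0 j)) + v).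
  apply/rowP => i; rewrite !mxE; case: unliftP => [j|] ->/=; first by rewrite !mxE.
  by rewrite addrC.
rewrite integral_leb_step// [RHS]integral_leb_step_swap//.
transitivity (\int[leb n]_v \int[lam]_t f (rVcons (t, v + \row_j b 0 (lift ord0 j))%R)
   )%E; last first.
  apply: eq_integral => v _.
  rewrite (@integral_lebesgue_affine _ 1 (b 0 ord0))//; last first.
    by apply: (measurableT_comp mf); exact: measurable_rVcons1.
  rewrite normr1 mul1e; apply: eq_integral => t _.
  by rewrite E mul1r [v + _]addrC.
have mG := measurable_integral_rVcons1 mf f0.
have G0 v : (0 <= \int[lam]_t f (rVcons (t, v)))%E by exact: integral_ge0.
rewrite -(integral_leb_step mf f0) (integral_leb_step_swap mf f0).
rewrite [LHS](IH (\row_j b 0 (lift ord0 j)) _ mG G0).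
by apply: eq_integral => v _; apply: eq_integral => t _; rewrite addrC.
Qed.

Lemma linear_covM n (A B : 'M[R]_n) :
  linear_cov A -> linear_cov B -> linear_cov (A *m B).
Proof.
move=> hA hB f mf f0; rewrite hB// hA//; last first.
  by apply: (measurableT_comp mf); exact: measurable_mulmxr.
rewrite muleA -EFinM -normrM -det_mulmx (det_mulmx B) (det_mulmx A) mulrC.
by congr (_ * _)%E; apply: eq_integral => x _; rewrite mulmxA.
Qed.

(** The row [(t, v)] is sent to [(t a + v w, v B)]. At fixed [v] the first coordinate undergoes an
    affine map of slope [a], so integrating in [t] first leaves only the action of [B]. *)
Lemma linear_cov_block_lower n (a : R) (w : 'cV[R]_n) (B : 'M[R]_n) :
  a != 0 -> linear_cov B -> linear_cov (block_mx a%:M 0 w B : 'M[R]_(n.+1)).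
Proof.
move=> a0 hB f mf f0.
have mG := measurable_integral_rVcons1 mf f0.
have mA := measurable_mulmxr (block_mx a%:M 0 w B : 'M[R]_(n.+1)).
have mfA := measurableT_comp mf mA.
have G0 v : (0 <= \int[lam]_t f (rVcons (t, v)))%E by exact: integral_ge0.
rewrite [X in `|X|](@det_lblock _ 1 n a%:M w B) det_scalar1 normrM EFinM.
have mG' := measurableT_comp mG (measurable_mulmxr B).
rewrite (integral_leb_step_swap mf f0) (hB _ mG G0) (integral_leb_step_swap mfA (fun x => f0 _)).
rewrite [(`|a|%:E * _)%E]muleC -muleA; congr (_ * _)%E.
rewrite -ge0_integralZl//; first last.
- by move=> v _; apply: integral_ge0 => t _; exact: f0.
- exact: measurable_integral_rVcons1 mfA (fun x => f0 _).
apply: eq_integral => v _.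
rewrite (@integral_lebesgue_affine _ a ((v *m w) 0 0))//; last first.
  by apply: (measurableT_comp mf); exact: measurable_rVcons1.
congr (_ * _)%E; apply: eq_integral => t _.
by rewrite /comp mul_rVcons_block scaler0 add0r mulrC.
Qed.

(** The row [(t, v)] is sent to [(t a, t r + v B)]. Here [t] has to be the outer variable, and the
    shift [t r] of the inner one is absorbed by translation invariance. *)
Lemma linear_cov_block_upper n (a : R) (r : 'rV[R]_n) (B : 'M[R]_n) :
  a != 0 -> linear_cov B -> linear_cov (block_mx a%:M r 0 B : 'M[R]_(n.+1)).
Proof.
move=> a0 hB f mf f0.
have mA := measurable_mulmxr (block_mx a%:M r 0 B : 'M[R]_(n.+1)).
have mfA := measurableT_comp mf mA.
have mG := measurable_integral_rVcons2 mf f0.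
have G0 t : (0 <= \int[leb n]_v f (rVcons (t, v)))%E by exact: integral_ge0.
rewrite [X in `|X|](@det_ublock _ 1 n a%:M r B) det_scalar1 normrM EFinM.
rewrite (integral_leb_step mf f0) (integral_leb_step mfA (fun x => f0 _)).
rewrite (integral_lebesgue_affine 0 a0 mG G0) -muleA; congr (_ * _)%E.
have mG' := measurable_integral_rVcons2 mfA (fun x => f0 _).
rewrite -ge0_integralZl//; last by move=> t _; apply: integral_ge0 => v _; exact: f0.
apply: eq_integral => t _.
have mh := measurableT_comp mf (measurable_rVcons2 (a * t + 0)).
have mT (b : 'rV[R]_n) : measurable_fun [set: 'rV[R]_n] (fun x => b + x).
  by have := measurable_affine 1%:M b; under eq_fun do rewrite mulmx1.
rewrite (integral_leb_translate (t *: r))//.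
have mhT := measurableT_comp mh (mT (t *: r)).
rewrite hB//.
congr (_ * _)%E; apply: eq_integral => v _.
by rewrite /comp mul_rVcons_block mulmx0 mxE !addr0 mulrC.
Qed.

Lemma linear_cov1 n : linear_cov (1%:M : 'M[R]_n).
Proof.
by move=> f mf f0; rewrite det1 normr1 mul1e; apply: eq_integral => x _; rewrite mulmx1.
Qed.

(* A block LU step if the pivot is nonzero; otherwise a shear, itself block
   triangular, makes it so. *)
Lemma unitmx_linear_cov n (A : 'M[R]_n) : A \in unitmx -> linear_cov A.
Proof.
elim: n => [|n IH] in A *.
  move=> _ f mf f0; rewrite det_mx00 normr1 mul1e.
  by apply: eq_integral => x _; congr f; apply/rowP => -[].
have pivot (A' : 'M[R]_n.+1) : A' 0 0 != 0 -> A' \in unitmx -> linear_cov A'.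
  move=> A0; set r := @ursubmx _ 1 n 1 n A'; set w := @dlsubmx _ 1 n 1 n A'.
  (* Schur complement of the pivot; its invertibility is read off the determinant of the second
     factor. *)
  pose B := @drsubmx _ 1 n 1 n A' - (A' 0 0)^-1 *: (w *m r).
  have -> : A' = (block_mx 1%:M 0 ((A' 0 0)^-1 *: w) 1%:M : 'M[R]_(n.+1)) *m
     (block_mx (A' 0 0)%:M r 0 B : 'M[R]_(n.+1)).
    rewrite [RHS](@mulmx_block _ 1 n 1 n 1 n) !mul0mx !mul1mx !addr0.
    rewrite mul_mx_scalar scalerA divff// scale1r -scalemxAl /B addrCA subrr addr0.
    rewrite -[LHS](@submxK _ 1 n 1 n) [ulsubmx _]mx11_scalar; apply: f_equal4 => //.
    by rewrite !mxE; congr (A' _ _)%:M; apply/val_inj.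
  rewrite unitmx_mul => /andP[_ uB]; apply: linear_covM.
    by apply: linear_cov_block_lower; [exact: oner_neq0|exact: linear_cov1].
  apply: linear_cov_block_upper => //; apply: IH.
  move: uB; rewrite !unitmxE [X in X \is a _ -> _](@det_ublock _ 1 n) unitrM.
  by case/andP.
have [A0|A0] := eqVneq (A 0 0) 0; last exact: pivot.
move=> uA.
have [j Aj] : exists j, A 0 j != 0.
  apply/existsP; apply: contraTT uA; rewrite negb_exists => /forallP A0j.
  rewrite unitmxE unitfE negbK (expand_det_row _ 0) big1// => j _.
  by have := A0j j; rewrite negbK => /eqP ->; rewrite mul0r.
have j0 : j != 0 by apply: contraNneq Aj => ->; rewrite A0.
have [j' jE] : exists j' : 'I_n, j = lift ord0 j'.
  by case: (unliftP ord0 j) j0 => [j' ->|->]; [exists j'|rewrite eqxx].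
(* [S 1] adds column [j] to the first column, so the new pivot is [A 0 0 + A 0 j], which is
   nonzero. *)
pose S (s : R) : 'M[R]_n.+1 := @block_mx R 1 n 1 n 1%:M 0 (s *: delta_mx j' 0) 1%:M.
have S1 : S 1 *m S (-1) = 1%:M.
  rewrite [LHS](@mulmx_block _ 1 n 1 n 1 n) !mul0mx !mul1mx !mulmx0 !mulmx1 !addr0 !add0r.
  by rewrite scale1r scaleN1r subrr -scalar_mx_block.
have /mulmx1_unit[uS _] := S1.
have -> : A = (A *m S 1) *m S (-1) by rewrite -mulmxA S1 mulmx1.
apply: linear_covM.
  apply: pivot; last by rewrite unitmx_mul uA.
  suff -> : (A *m S 1) 0 0 = A 0 0 + A 0 j by rewrite A0 add0r.
  have e0 : (0 : 'I_n.+1) = lshift n (0 : 'I_1) by apply/val_inj.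
  have el (i : 'I_n) : lift ord0 i = rshift 1 i by apply/val_inj.
  rewrite mxE big_ord_recl (_ : S 1 ord0 0 = 1); last first.
    by rewrite (_ : ord0 = 0)// e0 /S (@block_mxEul R 1 n 1 n) mxE eqxx.
  rewrite mulr1 (bigD1 j')//= big1 ?addr0.
    rewrite (_ : S 1 (lift ord0 j') 0 = 1) ?mulr1 ?jE//.
    by rewrite el e0 /S (@block_mxEdl R 1 n 1 n) !mxE !eqxx mulr1.
  move=> i ij; rewrite (_ : S 1 (lift ord0 i) 0 = 0) ?mulr0//.
  by rewrite el e0 /S (@block_mxEdl R 1 n 1 n) !mxE (negbTE ij) mulr0.
by apply: linear_cov_block_lower; [exact: oner_neq0|exact: linear_cov1].
Qed.

Lemma integral_leb_affine n (A : 'M[R]_n) (b : 'rV[R]_n) (f : 'rV[R]_n -> \bar R) :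
  A \in unitmx -> measurable_fun [set: 'rV[R]_n] f -> (forall x, 0 <= f x)%E ->
  (\int[leb n]_x f x = `|\det A|%:E * \int[leb n]_x f (b + x *m A)%R)%E.
Proof.
move=> uA mf f0; rewrite (integral_leb_translate b mf f0).
have mT : measurable_fun [set: 'rV[R]_n] (fun x => b + x).
  by have := measurable_affine 1%:M b; under eq_fun do rewrite mulmx1.
exact: (unitmx_linear_cov uA (measurableT_comp mf mT) (fun x => f0 _)).
Qed.

Import HBNNSimple.

(** Holds for arbitrary [f]: the integral of a nonnegative function is a supremum over simple
    functions below it, and cutting such a function off on [N] does not change its integral. This is
    what allows derivatives to take any value on the mesh skeleton. *)
Lemma integral_null_set d (T : measurableType d) (mu : {measure set T -> \bar R})
  (D N : set T) (f : T -> \bar R) : measurable N -> mu N = 0%E ->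
  (\int[mu]_(x in D) f x = \int[mu]_(x in D `\` N) f x)%E.
Proof.
move=> mN N0.
have mNC : measurable (~` N) by exact: measurableC.
have H (g : T -> \bar R) : (forall x, 0 <= g x)%E ->
    (\int[mu]_x g x = \int[mu]_x (g \_ (~` N)) x)%E.
  move=> g0; apply/eqP; rewrite eq_le; apply/andP; split; last first.
    rewrite !ge0_integralTE//; last by move=> x; rewrite patchE; case: ifP.
    apply: ereal_sup_le => _ /= [h hg <-]; exists h => // x.
    by apply: (le_trans (hg x)); rewrite patchE; case: ifP => // _; exact: g0.
  rewrite !ge0_integralTE//; last by move=> x; rewrite patchE; case: ifP.
  apply: ub_ereal_sup => _ /= [h hg <-].
  apply: ereal_sup_ubound; exists (proj_nnsfun h mNC).
    move=> x; rewrite /= patchE mindicE; case: ifPn => xN.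
      by rewrite mulr1; exact: hg.
    by rewrite mulr0.
  rewrite -mrestrict -integral_nnsfun//.
  have -> : sintegral mu h = (\int[mu]_x (h x)%:E)%E.
    by rewrite integral_nnsfun// patch_setT.
  rewrite [RHS](ge0_negligible_integral mN)//; first by rewrite setTD.
  - exact/measurable_EFinP.
  - by move=> x _; rewrite lee_fin.
rewrite integral_mkcond [RHS]integral_mkcond integralE [RHS]integralE.
congr (_ - _)%E.
- rewrite H//; apply: eq_integral => x _; rewrite !funepos_restrict !patchE in_setD in_setC.
  by case: (x \in D); case: (x \in N).
- rewrite H//; apply: eq_integral => x _; rewrite !funeneg_restrict !patchE in_setD in_setC.
  by case: (x \in D); case: (x \in N).
Qed.

End ChangeOfVariables.

(** * Borel sets and null sets of Lebesgue measure *)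

Section LebesgueBorel.
Context {R : realType}.
Local Notation lam := (@lebesgue_measure R).

Definition cube n (c : 'rV[R]_n) (r : R) : set 'rV[R]_n :=
  [set x | forall i, `|x 0 i - c 0 i| < r].

Lemma measurable_cube n (c : 'rV[R]_n) r : measurable (cube c r).
Proof.
rewrite (_ : cube c r = \bigcap_(i in [set: 'I_n])
    ((fun x : 'rV[R]_n => x 0 i) @^-1` [set t | `|t - c 0 i| < r])); last first.
  by apply/seteqP; split => x /=; [move=> h i _; exact: h | move=> h i; exact: h].
apply: fin_bigcap_measurable => // i _; rewrite -[X in measurable X]setTI.
apply: measurable_coord => //.
have -> : [set t | `|t - c 0 i| < r] = ball (c 0 i) r.
  by apply/seteqP; split => t; rewrite /ball/= distrC.
exact: measurable_ball.
Qed.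

Lemma cube_ball n (c : 'rV[R]_n) r : 0 < r -> cube c r = ball c r.
Proof.
move=> r0; apply/seteqP; split => x.
  move=> h; rewrite /ball/=; split=> // i j; rewrite ord1 /ball/= distrC; exact: h.
by move=> h i; have [_ /(_ 0 i)] := h; rewrite /ball/= distrC.
Qed.

(** The measurable sets are those of the product sigma-algebra. An open set is the union of the
    cubes inside it that have a rational centre and a radius [1/(k+1)], and these are countably
    many. *)
Lemma measurable_open_rV n (A : set 'rV[R]_n) : open A -> measurable A.
Proof.
move=> oA.
pose B (m : nat) : set 'rV[R]_n :=
  if unpickle m is Some (q, k) then
    let C := cube (map_mx ratr (q : 'rV[rat]_n)) (k : nat).+1%:R^-1 in
    if `[< C `<=` A >] then C else set0
  else set0.
have -> : A = \bigcup_m B m.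
  apply/seteqP; split => [x Ax|x [m _]]; last first.
    by rewrite /B; case: unpickle => // -[q k] /=; case: asboolP => // + ?; exact.
  have /nbhs_ballP[e /= e0 eA] : nbhs x A by exact: open_nbhs_nbhs.
  (* Half of [e] is spent on the distance from [x] to the rational centre, the other half on the
     radius of the cube. *)
  have [k ke] : exists k : nat, k.+1%:R^-1 < e / 2 :> R.
    have /archi_boundP := ltW (divr_gt0 (@ltr0Sn R 1) e0).
    set k := Num.bound _ => ke; exists k.
    rewrite invf_plt ?posrE ?divr_gt0 // invf_div (lt_le_trans ke)//.
    by rewrite ler_nat.
  have k0 : 0 < k.+1%:R^-1 :> R by rewrite invr_gt0.
  have /choice[q qx] : forall i, exists q : rat, `|x 0 i - ratr q| < k.+1%:R^-1.
    move=> i; have /rat_in_itvoo[q] : x 0 i - k.+1%:R^-1 < x 0 i by rewrite ltrBlDr ltrDl.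
    rewrite in_itv/= => /andP[q1 q2]; exists q.
    by move: (k.+1%:R^-1) q1 => d q1; rewrite ltr_norml; apply/andP; split; lra.
  exists (pickle ((\row_i q i : 'rV[rat]_n), k)) => //; rewrite /B pickleK /=.
  have Cx : cube (map_mx ratr (\row_i q i)) k.+1%:R^-1 x by move=> i; rewrite !mxE.
  case: asboolP => // -[] y Cy; apply: eA; rewrite -cube_ball// => i.
  rewrite (splitr e); apply: (@le_lt_trans _ _ (`|y 0 i - ratr (q i)| + `|x 0 i - ratr (q i)|)).
    by rewrite (distrC (x 0 i)); exact: ler_distD.
  apply: ltrD; last exact: lt_trans (qx i) ke.
  by apply: lt_trans ke; have := Cy i; rewrite !mxE.
apply: bigcupT_measurable => m; rewrite /B; case: unpickle => // -[q k] /=.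
by case: asboolP => // _; exact: measurable_cube.
Qed.

Lemma measurable_closed_rV n (A : set 'rV[R]_n) : closed A -> measurable A.
Proof.
by move=> cA; rewrite -[A]setCK; apply: measurableC; apply: measurable_open_rV; exact: closed_openC.
Qed.

Lemma measurable_within_continuous n (A : set 'rV[R]_n) (f : 'rV[R]_n -> R) :
  measurable A -> {within A, continuous f} ->
  measurable_fun A (f : _ -> measurableTypeR R).
Proof.
move=> mA cf; apply: (measurability _ (RGenOpens.measurableE R)).
move=> _ [_ [a [b ->] <-]].
have : open (f @^-1` `]a, b[%classic : set (subspace A)).
  by move/continuousP : cf; apply; exact: interval_open.
move=> oV; have [U oU UE] := (open_subspaceP _ _).1 oV.
by rewrite setIC -UE; apply: measurableI => //; exact: measurable_open_rV.
Qed.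

Lemma measurable_continuous_rV n (f : 'rV[R]_n -> R) :
  continuous f -> measurable_fun setT (f : _ -> measurableTypeR R).
Proof.
move=> cf; apply: measurable_within_continuous => //.
exact: continuous_subspaceT.
Qed.

Lemma leb_setX n (A : set (measurableTypeR R)) (B : set 'rV[R]_n) : measurable A -> measurable B ->
  leb n.+1 [set x | A (x 0 ord0) /\ B (\row_j x 0 (lift ord0 j))] = (lam A * leb n B)%E.
Proof.
move=> mA mB.
Transparent leb.
rewrite /= /leb_step /pushforward.
Opaque leb.
rewrite -(product_measure1E lam (leb n) mA mB)//.
apply: f_equal; apply/seteqP; split => -[a v] /=; rewrite mxE unlift_none/=.
  move=> [? h]; split => //; move: h; congr B; apply/rowP => j; by rewrite !mxE liftK.
move=> [? h]; split => //; move: h; congr B; apply/rowP => j; by rewrite !mxE liftK.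
Qed.

Lemma leb_cube n (c : 'rV[R]_n) r : 0 < r -> leb n (cube c r) = ((r *+ 2) ^+ n)%:E.
Proof.
move=> r0; elim: n => [|n IH] in c *.
Transparent leb.
  by rewrite expr0 /= diracE mem_set//; case.
Opaque leb.
pose c' := \row_j c 0 (lift ord0 j).
have -> : cube c r = [set x | ball (c 0 ord0) r (x 0 ord0) /\ cube c' r (\row_j x 0 (lift ord0 j))].
  apply/seteqP; split => x.
    by move=> h; split; [rewrite /ball/= distrC; exact: h|move=> i; rewrite !mxE; exact: h].
  move=> [h1 h2] i; case: (unliftP ord0 i) => [j|] ->; last by rewrite distrC.
  by have := h2 j; rewrite !mxE.
rewrite (leb_setX (measurable_ball _ _) (measurable_cube _ _)) IH.
by rewrite lebesgue_measure_ball ?ltW// -EFinM exprS.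
Qed.

Lemma coord_le_norm n (x : 'rV[R]_n) i : `|x 0 i| <= `|x|.
Proof.
rewrite [leRHS]mx_normrE.
exact: (le_bigmax _ (fun i : 'I_1 * 'I_n => `|x i.1 i.2|) (0, i)).
Qed.

Lemma leb_bounded_lty n (A : set 'rV[R]_n) : bounded_set A -> measurable A -> (leb n A < +oo)%E.
Proof.
move=> [M [Mr hM]] mA.
have := hM (`|M| + 1); rewrite (@le_lt_trans _ _ `|M|) ?ler_norm ?ltrDl// => /(_ isT) h.
apply: (@le_lt_trans _ _ (leb n (cube 0 (`|M| + 2)))); last first.
  by rewrite leb_cube ?ltry// ltr_wpDl.
apply: le_measure; rewrite ?inE//; first exact: measurable_cube.
move=> x Ax i; rewrite mxE subr0; apply: (@le_lt_trans _ _ (`|M| + 1)).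
  exact: le_trans (coord_le_norm _ _) (h x Ax).
by rewrite ltrD2l ltr1n.
Qed.

Lemma leb_open_gt0 n (A : set 'rV[R]_n) : open A -> A !=set0 -> (0 < leb n A)%E.
Proof.
move=> oA [x Ax].
have /nbhs_ballP[e /= e0 eA] : nbhs x A by exact: open_nbhs_nbhs.
apply: (@lt_le_trans _ _ (leb n (cube x e))).
  by rewrite leb_cube// lte_fin exprn_gt0// mulrn_wgt0.
apply: le_measure; rewrite ?inE//; first exact: measurable_cube.
- exact: measurable_open_rV.
- by rewrite cube_ball.
Qed.

(** Slicing: if the first coefficient of [c] vanishes, the slices at fixed [t] are hyperplanes one
    dimension lower; otherwise the slices at fixed [v] are single points. *)
Lemma leb_hyperplane n (c : 'rV[R]_n) (a : R) : c != 0 ->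
  leb n [set x | dot c x = a] = 0%E.
Proof.
elim: n => [|n IH] in c a *; first by rewrite [c]thinmx0 eqxx.
move=> c0.
have mH m (d : 'rV[R]_m) b : measurable [set x | dot d x = b].
  have : measurable_fun setT (fun x : 'rV[R]_m => dot d x : measurableTypeR R).
    apply: measurable_sum => i; apply: measurable_funM => //; exact: measurable_coord.
  by move=> /(_ measurableT [set b] (measurable_set1 b)); rewrite setTI.
rewrite -[X in leb _ X]setIT -integral_indic//; last exact: mH.
have mi : measurable_fun [set: 'rV[R]_n.+1] (fun x => (\1_[set x | dot c x = a] x : R)%:E).
  by apply/measurable_EFinP; apply: measurable_indic; exact: mH.
have i0 (x : 'rV[R]_n.+1) : (0 <= (\1_[set x | dot c x = a] x : R)%:E)%E by rewrite lee_fin.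
pose c' := \row_j c 0 (lift ord0 j).
have E t v : dot c (rVcons (t, v)) = c 0 ord0 * t + dot c' v.
  rewrite /dot big_ord_recl mxE unlift_none; congr (_ + _).
  by apply: eq_bigr => i _; rewrite !mxE liftK.
have [c00|c00] := eqVneq (c 0 ord0) 0.
  have c'0 : c' != 0.
    apply: contraNneq c0 => c'0; apply/eqP/rowP => i; rewrite mxE.
    case: (unliftP ord0 i) => [j|] -> //; have /rowP/(_ j) := c'0; by rewrite !mxE.
  rewrite (integral_leb_step mi i0) integral0_eq// => t _.
  rewrite -[RHS](IH _ a c'0) -[X in _ = leb _ X]setIT -integral_indic//.
    apply: eq_integral => v _; rewrite !indicE; congr (_%:R%:E); congr nat_of_bool.
    by apply/idP/idP; rewrite !in_setE /= E c00 mul0r add0r.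
  exact: mH.
rewrite (integral_leb_step_swap mi i0) integral0_eq// => v _.
pose t0 := (a - dot c' v) / c 0 ord0.
rewrite -[RHS](lebesgue_measure_set1 t0) -[X in _ = _ X]setIT -integral_indic//.
apply: eq_integral => t _; rewrite !indicE; congr (_%:R%:E); congr nat_of_bool.
apply/idP/idP; rewrite !in_setE /= E /t0 => h; last by rewrite h mulrC divfK// subrK.
by rewrite -h addrK mulrC mulKf.
Qed.

End LebesgueBorel.

(** * Finite-dimensional linear algebra *)

Section GalerkinSystem.
Context {R : realType} (V : lmodType R).
Implicit Types (W : set V) (s : seq V).

Definition subspace_of W := W 0 /\ forall a u v, W u -> W v -> W (a *: u + v).

(** Linearity is required on [W] only, since the forms in question involve derivatives and
    integrals, which are not additive on arbitrary functions. *)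
Definition linear_on W (f : V -> R) :=
  forall a u v, W u -> W v -> f (a *: u + v) = a * f u + f v.

Definition bilinear_on W (b : V -> V -> R) :=
  (forall u, W u -> linear_on W (b u)) /\ (forall v, W v -> linear_on W (b^~ v)).

Fixpoint lspan s (v : V) : Prop :=
  if s is w :: s' then exists a u, lspan s' u /\ v = a *: w + u else v = 0.

Lemma lspan_subspace s : subspace_of (lspan s).
Proof.
elim: s => [|w s [IH0 IH]] /=; first by split=> // a u v -> ->; rewrite scaler0 addr0.
split; first by exists 0, 0; rewrite scale0r addr0.
move=> a u v [b [u' [hu ->]]] [c [v' [hv ->]]].
exists (a * b + c), (a *: u' + v'); split; first exact: IH.
by rewrite scalerDr scalerA addrACA -scalerDl.
Qed.

Lemma linear_on0 W f : subspace_of W -> linear_on W f -> f 0 = 0.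
Proof.
move=> [W0 _] hf; have := hf 1 0 0 W0 W0; rewrite scale1r addr0 mul1r.
by move/eqP; rewrite eq_sym -subr_eq0 addrK => /eqP.
Qed.

(* No basis is extracted: induction on the spanning list, correcting the new
   direction so that it becomes B-orthogonal to the smaller space. *)
Lemma galerkin s W (B : V -> V -> R) (F : V -> R) :
  subspace_of W -> W `<=` lspan s -> bilinear_on W B -> linear_on W F ->
  (forall w, W w -> B w w = 0 -> w = 0) ->
  exists w, W w /\ forall z, W z -> B w z = F z.
Proof.
elim: s => [|phi s IH] in W F *.
  move=> sW Ws [Bl Br] lF _; exists 0; split; first exact: sW.1.
  move=> z /Ws /= ->; rewrite (linear_on0 sW lF).
  by rewrite (linear_on0 sW (Bl _ sW.1)).
move=> sW Ws [Bl Br] lF Bd.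
have [Ws'|] := pselect (W `<=` lspan s); first exact: IH.
move=> /existsNP[w0 /not_implyP[Ww0 w0s]].
have [c [u0 [su0 w0E]]] := Ws _ Ww0.
have c0 : c != 0 by apply: contra_notN w0s => /eqP c0; rewrite w0E c0 scale0r add0r.
pose W' := W `&` lspan s.
have sW' : subspace_of W'.
  split; first by split; [exact: sW.1|exact: (lspan_subspace s).1].
  move=> a u v [Wu su] [Wv sv]; split; first exact: sW.2.
  exact: (lspan_subspace s).2.
have linW' (f : V -> R) : linear_on W f -> linear_on W' f.
  by move=> lf a u v [Wu _] [Wv _]; exact: lf.
have bW' : bilinear_on W' B.
  by split=> u [Wu _]; apply: linW'; [exact: Bl|exact: Br].
have dW' w : W' w -> B w w = 0 -> w = 0 by move=> [Ww _]; exact: Bd.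
have sub' : W' `<=` lspan s by move=> ? [].
have [z0 [[Wz0 sz0] z0P]] := IH W' (B w0) sW' sub' bW' (linW' _ (Bl _ Ww0)) dW'.
have [w1 [[Ww1 sw1] w1P]] := IH W' F sW' sub' bW' (linW' _ lF) dW'.
pose e := w0 - z0.
have We : W e by rewrite /e addrC -scaleN1r; exact: sW.2.
have eP z : W' z -> B e z = 0.
  move=> W'z; have [Wz _] := W'z.
  by rewrite /e addrC -scaleN1r (Br _ Wz)// (z0P _ W'z) mulN1r addNr.
have Bee : B e e != 0.
  apply: contra_notN w0s => /eqP/(Bd _ We)/eqP; rewrite subr_eq0 => /eqP ->.
  exact: sz0.
(* Since [B e] vanishes on [W'], adding a multiple of [e] to [w1] keeps the equations on [W']; this
   multiple settles the equation tested with [e]. *)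
pose t := (F e - B w1 e) / B e e.
exists (t *: e + w1); split; first exact: sW.2.
move=> z Wz; have [a [u [su zE]]] := Ws _ Wz.
pose y := z - (a / c) *: e.
have Wy : W y by rewrite /y addrC -scaleNr; exact: sW.2.
have ss := lspan_subspace s.
have W'y : W' y.
  split=> //.
  have -> : y = (- (a / c)) *: u0 + ((a / c) *: z0 + u).
    rewrite /y /e zE w0E !scalerBr scalerDr scalerA divfK// scaleNr opprB opprD.
    by rewrite addrAC addrCA [_ + (- _ - _)]addrA subrr add0r [RHS]addrA [- _ + _]addrC.
  by apply: ss.2 => //; exact: ss.2.
have -> : z = (a / c) *: e + y by rewrite /y addrCA subrr addr0.
have Wte : W (t *: e + w1) by exact: sW.2.
rewrite (Bl _ Wte)// lF// !(Br _ We)// !(Br _ Wy)// (eP _ W'y) (w1P _ W'y) mulr0 add0r.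
by congr (_ * _ + _); rewrite /t divfK// subrK.
Qed.

Section SemidefiniteForms.
Variables (W : set V) (b : V -> V -> R).
Hypotheses (sW : subspace_of W) (bb : bilinear_on W b).
Hypothesis bs : forall u v, W u -> W v -> b u v = b v u.
Hypothesis b0 : forall u, W u -> 0 <= b u u.

Lemma bilinear_expand a u v : W u -> W v ->
  b (a *: u + v) (a *: u + v) = a ^+ 2 * b u u + a * b u v *+ 2 + b v v.
Proof.
move=> Wu Wv; have Wuv : W (a *: u + v) by exact: sW.2.
rewrite (bb.1 _ Wuv)// (bb.2 _ Wu)// (bb.2 _ Wv)// (bs Wv Wu); ring.
Qed.

Lemma psd_Cauchy_Schwarz u v : W u -> W v -> b u v ^+ 2 <= b u u * b v v.
Proof.
move=> Wu Wv; have [u0|u0] := eqVneq (b u u) 0.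
  have [->|uv] := eqVneq (b u v) 0; first by rewrite u0 mul0r expr0n.
  (* With [b u u = 0] the expanded form is affine in the coefficient, and this coefficient makes it
     equal to -1. *)
  have := b0 (sW.2 (- (b v v + 1) / (b u v *+ 2)) u v Wu Wv).
  rewrite bilinear_expand// u0 mulr0 add0r -mulrnAr divfK; last by rewrite mulrn_eq0.
  by rewrite addrC opprD addrA subrr add0r oppr_ge0 ler10.
have p : 0 < b u u by rewrite lt_neqAle eq_sym u0 b0.
have := b0 (sW.2 (- b u v / b u u) u v Wu Wv).
rewrite bilinear_expand// -(pmulr_rge0 _ p).
suff -> : b u u * ((- b u v / b u u) ^+ 2 * b u u + - b u v / b u u * b u v *+ 2 + b v v)
   = b u u * b v v - b u v ^+ 2 by rewrite subr_ge0.
by field.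
Qed.

End SemidefiniteForms.

(* Equivalence of norms in finite dimension, for seminorms. *)
Lemma psd_dominated s W (b1 b2 : V -> V -> R) :
  subspace_of W -> bilinear_on W b1 -> bilinear_on W b2 ->
  (forall u v, W u -> W v -> b1 u v = b1 v u) ->
  (forall u v, W u -> W v -> b2 u v = b2 v u) ->
  (forall u, W u -> 0 <= b1 u u) -> (forall u, W u -> 0 <= b2 u u) ->
  (forall u, W u -> b1 u u = 0 -> b2 u u = 0) -> {in s, forall u, W u} ->
  exists2 C : R, 0 <= C & forall u, lspan s u -> b2 u u <= C * b1 u u.
Proof.
move=> sW bb1 bb2 s1 s2 p1 p2 ker.
have lW t : {in t, forall u, W u} -> forall u, lspan t u -> W u.
  elim: t => [|w t IH] /= Wt u; first by move=> ->; exact: sW.1.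
  move=> [a [v [sv ->]]]; apply: sW.2; first by apply: Wt; rewrite inE eqxx.
  by apply: IH => // x xt; apply: Wt; rewrite inE xt orbT.
move: {2}(size s) (erefl (size s)) => k; elim: k s => [|k IH] [|phi s] //=.
  by move=> _ _; exists 0 => // u ->; rewrite mul0r (linear_on0 sW (bb2.1 _ sW.1)).
move=> [ks] Ws.
have Wphi : W phi by apply: Ws; rewrite inE eqxx.
have {}Ws u : u \in s -> W u by move=> us; apply: Ws; rewrite inE us orbT.
have [phi0|phi0] := eqVneq (b1 phi phi) 0.
  have [C C0 hC] := IH _ ks Ws; exists C => // _ [a [u [su ->]]].
  have Wu := lW _ Ws _ su.
  have sq0 (x y : R) : x ^+ 2 <= 0 * y -> x = 0.
    by rewrite mul0r => h; apply/eqP; rewrite -sqrf_eq0 eq_le h sqr_ge0.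
  have e1 : b1 phi u = 0.
    by apply: (sq0 _ (b1 u u)); rewrite -phi0; exact: (psd_Cauchy_Schwarz sW).
  have e2 : b2 phi u = 0.
    apply: (sq0 _ (b2 u u)); rewrite -(ker _ Wphi phi0).
    exact: (psd_Cauchy_Schwarz sW).
  by rewrite !(bilinear_expand sW)// phi0 ker// e1 e2 !mulr0 mul0rn !add0r hC.
(* Makes the remaining vectors [b1]-orthogonal to [phi], so that [b1] splits into two squares, while
   together with [phi] they still span everything. *)
pose pr u := u - (b1 phi u / b1 phi phi) *: phi.
have Wpr u : W u -> W (pr u) by move=> Wu; rewrite /pr addrC -scaleNr; exact: sW.2.
have prE u : W u -> b1 phi (pr u) = 0.
  by move=> Wu; rewrite /pr addrC -scaleNr (bb1.1 _ Wphi)// mulNr divfK// addNr.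
have Ws' : {in map pr s, forall u, W u} by move=> ? /mapP[x /Ws Wx ->]; exact: Wpr.
have orth t u : {in t, forall u, W u} -> lspan (map pr t) u -> b1 phi u = 0.
  elim: t u => [|w t IHt] u /= Wt; first by move=> ->; exact: linear_on0 sW (bb1.1 _ Wphi).
  have Wt' v : v \in t -> W v by move=> vt; apply: Wt; rewrite inE vt orbT.
  have Ww : W w by apply: Wt; rewrite inE eqxx.
  move=> [a [v [sv ->]]]; rewrite (bb1.1 _ Wphi)//; last 2 first.
  - exact: Wpr.
  - by apply: (lW (map pr t)) => // ? /mapP[x /Wt' Wx ->]; exact: Wpr.
  by rewrite prE// mulr0 add0r IHt.
have resp t u : lspan t u -> exists a v, lspan (map pr t) v /\ u = a *: phi + v.
  elim: t u => [|w t IHt] u /=; first by move=> ->; exists 0, 0; rewrite scale0r addr0.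
  move=> [a [v [/IHt[c [v' [sv' ->]]] ->]]].
  exists (a * (b1 phi w / b1 phi phi) + c), (a *: pr w + v'); split; first by exists a, v'.
  by rewrite /pr scalerBr scalerDl scalerA addrACA [_ + (_ - _)]addrCA subrr addr0.
have [C C0 hC] := IH (map pr s) (etrans (size_map _ _) ks) Ws'.
(* For [b2] the square of a sum is at most twice the sum of the squares; each of these is compared
   with its summand in the orthogonal splitting of [b1]. *)
exists (2 * b2 phi phi / b1 phi phi + 2 * C).
  by rewrite addr_ge0 ?divr_ge0 ?mulr_ge0 ?p1 ?p2.
move=> _ [a [u [/resp[c [v [sv ->]]] ->]]]; rewrite addrA -scalerDl; set d := a + c.
have Wv := lW _ Ws' _ sv.
rewrite (bilinear_expand sW bb1 s1)// (orth s v Ws sv) mulr0 mul0rn addr0.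
have h : b2 (d *: phi + v) (d *: phi + v) <= 2 * (d ^+ 2 * b2 phi phi) + 2 * b2 v v.
  have := p2 _ (sW.2 (- d) phi v Wphi Wv).
  rewrite !(bilinear_expand sW bb2 s2)//; lra.
apply: (le_trans h); rewrite mulrDr; apply: lerD.
  have -> : 2 * (d ^+ 2 * b2 phi phi) = 2 * b2 phi phi / b1 phi phi * (d ^+ 2 * b1 phi phi).
    by field.
  rewrite [leRHS]mulrDl lerDl; apply: mulr_ge0; first by rewrite mulr_ge0.
  by apply: mulr_ge0; [exact: sqr_ge0|exact: p1].
apply: (@le_trans _ _ (2 * C * b1 v v)); first by rewrite -mulrA ler_wpM2l// hC.
by rewrite [leRHS]mulrDl lerDr !mulr_ge0 ?invr_ge0 ?p1 ?p2.
Qed.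

End GalerkinSystem.

(** * Euclidean inner product and norm *)

Section EuclideanDot.
Context {R : realType} {n : nat}.
Implicit Types u v w : 'rV[R]_n.

Lemma dotC u v : dot u v = dot v u.
Proof. by apply: eq_bigr => i _; rewrite mulrC. Qed.
Lemma dotDr u v w : dot u (v + w) = dot u v + dot u w.
Proof. by rewrite -big_split; apply: eq_bigr => i _; rewrite mxE mulrDr. Qed.
Lemma dotZr a u v : dot u (a *: v) = a * dot u v.
Proof. by rewrite /dot mulr_sumr; apply: eq_bigr => i _; rewrite mxE mulrCA. Qed.
Lemma dotDl u v w : dot (v + w) u = dot v u + dot w u.
Proof. by rewrite dotC dotDr !(dotC u). Qed.
Lemma dotZl a u v : dot (a *: u) v = a * dot u v.
Proof. by rewrite dotC dotZr dotC. Qed.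
Lemma dot_ge0 u : 0 <= dot u u.
Proof. by apply: sumr_ge0 => i _; rewrite -expr2 sqr_ge0. Qed.
Lemma dot_eq0 u : dot u u = 0 -> u = 0.
Proof.
move/eqP; rewrite psumr_eq0; last by move=> i _; rewrite -expr2 sqr_ge0.
move/allP => h; apply/rowP => i; rewrite mxE.
by have := h i (mem_index_enum _); rewrite /= mulf_eq0 orbb => /eqP.
Qed.

Lemma dot_Cauchy_Schwarz u v : dot u v ^+ 2 <= dot u u * dot v v.
Proof.
apply: (@psd_Cauchy_Schwarz R 'rV[R]_n setT dot) => //.
- by split=> w _ a x y _ _; rewrite ?dotDr ?dotZr ?dotDl ?dotZl.
- by move=> x y _ _; exact: dotC.
- by move=> x _; exact: dot_ge0.
Qed.

Lemma sqr_enorm u : enorm u ^+ 2 = dot u u.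
Proof. by rewrite sqr_sqrtr// dot_ge0. Qed.

Lemma enorm_ge0 u : 0 <= enorm u. Proof. exact: sqrtr_ge0. Qed.

Lemma sqr_coord_le_dot u i : u 0 i ^+ 2 <= dot u u.
Proof.
rewrite /dot (bigD1 i)//= -expr2 lerDl; apply: sumr_ge0 => j _.
by rewrite -expr2 sqr_ge0.
Qed.

Lemma coord_le_enorm u i : `|u 0 i| <= enorm u.
Proof. by rewrite -sqrtr_sqr ler_sqrt ?dot_ge0// sqr_coord_le_dot. Qed.

Lemma dot_le_enorm u v : `|dot u v| <= enorm u * enorm v.
Proof.
by rewrite -sqrtr_sqr -sqrtrM ?dot_ge0// ler_sqrt ?mulr_ge0 ?dot_ge0// dot_Cauchy_Schwarz.
Qed.

End EuclideanDot.

(** * Polynomial functions *)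

Section Mpol.
Context {R : realType}.

(* Polynomials of degree at most [m], as an inductive family: closure properties
   follow by induction, without handling coefficients. *)
Inductive mpol {n} : nat -> ('rV[R]_n -> R) -> Prop :=
| mpol_cst m c : mpol m (fun=> c)
| mpol_add m f g : mpol m f -> mpol m g -> mpol m (fun x => f x + g x)
| mpol_coord m i f : mpol m f -> mpol m.+1 (fun x => x 0 i * f x).

Lemma mpolS n m (f : 'rV[R]_n -> R) : mpol m f -> mpol m.+1 f.
Proof.
elim=> [k c|k g h _ IHg _ IHh|k i g _ IHg]; first exact: mpol_cst.
- exact: mpol_add.
- exact: mpol_coord.
Qed.

Lemma mpolW n m m' (f : 'rV[R]_n -> R) : (m <= m')%N -> mpol m f -> mpol m' f.
Proof.
move=> /subnK <-; elim: (m' - m)%N => // k IH /IH; rewrite addSn; exact: mpolS.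
Qed.

Lemma mpol_scale n m a (f : 'rV[R]_n -> R) : mpol m f -> mpol m (fun x => a * f x).
Proof.
elim=> [k c|k g h _ IHg _ IHh|k i g _ IHg]; first exact: mpol_cst.
- by under eq_fun do rewrite mulrDr; exact: mpol_add.
- by under eq_fun do rewrite mulrCA; exact: mpol_coord.
Qed.

Lemma mpol_sum n m I (s : seq I) (F : I -> 'rV[R]_n -> R) :
  (forall i, mpol m (F i)) -> mpol m (fun x => \sum_(i <- s) F i x).
Proof.
move=> hF; elim: s => [|i s IH].
  by under eq_fun do rewrite big_nil; exact: mpol_cst.
by under eq_fun do rewrite big_cons; exact: mpol_add.
Qed.

Lemma mpol_sub n m (f g : 'rV[R]_n -> R) : mpol m f -> mpol m g -> mpol m (fun x => f x - g x).
Proof.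
move=> hf hg; under eq_fun do rewrite -mulN1r.
by apply: mpol_add => //; exact: mpol_scale.
Qed.

Lemma mpol_affine n p m (A : 'M[R]_(n, p)) (b : 'rV[R]_p) (f : 'rV[R]_p -> R) :
  mpol m f -> mpol m (fun y : 'rV[R]_n => f (b + y *m A)).
Proof.
elim=> [k c|k g h _ IHg _ IHh|k i g _ IHg]; first exact: mpol_cst.
- exact: mpol_add.
- under eq_fun do rewrite !mxE mulrDl mulr_suml.
  apply: mpol_add; first by apply: mpolS; exact: mpol_scale.
  apply: mpol_sum => j; under eq_fun do rewrite -mulrA.
  by apply: mpol_coord; exact: mpol_scale.
Qed.

Lemma mpol_continuous n m (f : 'rV[R]_n -> R) : mpol m f -> continuous f.
Proof.
elim=> [k c|k g h _ IHg _ IHh|k i g _ IHg] x; first exact: cst_continuous.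
- by apply: continuousD; [exact: IHg|exact: IHh].
- by apply: continuousM; [exact: coord_continuous|exact: IHg].
Qed.

Lemma mpol_differentiable n m (f : 'rV[R]_n.+1 -> R) x : mpol m f -> differentiable f x.
Proof.
elim=> [k c|k g h _ IHg _ IHh|k i g _ IHg]; first exact: differentiable_cst.
- exact: differentiableD.
- by apply: differentiableM => //; exact: differentiable_coord.
Qed.

Lemma mpol_derivable n m (f : 'rV[R]_n.+1 -> R) x v : mpol m f -> derivable f x v.
Proof. by move=> hf; apply: diff_derivable; exact: mpol_differentiable hf. Qed.

Lemma pderive_coord n i j (x : 'rV[R]_n.+1) : pderive i (fun x => x 0 j) x = (j == i)%:R.
Proof.
rewrite /pderive /derive; apply: cvg_lim => //.
apply: (@cvg_trans _ ((fun=> (j == i)%:R : R) @ (0 : R)^')); last exact: cvg_cst.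
apply: near_eq_cvg; near=> h; rewrite /= !mxE addrK eqxx /=.
have h0 : h != 0 by near: h; exact: nbhs_dnbhs_neq.
by rewrite /GRing.scale/= mulKf.
Unshelve. all: by end_near. Qed.

Lemma mpol_pderive n m i (f : 'rV[R]_n.+1 -> R) : mpol m f -> mpol m (pderive i f).
Proof.
elim=> [k c|k g h hg IHg hh IHh|k j g hg IHg].
- rewrite (_ : pderive _ _ = fun=> 0); first exact: mpol_cst.
  by apply/funext => x; rewrite /pderive derive_cst.
- rewrite (_ : pderive _ _ = fun x => pderive i g x + pderive i h x); first exact: mpol_add.
  apply/funext => x; rewrite /pderive [LHS]deriveD//.
    exact: mpol_derivable hg.
  exact: mpol_derivable hh.
- rewrite (_ : pderive _ _ = fun x => x 0 j * pderive i g x + (j == i)%:R * g x).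
    apply: mpol_add; first exact: mpol_coord.
    by apply: mpolS; exact: mpol_scale.
  apply/funext => x; rewrite /pderive [LHS]deriveM//.
  + by rewrite -[X in g x *: X]/(pderive i (fun x => x 0 j) x) pderive_coord [X in _ + X]mulrC.
  + by apply: diff_derivable; exact: differentiable_coord.
  + exact: mpol_derivable hg.
Qed.

Lemma derive_dirE n (f : 'rV[R]_n.+1 -> R) x v : differentiable f x ->
  'D_v f x = \sum_i v 0 i * pderive i f x.
Proof.
move=> df; rewrite deriveE// [X in 'd f x X]row_sum_delta linear_sum/=.
by apply: eq_bigr => i _; rewrite linearZ/= /pderive deriveE.
Qed.

Lemma is_derive_line n (f : 'rV[R]_n.+1 -> R) x v t : differentiable f (t *: v + x) ->
  is_derive (t : R) 1 (fun s => f (s *: v + x)) ('D_v f (t *: v + x)).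
Proof.
move=> df; have dv : derivable f (t *: v + x) v by exact: diff_derivable.
have E : (fun h : R => h^-1 *: (((fun s : R => f (s *: v + x)) \o shift t) (h *: 1) - f (t *: v + x))) =
  (fun h => h^-1 *: ((f \o shift (t *: v + x)) (h *: v) - f (t *: v + x))).
  apply/funext => h /=; congr (_ *: (f _ - _)).
  have -> : h *: (1 : R^o) + t = h + t :> R by rewrite /GRing.scale/= mulr1.
  by rewrite scalerDl addrA.
by split; rewrite /derivable /derive /= E.
Qed.

Lemma segment_derive_cst n (f : 'rV[R]_n.+1 -> R) x y :
  (forall z, differentiable f z) ->
  (forall t, 0 <= t <= 1 -> forall i, pderive i f (t *: (y - x) + x) = 0) -> f x = f y.
Proof.
move=> df h; pose g t := f (t *: (y - x) + x).
have dg t : is_derive (t : R) 1 g ('D_(y - x) f (t *: (y - x) + x)) by exact: is_derive_line.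
have cg : {within `[0, 1], continuous g}.
  apply: continuous_subspaceT => t; apply: differentiable_continuous.
  by apply/derivable1_diffP; have := dg t; case.
have [c] := @MVT R g (fun t => 'D_(y - x) f (t *: (y - x) + x)) 0 1 ltr01 (fun t _ => dg t) cg.
rewrite in_itv/= => /andP[c0 c1]; rewrite derive_dirE// big1 ?mul0r; last first.
  by move=> i _; rewrite h ?mulr0// !ltW.
by rewrite /g scale1r scale0r add0r subrK => /eqP; rewrite subr_eq0 => /eqP.
Qed.

(** The bound and the Lipschitz constant are proved together because the induction step for
    [x 0 i * g x] uses both of them for [g]. *)
Lemma mpol_lipschitz n m (f : 'rV[R]_n -> R) (r : R) : mpol m f ->
  exists2 L : R, 0 <= L & (forall x, `|x| <= r -> `|f x| <= L) /\
   (forall x y, `|x| <= r -> `|y| <= r -> `|f x - f y| <= L * `|x - y|).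
Proof.
elim=> [k c|k g h _ [L1 L10 [b1 l1]] _ [L2 L20 [b2 l2]]|k i g _ [L L0 [b l]]].
- exists `|c| => //; split => // x y _ _; by rewrite subrr normr0 mulr_ge0.
- exists (L1 + L2); first exact: addr_ge0.
  split=> [x xr|x y xr yr].
    by apply: (le_trans (ler_normD _ _)); apply: lerD; [exact: b1|exact: b2].
  rewrite opprD addrACA mulrDl; apply: (le_trans (ler_normD _ _)).
  by apply: lerD; [exact: l1|exact: l2].
- exists (`|r| * L + L); first by rewrite addr_ge0 ?mulr_ge0.
  split=> [x xr|x y xr yr].
    rewrite normrM ler_wpDr//; apply: ler_pM => //; last exact: b.
    by apply: (le_trans (coord_le_norm _ _)); apply: (le_trans xr); exact: ler_norm.
  have -> : x 0 i * g x - y 0 i * g y = x 0 i * (g x - g y) + (x - y) 0 i * g y.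
    by rewrite !mxE; ring.
  apply: (le_trans (ler_normD _ _)); rewrite !normrM mulrDl -mulrA; apply: lerD.
    apply: ler_pM => //; last exact: l.
    by apply: (le_trans (coord_le_norm _ _)); apply: (le_trans xr); exact: ler_norm.
  by rewrite mulrC; apply: ler_pM => //; [exact: b|exact: coord_le_norm].
Qed.

Lemma mpol_prod n I (s : seq I) (i : I -> 'I_n) (e : I -> nat) m (f : 'rV[R]_n -> R) : mpol m f ->
  mpol (m + \sum_(j <- s) e j) (fun x => f x * \prod_(j <- s) x 0 (i j) ^+ e j).
Proof.
move=> hf; elim: s => [|j s IH].
  rewrite big_nil addn0 (_ : (fun _ => _) = f)//.
  by apply/funext => x; rewrite big_nil mulr1.
rewrite big_cons (_ : (fun _ => _) =
    fun x : 'rV[R]_n => x 0 (i j) ^+ e j * (f x * \prod_(j <- s) x 0 (i j) ^+ e j)); last first.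
  by apply/funext => x; rewrite big_cons mulrCA.
elim: (e j) => [|k IHk].
  rewrite add0n (_ : (fun _ => _) = fun x : 'rV[R]_n => f x * \prod_(j <- s) x 0 (i j) ^+ e j)//.
  by apply/funext => x; rewrite expr0 mul1r.
rewrite addSn addnS (_ : (fun _ => _) = fun x : 'rV[R]_n =>
    x 0 (i j) * (x 0 (i j) ^+ k * (f x * \prod_(j <- s) x 0 (i j) ^+ e j))).
  exact: mpol_coord.
by apply/funext => x; rewrite exprS -mulrA.
Qed.

Lemma polynomial_fun_mpol n k (p : 'rV[R]_n.+1 -> R) : polynomial_fun k p -> mpol k p.
Proof.
move=> [c pE]; have -> := funext pE.
under eq_fun do rewrite big_mkcond.
apply: mpol_sum => al; case alk: (\sum_i al i <= k)%N; last exact: mpol_cst.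
apply: (mpolW alk).
exact: (@mpol_prod _ _ _ (fun i => i) (fun i => al i : nat) 0 _ (mpol_cst _ _)).
Qed.

(** Monomials occur with repetitions, which is harmless for a list whose only role is to span. *)
Fixpoint mons n m : seq ('rV[R]_n -> R^o) :=
  if m is m'.+1 then mons n m' ++ [seq (fun x : 'rV[R]_n => x 0 i * (f : 'rV[R]_n -> R) x : R^o) | i <- enum 'I_n, f <- mons n m']
  else [:: fun=> 1].

Lemma mons_mpol n m f : f \in mons n m -> mpol m f.
Proof.
elim: m f => [|m IH] f /=; first by rewrite inE => /eqP ->; exact: mpol_cst.
rewrite mem_cat => /orP[/IH|]; first exact: mpolS.
by move=> /allpairsP[[i g] [_ /= /IH hg ->]]; exact: mpol_coord.
Qed.

End Mpol.
Section LinearSpan.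
Context {R : realType}.

Lemma lspan_cat (V : lmodType R) (s t : seq V) (u v : V) : lspan s u -> lspan t v -> lspan (s ++ t) (u + v).
Proof.
elim: s u => [|w s IH] u /=; first by move=> -> ?; rewrite add0r.
by move=> [a [u' [su ->]]] tv; exists a, (u' + v); split; [exact: IH|rewrite addrA].
Qed.

Lemma lspan_mem (V : lmodType R) (s : seq V) v : v \in s -> lspan s v.
Proof.
elim: s => // w s IH; rewrite inE => /predU1P[->|/IH sv] /=.
  by exists 1, 0; split; [exact: (lspan_subspace s).1|rewrite scale1r addr0].
by exists 0, v; rewrite scale0r add0r.
Qed.

Lemma lspan_map (V V' : lmodType R) (s : seq V) (t : seq V') (h : V -> V') :
  linear h -> {in s, forall w, lspan t (h w)} -> forall v, lspan s v -> lspan t (h v).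
Proof.
move=> hl; have h0 : h 0 = 0 by have := hl (-1) 0 0; rewrite !scaleN1r !addNr.
elim: s => [|w s IH] st v /=; first by move=> ->; rewrite h0; exact: (lspan_subspace t).1.
move=> [a [u [su ->]]]; rewrite hl; apply: (lspan_subspace t).2.
  by apply: st; rewrite inE eqxx.
by apply: IH => // x xs; apply: st; rewrite inE xs orbT.
Qed.

Lemma mpol_lspan n m (f : 'rV[R]_n -> R) : mpol m f -> lspan (mons n m) (f : 'rV[R]_n -> R^o).
Proof.
elim=> [k c|k g h _ IHg _ IHh|k i g _ IHg].
- have -> : (fun=> c : R^o) = c *: (fun=> 1 : R^o) :> ('rV[R]_n -> R^o).
    by apply/funext => x; rewrite /GRing.scale/= /GRing.scale/= mulr1.
  have s1 : lspan (mons n k) (fun=> 1 : R^o).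
    apply: lspan_mem; elim: k => [|k IH] /=; first by rewrite inE.
    by rewrite mem_cat IH.
  have ss := lspan_subspace (@mons R n k).
  by rewrite -[_ *: _]addr0; apply: ss.2 => //; exact: ss.1.
- have ss := lspan_subspace (@mons R n k).
  have := ss.2 1 _ _ IHg IHh; rewrite scale1r; exact.
- rewrite /= -[X in lspan _ X]add0r; apply: lspan_cat; first exact: (lspan_subspace (@mons R n k)).1.
  pose h (f : 'rV[R]_n -> R^o) : 'rV[R]_n -> R^o := fun x => x 0 i * (f : 'rV[R]_n -> R) x.
  apply: (@lspan_map _ _ (mons n k) _ h) IHg.
    by move=> a u v; apply/funext => x; change (x 0 i * (a * (u x : R) + (v x : R)) = a * (x 0 i * (u x : R)) + x 0 i * (v x : R)); ring.
  move=> w wk; apply: lspan_mem; apply/allpairsP; exists (i, w) => //=.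
  by rewrite mem_enum.
Qed.
End LinearSpan.

(** * Integrals of polynomials *)

Section IntegrableEFin.
Context d (T : measurableType d) (R : realType).
Variables (mu : {measure set T -> \bar R}) (D : set T).
Hypothesis mD : measurable D.
Local Notation intg f := (mu.-integrable D (EFin \o f)).

Lemma integrable_EFinZ (a : R) (f : T -> R) : intg f -> intg (fun x => a * f x).
Proof. exact: integrableZl. Qed.

Lemma integrable_EFinD (f g : T -> R) : intg f -> intg g -> intg (fun x => f x + g x).
Proof. exact: integrableD. Qed.

Lemma integrable_EFinB (f g : T -> R) : intg f -> intg g -> intg (fun x => f x - g x).
Proof. exact: integrableB. Qed.

Lemma integrable_EFin_sum (I : Type) (s : seq I) (F : I -> T -> R) :
  (forall i, intg (F i)) -> intg (fun x => \sum_(i <- s) F i x).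
Proof.
move=> hF; elim: s => [|i s IH].
  rewrite (_ : (fun _ => _) = cst 0); first exact: integrable0.
  by apply/funext => x; rewrite big_nil.
rewrite (_ : (fun _ => _) = fun x => F i x + \sum_(j <- s) F j x).
  exact: integrable_EFinD.
by apply/funext => x; rewrite big_cons.
Qed.

Lemma Rintegral_cst0 : \int[mu]_(x in D) (0 : R) = 0.
Proof. by rewrite /Rintegral (_ : (fun _ => _) = cst 0%E)// integral0. Qed.

Lemma Rintegral_sum (I : Type) (s : seq I) (F : I -> T -> R) :
  (forall i, intg (F i)) ->
  \int[mu]_(x in D) (\sum_(i <- s) F i x) = \sum_(i <- s) \int[mu]_(x in D) F i x.
Proof.
move=> hF; elim: s => [|i s IH].
  rewrite big_nil; under eq_Rintegral do rewrite big_nil; exact: Rintegral_cst0.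
rewrite big_cons; under eq_Rintegral do rewrite big_cons.
by rewrite RintegralD// ?IH//; exact: integrable_EFin_sum.
Qed.

End IntegrableEFin.

Section PolynomialIntegrals.
Context {R : realType} {n : nat}.
Implicit Types (D G : set 'rV[R]_n) (f g : 'rV[R]_n -> R).
Local Notation mu := (leb n).

Lemma bounded_integrable D f (M : R) : measurable D -> (mu D < +oo)%E ->
  measurable_fun D (f : _ -> measurableTypeR R) -> (forall x, D x -> `|f x| <= M) ->
  mu.-integrable D (EFin \o f).
Proof.
move=> mD fD mf fM; apply: measurable_bounded_integrable => //.
exists M; split; first exact: num_real.
by move=> x Mx y Dy /=; apply: le_trans (ltW Mx); exact: fM.
Qed.

Lemma mpol_integrable_bounded D m f : mpol m f -> measurable D -> bounded_set D ->
  mu.-integrable D (EFin \o f).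
Proof.
move=> hf mD bD; have [M [Mr hM]] := bD.
have [L _ [hL _]] := mpol_lipschitz (`|M| + 1) hf.
apply: (@bounded_integrable _ _ L) => //; first exact: leb_bounded_lty.
- apply: measurable_funTS; apply: measurable_continuous_rV; exact: mpol_continuous hf.
- by move=> x Dx; apply: hL; apply: hM => //; rewrite (le_lt_trans (ler_norm _))// ltrDl.
Qed.

Lemma mpolM m1 m2 f g : mpol m1 f -> mpol m2 g -> mpol (m1 + m2) (fun x => f x * g x).
Proof.
move=> hf hg; elim: hf => {m1 f} [k c|k f1 f2 _ IH1 _ IH2|k i f _ IH].
- by apply: (mpolW (leq_addl _ _)); exact: mpol_scale.
- by under eq_fun do rewrite mulrDl; exact: mpol_add.
- by rewrite addSn; under eq_fun do rewrite -mulrA; exact: mpol_coord.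
Qed.

(** Where [f] is nonzero at a point of [G], continuity makes it nonzero on a ball, which has
    positive measure; but the set of nonzero values is null. Continuity is asked on [G] only, so
    nothing has to be known at the boundary of [D]. *)
Lemma Rintegral_eq0_open D G f : measurable D -> open G -> G `<=` D ->
  (forall x, D x -> 0 <= f x) -> (forall x, G x -> {for x, continuous f}) ->
  mu.-integrable D (EFin \o f) -> \int[mu]_(x in D) f x = 0 -> forall x, G x -> f x = 0.
Proof.
move=> mD oG GD f0 cf intf If0 x Gx; apply/eqP/negPn/negP => fx.
have mf : measurable_fun D (EFin \o f) by case/integrableP : intf.
have : (\int[mu]_(x in D) `|(EFin \o f) x|)%E = 0%E.
  rewrite (eq_integral (EFin \o f)); last first.
    by move=> y; rewrite inE => Dy; rewrite gee0_abs// lee_fin f0.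
  rewrite -[LHS]fineK; first by rewrite -[fine _]/(\int[mu]_(x in D) f x) If0.
  exact: integrable_fin_num.
move/(ae_eq_integral_abs mu mD mf) => [N [mN N0 hN]].
have cfx := cf _ Gx.
have nf : \forall y \near x, f y != 0.
  by apply: (cfx [set t | t != 0]); apply: open_nbhs_nbhs; split => //; exact: open_neq.
have := filterI (open_nbhs_nbhs (conj oG Gx)) nf; rewrite nbhs_ballP => -[e /= e0 he].
have : (0 < mu (ball x e))%E.
  by apply: leb_open_gt0; [exact: ball_open|exists x; exact: ballxx].
rewrite -N0 ltNge => /negP; apply; apply: le_measure; rewrite ?inE//.
  by apply: measurable_open_rV; exact: ball_open.
move=> y /he[Gy fy]; apply: hN => /(_ (GD _ Gy)) /= [] /eqP; exact/negP.
Qed.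

Lemma vanish_on_closure G f : (forall x, G x -> f x = 0) ->
  forall x, closure G x -> {for x, continuous f} -> f x = 0.
Proof.
move=> f0 x cx cf; apply/eqP/negPn/negP => fx.
have nf : \forall y \near x, f y != 0.
  by apply: (cf [set t | t != 0]); apply: open_nbhs_nbhs; split => //; exact: open_neq.
by have [y [/f0 -> /=]] := cx _ nf; rewrite eqxx.
Qed.

End PolynomialIntegrals.

(** * The reference simplex and the trace inequality on it *)

Section ReferenceSimplex.
Context {R : realType}.

Definition iref n : set 'rV[R]_n := [set y | (forall k, 0 < y 0 k) /\ \sum_k y 0 k < 1].

Lemma continuous_sum_coord n : continuous (fun y : 'rV[R]_n => \sum_k y 0 k).
Proof.
apply: (@mpol_continuous _ _ 1); apply: mpol_sum => i.
have := mpol_coord i (@mpol_cst R n 0 1); by under eq_fun do rewrite mulr1.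
Qed.

Lemma closed_ref_simplex n : closed (@ref_simplex R n).
Proof.
have -> : @ref_simplex R n = (\bigcap_(k in [set: 'I_n]) ((fun y : 'rV[R]_n => y 0 k) @^-1` [set t | 0 <= t]))
   `&` ((fun y : 'rV[R]_n => \sum_k y 0 k) @^-1` [set t | t <= 1]).
  by apply/seteqP; split => y [h1 h2]; split=> // k; [move=> _; exact: h1|exact: h1].
apply: closedI.
  apply: closed_bigI => k _; apply: preimage_closed; last exact: closed_ge.
  by move=> x _; exact: coord_continuous.
apply: preimage_closed; last exact: closed_le.
by move=> x _; exact: continuous_sum_coord.
Qed.

Lemma open_iref n : open (@iref n).
Proof.
rewrite openE => y [y0 y1]; apply: filterI.
  apply: (@filter_forall _ _ (fun (k : 'I_n) (x : 'rV[R]_n) => 0 < x 0 k) (nbhs y) _) => k.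
  apply: (@coord_continuous R 1 n 0 k y [set t | 0 < t]).
  exact: open_nbhs_nbhs (conj (@open_gt R 0) (y0 k)).
apply: (@continuous_sum_coord n y [set t | t < 1]).
exact: open_nbhs_nbhs (conj (@open_lt R 1) y1).
Qed.

Lemma iref_sub n : @iref n `<=` ref_simplex.
Proof. by move=> y [h1 h2]; split; [move=> k; exact: ltW|exact: ltW]. Qed.

Lemma norm_ref_simplex n (y : 'rV[R]_n) : ref_simplex y -> `|y| <= 1.
Proof.
move=> [y0 y1]; rewrite [leLHS]mx_normrE; apply/bigmax_leP; split => // -[i j] _ /=.
rewrite ord1 ger0_norm//; apply: le_trans y1; rewrite (bigD1 j)//= lerDl.
exact: sumr_ge0.
Qed.

Lemma bounded_ref_simplex n : bounded_set (@ref_simplex R n).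
Proof.
exists 1; split => // x x1 y /norm_ref_simplex h; apply: le_trans h (ltW x1).
Qed.

Lemma measurable_ref_simplex n : measurable (@ref_simplex R n).
Proof. by apply: measurable_closed_rV; exact: closed_ref_simplex. Qed.

Definition centroid n : 'rV[R]_n := const_mx (n.+1%:R^-1).

Lemma centroid_iref n : iref (centroid n).
Proof.
split=> [k|]; first by rewrite mxE invr_gt0.
under eq_bigr do rewrite mxE.
by rewrite sumr_const card_ord -[_ *+ n]mulr_natr mulrC ltr_pdivrMr// mul1r ltr_nat.
Qed.

Lemma iref_segment n (y c : 'rV[R]_n) (t : R) : ref_simplex y -> iref c -> 0 < t -> t <= 1 ->
  iref (y + t *: (c - y)).
Proof.
move=> [y0 y1] [c0 c1] t0 t1.
have E k : (y + t *: (c - y)) 0 k = (1 - t) * y 0 k + t * c 0 k by rewrite !mxE; ring.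
split=> [k|].
  by rewrite E ltr_wpDl// ?mulr_ge0 ?subr_ge0// mulr_gt0.
under eq_bigr do rewrite E; rewrite big_split/= -!mulr_sumr.
have : (1 - t) * \sum_k y 0 k <= (1 - t) * 1 by rewrite ler_wpM2l// subr_ge0.
have : t * \sum_k c 0 k < t * 1 by rewrite ltr_pM2l.
lra.
Qed.

(** Any point of the simplex becomes interior once it is moved slightly towards the centroid. *)
Lemma closure_iref n : @ref_simplex R n `<=` closure (@iref n).
Proof.
move=> y hy A /nbhs_ballP[e /= e0 eA].
have c := centroid_iref n.
pose d := e / (`|centroid n - y| + 1).
have p : 0 < `|centroid n - y| + 1 :> R by rewrite ltr_wpDl.
have d0 : 0 < d by rewrite divr_gt0.
pose t := Num.min 1 (d / 2).
have t0 : 0 < t by rewrite lt_min ltr01 divr_gt0.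
have t1 : t <= 1 by rewrite ge_min lexx.
exists (y + t *: (centroid n - y)); split; first exact: iref_segment.
apply: eA; rewrite -ball_normE /= opprD addrA subrr add0r normrN normrZ gtr0_norm//.
apply: (@le_lt_trans _ _ (d / 2 * `|centroid n - y|)).
  by rewrite ler_wpM2r// ge_min lexx orbT.
apply: (@le_lt_trans _ _ (d / 2 * (`|centroid n - y| + 1))).
  by apply: ler_wpM2l; [rewrite ltW// divr_gt0|rewrite lerDl].
by rewrite mulrAC /d divfK ?gt_eqF// ltr_pdivrMr// ltr_pMr// ltr1n.
Qed.

Lemma ref_rVcons0 n (y : 'rV[R]_n) : ref_simplex y -> ref_simplex (rVcons (0 : R, y)).
Proof.
move=> [y0 y1]; split.
  by move=> k; rewrite mxE; case: unlift => [j|] //=.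
rewrite big_ord_recl mxE unlift_none/= add0r.
by under eq_bigr do rewrite mxE liftK.
Qed.

Lemma mpol_rVcons0 n m (f : 'rV[R]_n.+1 -> R) : mpol m f -> mpol m (fun y : 'rV[R]_n => f (rVcons (0 : R, y))).
Proof.
move=> hf; have -> : (fun y : 'rV[R]_n => f (rVcons (0 : R, y))) =
    fun y => f (0 + y *m (\matrix_(i < n, j < n.+1) (j == lift ord0 i)%:R)).
  apply/funext => y; congr f; apply/rowP => j; rewrite !mxE add0r.
  case: unliftP => [k ->|->] /=.
    rewrite (bigD1 k)//= !mxE eqxx mulr1 big1 ?addr0// => i ik.
    by rewrite !mxE (inj_eq lift_inj) eq_sym (negbTE ik) mulr0.
  by rewrite big1// => i _; rewrite !mxE (negbTE (neq_lift _ _)) mulr0.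
exact: mpol_affine.
Qed.

(* If p vanishes on the simplex it vanishes on its face, and polynomials of degree
   at most m form a finite-dimensional space. *)
Lemma reference_trace_inequality n m : exists2 C : R, 0 <= C &
  forall p : 'rV[R]_n.+1 -> R, mpol m p ->
    \int[leb n]_(y in ref_simplex) (p (rVcons (0, y)) ^+ 2) <=
    C * \int[leb n.+1]_(x in ref_simplex) (p x ^+ 2).
Proof.
pose V := 'rV[R]_n.+1 -> R^o.
pose b1 (u v : V) : R := \int[leb n.+1]_(x in ref_simplex) ((u x : R) * v x).
pose b2 (u v : V) : R := \int[leb n]_(y in ref_simplex) ((u (rVcons (0, y)) : R) * v (rVcons (0, y))).
pose W : set V := [set u : V | mpol m (u : _ -> R)].
have int1 (u v : 'rV[R]_n.+1 -> R) : mpol m u -> mpol m v -> (leb n.+1).-integrable ref_simplex (EFin \o (fun x => u x * v x)).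
  move=> hu hv; apply: mpol_integrable_bounded; first exact: mpolM hu hv.
    exact: measurable_ref_simplex.
  exact: bounded_ref_simplex.
have int2 (u v : 'rV[R]_n.+1 -> R) : mpol m u -> mpol m v -> (leb n).-integrable ref_simplex (EFin \o (fun y => u (rVcons (0, y)) * v (rVcons (0, y)))).
  move=> /mpol_rVcons0 hu /mpol_rVcons0 hv; apply: mpol_integrable_bounded; first exact: mpolM hu hv.
    exact: measurable_ref_simplex.
  exact: bounded_ref_simplex.
have mr k := @measurable_ref_simplex k.
have lin1 (w : V) : W w -> linear_on W (b1 w).
  move=> Ww a u v Wu Wv; rewrite /b1 -(RintegralZl a (mr _) (int1 _ _ Ww Wu)).
  have i1 := integrable_EFinZ (mr _) a (int1 _ _ Ww Wu).
  rewrite -(RintegralD (mr _) i1 (int1 _ _ Ww Wv)).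
  by apply: eq_Rintegral => x _; change (w x * (a * u x + v x) = a * (w x * u x) + w x * v x :> R); ring.
have lin2 (w : V) : W w -> linear_on W (b2 w).
  move=> Ww a u v Wu Wv; rewrite /b2 -(RintegralZl a (mr _) (int2 _ _ Ww Wu)).
  have i1 := integrable_EFinZ (mr _) a (int2 _ _ Ww Wu).
  rewrite -(RintegralD (mr _) i1 (int2 _ _ Ww Wv)).
  apply: eq_Rintegral => x _; set z := rVcons _.
  by change (w z * (a * u z + v z) = a * (w z * u z) + w z * v z :> R); ring.
have s1 (u v : V) : b1 u v = b1 v u by apply: eq_Rintegral => x _; rewrite mulrC.
have s2 (u v : V) : b2 u v = b2 v u by apply: eq_Rintegral => x _; rewrite mulrC.
have sW : subspace_of W.
  split; first exact: mpol_cst.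
  move=> a u v Wu Wv; rewrite /W /=; apply: mpol_add => //; exact: mpol_scale.
have [C C0 hC] : exists2 C : R, 0 <= C & forall u, lspan (@mons R n.+1 m) u -> b2 u u <= C * b1 u u.
  apply: (psd_dominated sW) => //.
  - by split=> w Ww; [exact: lin1|move=> a u v Wu Wv; rewrite !(s1 _ w); exact: lin1].
  - by split=> w Ww; [exact: lin2|move=> a u v Wu Wv; rewrite !(s2 _ w); exact: lin2].
  - by move=> u _; apply: Rintegral_ge0 => x _; rewrite -expr2 sqr_ge0.
  - by move=> u _; apply: Rintegral_ge0 => x _; rewrite -expr2 sqr_ge0.
  - move=> u Wu u0.
    have cu := mpol_continuous (mpolM Wu Wu).
    have z : forall x, iref x -> (u x : R) * u x = 0.
      apply: (@Rintegral_eq0_open R _ ref_simplex (@iref n.+1) (fun x => (u x : R) * u x)) => //.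
      + exact: open_iref.
      + exact: iref_sub.
      + by move=> x _; rewrite -expr2 sqr_ge0.
      + by move=> x _; exact: cu.
      + exact: int1.
    rewrite /b2 -[RHS](@Rintegral_cst0 _ _ _ (leb n) ref_simplex); apply: eq_Rintegral => y.
    rewrite inE => /ref_rVcons0/closure_iref hy.
    exact: vanish_on_closure z _ hy (cu _).
  - by move=> u /mons_mpol.
exists C => // p hp; have := hC _ (mpol_lspan hp).
by rewrite /b1 /b2; under eq_Rintegral do rewrite -expr2; under [in leRHS]eq_Rintegral do rewrite -expr2.
Qed.

End ReferenceSimplex.

Lemma dot_mulmx (R : realType) n (u v : 'rV[R]_n) : dot u v = (u *m v^T) 0 0.
Proof. by rewrite mxE; apply: eq_bigr => j _; rewrite mxE. Qed.

Lemma rVcons_row (R : realType) n (y : 'rV[R]_n.+1) :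
  rVcons (y 0 ord0, \row_j y 0 (lift ord0 j)) = y.
Proof.
by apply/rowP => i; rewrite mxE; case: unliftP => [j|] -> //=; rewrite mxE.
Qed.

Lemma bigsetU_null d (T : measurableType d) (R : realType) (mu : {measure set T -> \bar R})
  (I : Type) (s : seq I) (F : I -> set T) :
  (forall i, measurable (F i)) -> (forall i, mu (F i) = 0%E) ->
  mu (\big[setU/set0]_(i <- s) F i) = 0%E.
Proof.
move=> mF F0; elim: s => [|i s IH]; first by rewrite big_nil measure0.
rewrite big_cons null_set_setU//.
by apply: bigsetU_measurable => j _; exact: mF.
Qed.

(** * Geometry of simplices and the trace inequality *)

Section Simplex.
Context {R : realType} {n : nat}.
Variable a : 'I_n.+2 -> 'rV[R]_n.+1.

Definition apex_edge i := a i - facet_base a i.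

Definition facet_frame i : 'M[R]_(n.+1) := col_mx (apex_edge i) (facet_edges a i).

(* The affine chart maps the reference simplex onto the simplex, and its face
   {x_0 = 0} onto the facet i. *)
Definition chart i (x : 'rV[R]_n.+1) := facet_base a i + x *m facet_frame i.

Lemma chart_rVcons i s y :
  chart i (rVcons (s, y)) = facet_base a i + (s *: apex_edge i + y *m facet_edges a i).
Proof.
rewrite /chart rVconsE; congr (_ + _).
by rewrite [LHS](mul_row_col s%:M y (apex_edge i) (facet_edges a i)) mul_scalar_mx.
Qed.

(** From barycentric to reference coordinates: the weight of the apex [i] becomes the first
    coordinate, the weights of the other non-base vertices the remaining ones, and the base vertex
    takes what is left of the total 1. *)
Lemma chart_bary i (lam : 'I_n.+2 -> R) : \sum_j lam j = 1 ->
  \sum_j lam j *: a j = chart i (rVcons (lam i, \row_k lam (lift i (lift ord0 k)))).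
Proof.
rewrite (bigD1_ord i)//= big_ord_recl => l1.
rewrite (bigD1_ord i)//= big_ord_recl chart_rVcons mulmx_sum_row.
have -> : lam (lift i ord0) = 1 - lam i - \sum_(k < n) lam (lift i (lift ord0 k)).
  by rewrite -l1; ring.
rewrite -/(facet_base a i) !scalerBl scale1r scaler_suml /apex_edge scalerBr.
have -> : \sum_k (\row_k0 lam (lift i (lift ord0 k0))) 0 k *: row k (facet_edges a i) =
   \sum_(k < n) lam (lift i (lift ord0 k)) *: a (lift i (lift ord0 k)) -
   \sum_(k < n) lam (lift i (lift ord0 k)) *: facet_base a i.
  by rewrite -sumrB; apply: eq_bigr => k _; rewrite mxE rowK scalerBr.
move: (facet_base a i) (\sum_k _ *: a _) (\sum_k _) => b s1 s2.
by apply/rowP => j; rewrite !mxE; ring.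
Qed.

(** Barycentric coordinates of [chart i y]. The innermost alternative is the base vertex of the
    facet, whose weight is determined by the others. *)
Definition chart_weights i (y : 'rV[R]_n.+1) (j : 'I_n.+2) : R :=
  if unlift i j is Some j' then
    if unlift ord0 j' is Some k then y 0 (lift ord0 k) else 1 - \sum_k y 0 k
  else y 0 ord0.

Lemma chart_weights_apex i y : chart_weights i y i = y 0 ord0.
Proof. by rewrite /chart_weights unlift_none. Qed.

Lemma chart_weights_base i y : chart_weights i y (lift i ord0) = 1 - \sum_k y 0 k.
Proof. by rewrite /chart_weights liftK unlift_none. Qed.

Lemma chart_weights_edge i y (k : 'I_n) :
  chart_weights i y (lift i (lift ord0 k)) = y 0 (lift ord0 k).
Proof. by rewrite /chart_weights !liftK. Qed.

Lemma sum_chart_weights i y : \sum_j chart_weights i y j = 1.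
Proof.
rewrite (bigD1_ord i)//= big_ord_recl chart_weights_apex chart_weights_base.
rewrite (eq_bigr _ (fun k _ => chart_weights_edge i y k)).
by rewrite [in X in _ + (_ - X + _)]big_ord_recl/=; ring.
Qed.

Lemma chart_weightsE i y : \sum_j chart_weights i y j *: a j = chart i y.
Proof.
rewrite (chart_bary i (sum_chart_weights i y)); congr chart; apply/rowP => j.
rewrite mxE; case: unliftP => [k|] -> /=; last by rewrite chart_weights_apex.
by rewrite mxE chart_weights_edge.
Qed.

Lemma chart_weights_ge0 i y j : ref_simplex y -> 0 <= chart_weights i y j.
Proof.
move=> [y0 y1]; rewrite /chart_weights; case: unlift => [j'|//].
by case: unlift => [k//|]; rewrite subr_ge0.
Qed.

Lemma simplex_chartP i x : simplex a x <-> exists2 y, ref_simplex y & x = chart i y.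
Proof.
split=> [[lam [l0 _ l1 ->]]|[y hy ->]].
  exists (rVcons (lam i, \row_k lam (lift i (lift ord0 k)))); last exact: chart_bary.
  have E (k : 'I_n) : rVcons (lam i, \row_k lam (lift i (lift ord0 k))) 0 (lift ord0 k) = lam (lift i (lift ord0 k)).
    by rewrite mxE liftK /= mxE.
  split=> [k|].
    case: (unliftP ord0 k) => [k'|] ->; first by rewrite E.
    by rewrite mxE unlift_none; exact: l0.
  rewrite big_ord_recl mxE unlift_none/= -l1 (bigD1_ord i)//= big_ord_recl lerD2l.
  by under eq_bigr do rewrite E; rewrite lerDr.
exists (chart_weights i y); split => //; last by rewrite chart_weightsE.
- by move=> j; exact: chart_weights_ge0.
- by move=> j; rewrite inE.
- exact: sum_chart_weights.
Qed.

Lemma facet_chart i (y : 'rV[R]_n) : ref_simplex y ->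
  facet a i (facet_base a i + y *m facet_edges a i).
Proof.
move=> /ref_rVcons0 hy; exists (chart_weights i (rVcons (0 : R, y))); split.
- by move=> j; exact: chart_weights_ge0.
- move=> j; rewrite !inE negbK => /eqP ->.
  by rewrite chart_weights_apex mxE unlift_none.
- exact: sum_chart_weights.
- by rewrite chart_weightsE chart_rVcons scale0r add0r.
Qed.

Lemma facet_sub_simplex i : facet a i `<=` simplex a.
Proof. by move=> x [lam [l0 _ l1 ->]]; exists lam; split=> // j; rewrite inE. Qed.

Lemma vertex_simplex j : simplex a (a j).
Proof.
exists (fun k => (k == j)%:R); split.
- by move=> k; rewrite ler0n.
- by move=> k; rewrite inE.
- by rewrite (bigD1 j)//= eqxx big1 ?addr0// => k /negbTE ->.
- by rewrite (bigD1 j)//= eqxx scale1r big1 ?addr0// => k /negbTE ->; rewrite scale0r.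
Qed.

Hypothesis nd : Defs.nondegenerate a.

Lemma affine_free (c : 'I_n.+2 -> R) : \sum_j c j = 0 -> \sum_j c j *: a j = 0 ->
  forall j, c j = 0.
Proof.
rewrite !(big_ord_recl n.+1) => c0 ca.
have c00 : c ord0 = - \sum_(j < n.+1) c (lift ord0 j) by apply/eqP; rewrite -addr_eq0 c0.
pose v : 'rV[R]_n.+1 := \row_j c (lift ord0 j).
have : v *m (\matrix_(j < n.+1) (a (lift ord0 j) - a ord0)) = 0.
  rewrite mulmx_sum_row -[RHS]ca c00 scaleNr scaler_suml addrC -sumrB.
  by apply: eq_bigr => j _; rewrite mxE rowK scalerBr.
move=> /(congr1 (mulmxr (invmx (\matrix_(j < n.+1) (a (lift ord0 j) - a ord0))))).
rewrite /= mulmxK// mul0mx => v0.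
have cl j : c (lift ord0 j) = 0 by have /rowP/(_ j) := v0; rewrite !mxE.
move=> j; case: (unliftP ord0 j) => [k|] -> //.
by rewrite c00 big1 ?oppr0.
Qed.

(** [nondegenerate] speaks of the edges issuing from vertex 0, the frame of those issuing from the
    base of facet [i]. Affine independence of the vertices is the condition common to both. *)
Lemma facet_frame_unit i : facet_frame i \in unitmx.
Proof.
rewrite -row_free_unit; apply: inj_row_free => v v0.
have h1 : \sum_j (chart_weights i v j - chart_weights i 0 j) = 0.
  by rewrite sumrB !sum_chart_weights subrr.
have h2 : \sum_j (chart_weights i v j - chart_weights i 0 j) *: a j = 0.
  under eq_bigr do rewrite scalerBl.
  by rewrite sumrB !chart_weightsE /chart v0 mul0mx subrr.
have h := affine_free h1 h2.
apply/rowP => j; rewrite mxE; case: (unliftP ord0 j) => [k|] ->.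
  by have := h (lift i (lift ord0 k)); rewrite !chart_weights_edge mxE subr0.
by have := h i; rewrite !chart_weights_apex mxE subr0.
Qed.

Definition unchart i (x : 'rV[R]_n.+1) := (x - facet_base a i) *m invmx (facet_frame i).

Lemma chartK i : cancel (chart i) (unchart i).
Proof. by move=> y; rewrite /unchart /chart addrC addKr mulmxK// facet_frame_unit. Qed.

Lemma unchartK i : cancel (unchart i) (chart i).
Proof. by move=> x; rewrite /unchart /chart mulmxKV ?facet_frame_unit// addrC subrK. Qed.

Lemma simplex_unchart i : simplex a = unchart i @^-1` ref_simplex.
Proof.
apply/seteqP; split => x /=.
  by move=> /(simplex_chartP i)[y hy ->]; rewrite chartK.
by move=> hx; apply/(simplex_chartP i); exists (unchart i x) => //; rewrite unchartK.
Qed.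

Lemma affine_continuous p q (A : 'M[R]_(p, q)) (b : 'rV[R]_q) (c : 'rV[R]_p) :
  continuous (fun x : 'rV[R]_p => b + (x - c) *m A).
Proof.
move=> x U /nbhs_ballP[e /= e0 eU].
suff : \forall y \near x, forall j, `|(b + (x - c) *m A) 0 j - (b + (y - c) *m A) 0 j| < e.
  apply: filterS => y hy; apply: eU; split=> // i j; rewrite ord1 /ball/=; exact: hy.
apply: (@filter_forall _ _ (fun j (y : 'rV[R]_p) => `|(b + (x - c) *m A) 0 j - (b + (y - c) *m A) 0 j| < e) (nbhs x) _) => j.
have hp : mpol 1 (fun y : 'rV[R]_p => (b + (y - c) *m A) 0 j).
  have -> : (fun y : 'rV[R]_p => (b + (y - c) *m A) 0 j) =
      (fun y => (fun z : 'rV[R]_q => z 0 j * 1) ((b - c *m A) + y *m A)).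
    by apply/funext => y; rewrite mulr1 mulmxBl !mxE; ring.
  by apply: (@mpol_affine _ _ _ _ _ _ (fun z : 'rV[R]_q => z 0 j * 1)); apply: mpol_coord; exact: mpol_cst.
have := mpol_continuous hp (x := x); move/cvgr_dist_lt => /(_ _ e0); exact.
Qed.

Lemma unchart_continuous i : continuous (unchart i).
Proof.
have := @affine_continuous _ _ (invmx (facet_frame i)) 0 (facet_base a i).
by under eq_fun do rewrite add0r.
Qed.

Lemma chart_continuous i : continuous (chart i).
Proof.
have := @affine_continuous _ _ (facet_frame i) (facet_base a i) 0.
by under eq_fun do rewrite subr0.
Qed.

Lemma closed_simplex : closed (simplex a).
Proof.
rewrite (simplex_unchart ord0); apply: preimage_closed; last exact: closed_ref_simplex.
by move=> x _; exact: unchart_continuous.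
Qed.

Lemma bounded_simplex : bounded_set (simplex a).
Proof.
have cr : compact (chart ord0 @` (@ref_simplex R n.+1)).
  apply: continuous_compact; first by apply: continuous_subspaceT; exact: chart_continuous.
  by apply: bounded_closed_compact; [exact: bounded_ref_simplex|exact: closed_ref_simplex].
apply: compact_bounded.
rewrite (_ : simplex a = chart ord0 @` ref_simplex)//.
apply/seteqP; split => x; first by move=> /(simplex_chartP ord0)[y hy ->]; exists y.
by move=> [y hy <-]; apply/(simplex_chartP ord0); exists y.
Qed.

Lemma measurable_simplex : measurable (simplex a).
Proof. by apply: measurable_closed_rV; exact: closed_simplex. Qed.

(** The image of the open reference simplex. Openness, convexity and density in the simplex are
    inherited from [iref], and since it lies in the topological interior it can stand in for the
    latter. *)
Definition simplex_core : set 'rV[R]_n.+1 := unchart ord0 @^-1` (@iref R n.+1).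

Lemma open_simplex_core : open simplex_core.
Proof.
apply: open_comp; last exact: open_iref.
by move=> x _; exact: unchart_continuous.
Qed.

Lemma simplex_core_sub : simplex_core `<=` simplex a.
Proof. by move=> x hx; rewrite (simplex_unchart ord0); exact: iref_sub. Qed.

Lemma simplex_core_interior : simplex_core `<=` interior (simplex a).
Proof. by rewrite -open_subsetE; [exact: simplex_core_sub|exact: open_simplex_core]. Qed.

Lemma closure_simplex_core : simplex a `<=` closure simplex_core.
Proof.
move=> x; rewrite (simplex_unchart ord0) => /= /closure_iref hx A Ax.
have : nbhs (unchart ord0 x) (chart ord0 @^-1` A).
  by apply: chart_continuous; rewrite unchartK.
move=> /hx[y [iy Ay]]; exists (chart ord0 y); split=> //.
by rewrite /simplex_core /= chartK.
Qed.

Lemma simplex_core_convex x y t : simplex_core x -> simplex_core y -> 0 <= t <= 1 ->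
  simplex_core (t *: (y - x) + x).
Proof.
rewrite /simplex_core /= => hx hy /andP[t0 t1].
have -> : unchart ord0 (t *: (y - x) + x) = unchart ord0 x + t *: (unchart ord0 y - unchart ord0 x).
  rewrite /unchart -mulmxBl scalemxAl -mulmxDl; congr (_ *m _).
  by apply/rowP => j; rewrite !mxE; ring.
have [->|tn0] := eqVneq t 0; first by rewrite scale0r addr0.
by apply: iref_segment => //; [exact: iref_sub|rewrite lt_neqAle eq_sym tn0].
Qed.

(** A point of the simplex outside the core has a vanishing reference coordinate or coordinates of
    sum 1. It thus lies on one of [n.+2] hyperplanes, and each of them is null. *)
Lemma leb_simplex_bdry : measurable (simplex a `\` interior (simplex a)) /\
  leb n.+1 (simplex a `\` interior (simplex a)) = 0%E.
Proof.
have mS := measurable_simplex.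
have mI : measurable (interior (simplex a)) by apply: measurable_open_rV; exact: open_interior.
have mD : measurable (simplex a `\` interior (simplex a)) by exact: measurableD.
split => //.
pose A := invmx (facet_frame ord0).
(* Normals of these hyperplanes: the columns of the inverse frame for the single coordinates, its
   row sums for the sum of the coordinates. *)
pose c (k : option 'I_n.+1) : 'rV[R]_n.+1 :=
  if k is Some k then (col k A)^T else (A *m const_mx 1)^T.
pose d (k : option 'I_n.+1) : R :=
  dot (c k) (facet_base a ord0) + if k is Some _ then 0 else 1.
pose H k := [set x | dot (c k) x = d k].
have uA : A \in unitmx by rewrite unitmx_inv facet_frame_unit.
have c0 k : c k != 0.
  case: k => [k|] /=; apply/eqP => /(congr1 trmx); rewrite trmxK trmx0.
    move=> ck; have := congr1 (mulmx (invmx A)) ck.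
    rewrite mulmx0 colE mulKmx// => /matrixP/(_ k 0); rewrite !mxE eqxx => /eqP.
    by rewrite oner_eq0.
  move=> ck; have := congr1 (mulmx (invmx A)) ck.
  rewrite mulmx0 mulKmx// => /matrixP/(_ 0 0); rewrite !mxE => /eqP.
  by rewrite oner_eq0.
have dotcE k x : dot (c k) x = (x *m (c k)^T) 0 0.
  by rewrite !mxE; apply: eq_bigr => j _; rewrite mxE mulrC.
have mH k : measurable (H k).
  have : measurable_fun setT (fun x : 'rV[R]_n.+1 => dot (c k) x : measurableTypeR R).
    apply: measurable_sum => i; apply: measurable_funM => //; exact: measurable_coord.
  by move=> /(_ measurableT [set d k] (measurable_set1 _)); rewrite setTI.
have sub : simplex a `\` interior (simplex a) `<=` \big[setU/set0]_k H k.
  move=> x [Sx nIx]; have nc : ~ simplex_core x by move=> /simplex_core_interior.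
  move: Sx; rewrite (simplex_unchart ord0) => -[/= y0 y1].
  rewrite -bigcup_seq.
  have yE k : unchart ord0 x 0 k = dot (c (Some k)) x - dot (c (Some k)) (facet_base a ord0).
    rewrite !dotcE /= trmxK !mxE -sumrB; apply: eq_bigr => j _.
    by rewrite !mxE mulrBl.
  have sE : \sum_k unchart ord0 x 0 k = dot (c None) x - dot (c None) (facet_base a ord0).
    rewrite !dotcE /= trmxK !mulmxA -[X in _ = X](_ : ((unchart ord0 x *m const_mx 1 : 'M[R]_1) 0 0) = _).
      by rewrite [RHS]mxE; apply: eq_bigr => j _; rewrite [const_mx _ _ _]mxE mulr1.
    by rewrite /unchart mulmxBl mulmxBl !mxE.
  have [[k yk]|h] := pselect (exists k, unchart ord0 x 0 k = 0).
    exists (Some k); first by rewrite /= mem_index_enum.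
    by rewrite /H /= /d addr0; apply/eqP; rewrite -subr_eq0 -yE yk.
  exists None; first by rewrite /= mem_index_enum.
  have : \sum_k unchart ord0 x 0 k = 1.
    apply/eqP; rewrite eq_le y1 leNgt; apply/negP => s1; apply: nc; split => // k.
    rewrite lt_neqAle y0 andbT eq_sym; apply/eqP => yk; apply: h; by exists k.
  move=> s1; apply/eqP; rewrite /H /= /d addrC -subr_eq -sE s1 eqxx //.
have n0 : leb n.+1 (\big[setU/set0]_k H k) = 0%E.
  apply: bigsetU_null => [k|k]; [exact: mH|exact: leb_hyperplane].
apply/eqP; rewrite eq_le measure_ge0 andbT -n0; apply: le_measure; rewrite ?inE//.
by apply: bigsetU_measurable => k _; exact: mH.
Qed.

Lemma integral_simplex i (f : 'rV[R]_n.+1 -> \bar R) :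
  measurable_fun [set: 'rV[R]_n.+1] f -> (forall x, 0 <= f x)%E ->
  (\int[leb n.+1]_(x in simplex a) f x =
   `|\det (facet_frame i)|%:E * \int[leb n.+1]_(y in ref_simplex) f (chart i y))%E.
Proof.
move=> mf f0; rewrite integral_mkcond.
have g0 x : (0 <= (f \_ (simplex a)) x)%E by rewrite patchE; case: ifP.
have mg : measurable_fun [set: 'rV[R]_n.+1] (f \_ (simplex a)).
  apply/(measurable_restrictT _ measurable_simplex); exact: measurable_funTS.
rewrite (integral_leb_affine (facet_base a i) (facet_frame_unit i) mg g0).
congr (_ * _)%E; rewrite [RHS]integral_mkcond; apply: eq_integral => y _.
rewrite !patchE -/(chart i y) (simplex_unchart i).
rewrite (_ : (chart i y \in unchart i @^-1` ref_simplex) = (y \in ref_simplex))//.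
by apply/idP/idP; rewrite !inE /= chartK.
Qed.

(* The height over the facet, times the facet's volume factor, is |det|; and the
   height is the range of an affine function on the simplex, at least the diameter
   of any ball inside. *)
Lemma facet_height i :
  Num.sqrt (\det (facet_edges a i *m (facet_edges a i)^T)) * inball_diam (simplex a) <=
  `|\det (facet_frame i)|.
Proof.
set E := facet_edges a i; set w := apex_edge i.
have [d0|dn0] := leP (\det (E *m E^T)) 0; first by rewrite ler0_sqrtr// mul0r.
have uG : E *m E^T \in unitmx by rewrite unitmxE unitfE gt_eqF.
(* Coefficients of the orthogonal projection of the apex edge onto the span of the facet edges. The
   remainder [p] is normal to the facet, and its length is the height. *)
pose c := w *m E^T *m invmx (E *m E^T).
pose p := w - c *m E.
have pE : p *m E^T = 0 by rewrite mulmxBl -!mulmxA [invmx _ *m _]mulVmx// mulmx1 subrr.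
have pE' : E *m p^T = 0 by rewrite -[E]trmxK -trmx_mul pE trmx0.
(* Passing from [w] to [p] is a unipotent row operation, and the Gram matrix of the new rows is
   block diagonal. Hence the squared determinant is [dot p p] times the Gram determinant of the
   facet. *)
have M'E : col_mx p E = (block_mx 1%:M (- c) 0 1%:M : 'M[R]_(1 + n)) *m col_mx w E.
  by rewrite mul_block_col !mul1mx mul0mx add0r mulNmx.
have detM : \det (col_mx p E : 'M[R]_(1 + n)) = \det (facet_frame i).
  by rewrite M'E det_mulmx det_ublock !det1 !mul1r.
have pp : p *m p^T = (dot p p)%:M.
  by rewrite [LHS]mx11_scalar dot_mulmx.
have sq : \det (facet_frame i) ^+ 2 = dot p p * \det (E *m E^T).
  rewrite -detM expr2 -{2}(det_tr (col_mx p E : 'M[R]_(1 + n))) -det_mulmx tr_col_mx.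
  rewrite mul_col_row pE pE' pp.
  have -> : E *m E^T = E *m E^T by [].
  by rewrite [LHS](@det_ublock _ 1 n) det_scalar1.
have -> : `|\det (facet_frame i)| = Num.sqrt (\det (E *m E^T)) * enorm p.
  by rewrite -sqrtr_sqr sq mulrC sqrtrM ?ltW.
apply: ler_wpM2l; first exact: sqrtr_ge0.
have dp : dot p p != 0.
  apply/negP => /eqP p0; have := facet_frame_unit i.
  by rewrite unitmxE unitfE -sqrf_eq0 sq p0 mul0r eqxx.
have np : 0 < enorm p by rewrite /enorm sqrtr_gt0 lt_neqAle eq_sym dp dot_ge0.
have wp : dot p w = dot p p.
  have -> : w = p + c *m E by rewrite subrK.
  rewrite dotDr -[RHS]addr0; congr (_ + _).
  by rewrite dot_mulmx trmx_mul mulmxA pE mul0mx mxE.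
(* The simplex lies between the hyperplanes orthogonal to [p] through the facet and through the
   apex. *)
have slab x : simplex a x -> 0 <= dot p (x - facet_base a i) <= dot p p.
  move=> /(simplex_chartP i)[y [y0 y1] ->].
  rewrite -(rVcons_row y) chart_rVcons addrC addKr dotDr dotZr wp.
  rewrite [X in _ + X]dot_mulmx trmx_mul mulmxA pE mul0mx mxE addr0.
  rewrite mulr_ge0 ?dot_ge0//= -[leRHS]mul1r ler_wpM2r ?dot_ge0//.
  apply: le_trans y1; rewrite (bigD1 ord0)//= lerDl; exact: sumr_ge0.
(* The supremum is over a nonempty set, thanks to the ball of radius 0 about a vertex. *)
apply: sup_le_ub.
  exists (2 * 0); exists 0 => //; split=> //; exists (a ord0) => x /= hx.
  have /eqP : enorm (x - a ord0) = 0 by apply/eqP; rewrite eq_le hx enorm_ge0.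
  rewrite -sqrf_eq0 sqr_enorm => /eqP/dot_eq0/eqP; rewrite subr_eq0 => /eqP ->.
  exact: vertex_simplex.
move=> _ [r [r0 [x hx]] <-].
(* Both ends of the diameter parallel to [p] lie in the slab, so that [2 r |p| <= |p|^2]. *)
have hr (s : R) : `|s| <= r -> simplex a (x + (s / enorm p) *: p).
  move=> sr; apply: hx; rewrite /= addrC addKr /enorm dotZl dotZr mulrA -expr2.
  by rewrite sqrtrM ?sqr_ge0// sqrtr_sqr normrM normfV (ger0_norm (enorm_ge0 _)) divfK// gt_eqF.
have h1 := slab _ (hr r _); have h2 := slab _ (hr (- r) _).
move: h1 h2; rewrite normrN ger0_norm// lexx => /(_ isT)/andP[_ h1] /(_ isT)/andP[h2 _].
have E1 (s : R) : dot p (x + (s / enorm p) *: p - facet_base a i) = dot p (x - facet_base a i) + s * enorm p.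
  rewrite addrAC dotDr dotZr -sqr_enorm; congr (_ + _); field; exact: lt0r_neq0.
rewrite E1 in h1; rewrite E1 in h2.
rewrite -(ler_pM2r np) -expr2 sqr_enorm.
lra.
Qed.

Lemma inball_diam_ge0 : 0 <= inball_diam (simplex a).
Proof.
rewrite /inball_diam; set S := (X in sup X).
have [hS|/sup_out ->//] := pselect (has_sup S).
have [[s [r [r0 hr] rs]] _] := hS; apply: le_trans (ub_le_sup hS.2 (x := s) _); last by exists r.
by rewrite -rs mulr_ge0.
Qed.

End Simplex.

(** * Traces on the facets of an arbitrary simplex *)

Section TraceInequality.
Context {R : realType}.

(** The limit is along the interior of the simplex, where [g] is [P]. The filter is proper because
    the core is dense in the simplex, so that the limit is unique. *)
Lemma elem_trace_eq n (a : 'I_n.+2 -> 'rV[R]_n.+1) (V : normedModType R)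
    (g P : 'rV[R]_n.+1 -> V) x : Defs.nondegenerate a -> simplex a x ->
  (forall y, interior (simplex a) y -> g y = P y) -> {for x, continuous P} ->
  elem_trace a g x = P x.
Proof.
move=> nd Sx gP cP; apply: cvg_lim; first exact: norm_hausdorff.
  apply: within_nbhs_proper => A /(closure_simplex_core nd Sx)[y [cy Ay]].
  by exists y; split=> //; exact: simplex_core_interior.
apply: (@cvg_trans _ (P @ within (interior (simplex a)) (nbhs x))); last first.
  by apply: cvg_trans cP; apply: cvg_app; exact: cvg_within.
apply: near_eq_cvg; rewrite near_withinE; apply: nearW => y Sy; exact/esym/gP.
Qed.

(** In the chart the facet integral carries the facet factor and the volume integral carries
    [|det|]; [facet_height] compares the two. The constant is that of the reference simplex, hence
    independent of [a] and [i]. *)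
Lemma trace_inequality n m : exists2 C : R, 0 <= C &
  forall (a : 'I_n.+2 -> 'rV[R]_n.+1) i (p : 'rV[R]_n.+1 -> R), Defs.nondegenerate a -> mpol m p ->
    facet_integral a i (fun x => p x ^+ 2) * inball_diam (simplex a) <=
    C * \int[leb n.+1]_(x in simplex a) (p x ^+ 2).
Proof.
have [C C0 hC] := @reference_trace_inequality R n m.
exists C => // a i p nd hp.
have hq : mpol m (fun x => p (chart a i x)) by exact: mpol_affine.
have vol : \int[leb n.+1]_(x in simplex a) (p x ^+ 2) =
    `|\det (facet_frame a i)| * \int[leb n.+1]_(y in ref_simplex) (p (chart a i y) ^+ 2).
  rewrite /Rintegral (@integral_simplex _ _ _ nd i (fun x => (p x ^+ 2)%:E)).
  - rewrite fineM//; apply: integrable_fin_num; first exact: measurable_ref_simplex.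
    have := mpol_integrable_bounded (mpolM hq hq) (@measurable_ref_simplex R n.+1) (@bounded_ref_simplex R n.+1).
    by [].
  - apply/measurable_EFinP; apply: measurable_continuous_rV; exact: mpol_continuous (mpolM hp hp).
  - by move=> x; rewrite lee_fin sqr_ge0.
rewrite vol /facet_integral.
have -> : \int[leb n]_(y in ref_simplex) p (facet_base a i + y *m facet_edges a i) ^+ 2 =
    \int[leb n]_(y in ref_simplex) p (chart a i (rVcons (0, y))) ^+ 2.
  by apply: eq_Rintegral => y _; rewrite chart_rVcons scale0r add0r.
have I0 : 0 <= \int[leb n.+1]_(y in ref_simplex) p (chart a i y) ^+ 2.
  by apply: Rintegral_ge0 => y _; rewrite sqr_ge0.
have J0 : 0 <= \int[leb n]_(y in ref_simplex) p (chart a i (rVcons (0, y))) ^+ 2.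
  by apply: Rintegral_ge0 => y _; rewrite sqr_ge0.
rewrite mulrAC; apply: (le_trans (ler_wpM2r J0 (facet_height nd i))).
by rewrite [leRHS]mulrCA ler_wpM2l// hC.
Qed.

End TraceInequality.

(** * Meshes and piecewise polynomials *)

Section EnormExtra.
Context {R : realType} {m : nat}.
Implicit Types u v : 'rV[R]_m.

Lemma enorm0 : enorm (0 : 'rV[R]_m) = 0.
Proof. by rewrite /enorm /dot big1 ?sqrtr0// => i _; rewrite mxE mul0r. Qed.

Lemma enormN u : enorm (- u) = enorm u.
Proof. by rewrite /enorm -scaleN1r dotZl dotZr mulrA mulrNN mulr1 mul1r. Qed.

Lemma enorm_le_norm u : enorm u <= m%:R * `|u|.
Proof.
rewrite -(@ler_pXn2r _ 2) ?nnegrE ?enorm_ge0 ?mulr_ge0// sqr_enorm exprMn.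
apply: (@le_trans _ _ (m%:R * `|u| ^+ 2)).
  rewrite /dot mulr_natl -[X in _ *+ X]card_ord -sumr_const; apply: ler_sum => i _.
  by rewrite -expr2 -real_normK ?num_real// lerXn2r ?nnegrE ?coord_le_norm.
rewrite ler_wpM2r ?sqr_ge0// -natrX ler_nat.
by case: m => // k; rewrite expnS leq_pmulr ?expn_gt0.
Qed.

Lemma enormD u v : enorm (u + v) <= enorm u + enorm v.
Proof.
rewrite -(@ler_pXn2r _ 2) ?nnegrE ?addr_ge0 ?enorm_ge0// sqr_enorm sqrrD !sqr_enorm.
rewrite dotDl !dotDr (dotC v u).
have := le_trans (ler_norm _) (dot_le_enorm u v); lra.
Qed.

Lemma norm_delta_le1 (i : 'I_m) : `|delta_mx 0 i : 'rV[R]_m| <= 1.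
Proof.
rewrite [leLHS]mx_normrE; apply/bigmax_leP; split => // -[j k] _ /=.
by rewrite mxE; case: (_ && _); rewrite ?normr1// normr0.
Qed.

Lemma mulmxB_coord k (U : 'M[R]_(m, k)) u v j :
  (u *m U) 0 j - (v *m U) 0 j = ((u - v) *m U) 0 j.
Proof. by rewrite mulmxBl [RHS]mxE; congr (_ + _); rewrite [RHS]mxE. Qed.

Lemma enorm_orthogonal (U : 'M[R]_m) u : U *m U^T = 1%:M -> enorm (u *m U) = enorm u.
Proof. by move=> hU; rewrite /enorm !dot_mulmx trmx_mul mulmxA -(mulmxA u) hU mulmx1. Qed.

End EnormExtra.

(** * A Lipschitz domain lies on one side of its boundary *)

Section DomainInterior.
Context {R : realType} {n : nat}.
Variable Om : set 'rV[R]_n.+1.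

Lemma enorm_col' (u : 'rV[R]_n.+1) : enorm (col' ord_max u) <= enorm u.
Proof.
rewrite ler_sqrt ?dot_ge0// /dot [leRHS](bigD1_ord ord_max)//=.
under eq_bigr do rewrite !mxE.
by rewrite lerDr -expr2 sqr_ge0.
Qed.

(* Excludes slits, so that element interiors lie in Om. *)
Lemma interior_closure_lipschitz : open Om -> lipschitz_boundary Om ->
  interior (closure Om) `<=` Om.
Proof.
move=> oOm hL x ix; apply: contrapT => nx.
have bx : bdry Om x.
  split; first exact: interior_subset ix.
  by move=> /interior_subset.
have [U [gam [L [r [hU gamL r0 hy]]]]] := hL x bx.
have xle : (x *m U) 0 ord_max <= gam (col' ord_max (x *m U)).
  by rewrite leNgt; apply/negP => h; apply: nx; apply/(hy x _) => //; rewrite subrr enorm0.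
have hU' : U^T *m U = 1%:M by exact: mulmx1C.
(* The upward direction of the graph coordinates, expressed in the original ones. *)
pose v : 'rV[R]_n.+1 := delta_mx 0 ord_max *m U^T.
have vU : v *m U = delta_mx 0 ord_max by rewrite -mulmxA hU' mulmx1.
have /nbhs_ballP[d /= d0 hd] : nbhs x (closure Om) by [].
pose K : R := n.+1%:R * `|v| + 1.
have K0 : 0 < K by rewrite ltr_wpDl ?mulr_ge0.
(* Small enough for [x - t *: v] to remain both in the ball contained in [closure Om] and in the
   ball where the graph describes [Om]. *)
pose t := Num.min (d / 2) (r / 2) / K.
have t0 : 0 < t by rewrite divr_gt0// lt_min !divr_gt0.
have tK : t * K <= d / 2 /\ t * K <= r / 2.
  by rewrite /t divfK ?gt_eqF// !ge_min !lexx orbT.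
have vK : `|v| <= K.
  rewrite /K -[leLHS]mul1r ler_wpDr// ler_wpM2r// ler1n//.
have evK : enorm v <= K by apply: (le_trans (enorm_le_norm v)); rewrite lerDl.
pose y := x - t *: v.
have cy : closure Om y.
  apply: hd; rewrite -ball_normE /= /y opprB addrC subrK normrZ gtr0_norm//.
  have : t * `|v| <= t * K by rewrite ler_pM2l.
  move=> h; apply: (le_lt_trans h); apply: (le_lt_trans tK.1); lra.
pose M : R := (`|L| + 1) * n.+1%:R.
have M0 : 0 < M by rewrite mulr_gt0// ltr_wpDl.
(* A point [z] of [Om] within [e] of [y] is still in the range of the graph description, and its
   change of height plus the change of [gam] is less than [t]. So [z] remains below the graph, which
   contradicts that it belongs to [Om]. *)
pose e := Num.min (t / M) (r / (2 * n.+1%:R)).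
have e0 : 0 < e.
  by rewrite lt_min; apply/andP; split; apply: divr_gt0 => //; rewrite mulr_gt0.
have [z [Omz zy]] := cy _ (nbhsx_ballx y e e0).
have {}zy : `|z - y| < e by move: zy; rewrite -ball_normE /= distrC.
have ezy : enorm (z - y) <= n.+1%:R * `|z - y| by exact: enorm_le_norm.
have exy : enorm (y - x) <= r / 2.
  rewrite /y addrAC subrr add0r -scaleNr /enorm dotZl dotZr mulrA -expr2 sqrtrM ?sqr_ge0//.
  rewrite sqrtr_sqr normrN gtr0_norm//; apply: le_trans tK.2; by rewrite ler_pM2l.
have tri : enorm (z - x) < r.
  have -> : z - x = (z - y) + (y - x) by rewrite addrA subrK.
  apply: (le_lt_trans (enormD _ _)); apply: (@lt_le_trans _ _ (r / 2 + r / 2)); last by rewrite -splitr.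
  apply: ltr_leD exy; apply: (le_lt_trans ezy).
  rewrite mulrC -ltr_pdivlMr//; apply: (lt_le_trans zy).
  by rewrite ge_min; apply/orP; right; rewrite invfM mulrA lexx.
have := (hy z tri).1 Omz.
have yU : y *m U = x *m U - t *: delta_mx 0 ord_max by rewrite mulmxBl -scalemxAl vU.
have yc : col' ord_max (y *m U) = col' ord_max (x *m U).
  apply/rowP => j; by rewrite yU !mxE [lift _ _ == _]eq_sym (negbTE (neq_lift _ _)) andbF mulr0 subr0.
have ym : (y *m U) 0 ord_max = (x *m U) 0 ord_max - t by rewrite yU !mxE !eqxx mulr1.
have gz : gam (col' ord_max (x *m U)) - gam (col' ord_max (z *m U)) <= `|L| * (n.+1%:R * `|z - y|).
  rewrite -yc; apply: (le_trans (ler_norm _)); apply: (le_trans (gamL _ _)).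
  apply: (@le_trans _ _ (`|L| * enorm (col' ord_max (y *m U) - col' ord_max (z *m U)))).
    by rewrite ler_wpM2r ?enorm_ge0// ler_norm.
  rewrite ler_wpM2l//; apply: le_trans ezy.
  rewrite -[z - y]opprB -linearB/= -mulmxBl.
  apply: (le_trans (enorm_col' _)).
  by rewrite enorm_orthogonal// enormN.
have zm : (z *m U) 0 ord_max - (y *m U) 0 ord_max <= n.+1%:R * `|z - y|.
  have -> : (z *m U) 0 ord_max - (y *m U) 0 ord_max = ((z - y) *m U) 0 ord_max.
    exact: mulmxB_coord.
  apply: (le_trans (ler_norm _)); apply: (le_trans (coord_le_enorm _ _)).
  by rewrite enorm_orthogonal.
have : M * `|z - y| < t.
  rewrite mulrC -ltr_pdivlMr//; apply: (lt_le_trans zy); by rewrite ge_min lexx.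
have -> : M * `|z - y| = `|L| * (n.+1%:R * `|z - y|) + n.+1%:R * `|z - y| by rewrite /M; ring.
rewrite ym in zm; lra.
Qed.

End DomainInterior.

(** * Triangulations, their skeleton, and piecewise polynomials *)

Section Mesh.
Context {R : realType} {n N : nat}.
Variables (Om : set 'rV[R]_n.+1) (T : 'I_N -> 'I_n.+2 -> 'rV[R]_n.+1).
Hypothesis hOm : bounded_lipschitz_domain Om.
Hypothesis hT : triangulation Om T.

Let nd e : Defs.nondegenerate (T e). Proof. by case: hT. Qed.

Lemma face_unchart e (J : {set 'I_n.+2}) j x : j \notin J -> face (T e) J x ->
  unchart (T e) j x 0 ord0 = 0.
Proof.
move=> jJ [lam [l0 lJ l1 ->]].
by rewrite (chart_bary _ j l1) chartK// mxE unlift_none lJ.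
Qed.

(** The reference coordinate of a missing vertex vanishes on the face, whereas an open set allows a
    small step in the direction of that coordinate. *)
Lemma open_in_face e (J : {set 'I_n.+2}) (G : set 'rV[R]_n.+1) : open G -> G !=set0 ->
  G `<=` face (T e) J -> J = [set: 'I_n.+2]%SET.
Proof.
move=> oG [x Gx] GJ; apply/finset.setP => j; rewrite inE.
apply/negPn/negP => jJ.
have : nbhs (unchart (T e) j x) (chart (T e) j @^-1` G).
  apply: chart_continuous; rewrite unchartK//; exact: open_nbhs_nbhs.
move=> /nbhs_ballP[d /= d0 hd].
pose y := unchart (T e) j x + (d / 2) *: delta_mx 0 ord0.
have /hd/GJ/(face_unchart jJ) : ball (unchart (T e) j x) d y.
  rewrite -ball_normE /= /y opprD addrA subrr add0r normrN normrZ gtr0_norm ?divr_gt0//.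
  apply: (@le_lt_trans _ _ (d / 2 * 1)); last by rewrite mulr1; lra.
  by rewrite ler_wpM2l ?norm_delta_le1// ltW// divr_gt0.
have -> : unchart (T e) j (chart (T e) j y) 0 ord0 = unchart (T e) j x 0 ord0 + d / 2.
  by rewrite chartK// /y [LHS]mxE; congr (_ + _); rewrite !mxE !eqxx mulr1.
rewrite (face_unchart jJ (GJ _ Gx)) add0r => /eqP.
by rewrite mulf_eq0 (gt_eqF d0) invr_eq0 pnatr_eq0.
Qed.

(** By conformity the two simplices meet in a common face. If that face contains a nonempty open set
    it is all of both, and distinct indices have distinct simplices. *)
Lemma interior_simplex_disjoint e e' x : interior (simplex (T e)) x ->
  interior (simplex (T e')) x -> e = e'.
Proof.
move=> xe xe'; have [_ inj hf _] := hT; have [J [J' [JE J'E]]] := hf e e'.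
pose G := interior (simplex (T e)) `&` interior (simplex (T e')).
have oG : open G by apply: openI; exact: open_interior.
have G0 : G !=set0 by exists x.
have GS : G `<=` simplex (T e) `&` simplex (T e').
  by move=> y [/interior_subset ? /interior_subset].
apply: inj; have := @open_in_face e J G oG G0; rewrite -JE => /(_ GS) JT.
have := @open_in_face e' J' G oG G0; rewrite -J'E => /(_ GS) J'T.
by rewrite JT in JE; rewrite J'T in J'E; rewrite [LHS](esym JE) J'E.
Qed.

Lemma simplex_sub_closure e : simplex (T e) `<=` closure Om.
Proof. by have [_ _ _ <-] := hT; move=> x hx; exists e. Qed.

Lemma interior_simplex_sub e : interior (simplex (T e)) `<=` Om.
Proof.
have [_ oOm _ _ lip] := hOm.
apply: subset_trans (interior_closure_lipschitz oOm lip).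
by move=> x; apply: filterS; exact: simplex_sub_closure.
Qed.

Definition mesh_open : set 'rV[R]_n.+1 := \bigcup_e interior (simplex (T e)).

(** Subtracting [mesh_open] makes the two sets disjoint by construction; otherwise one would have to
    show that no element boundary meets the interior of another element. *)
Definition mesh_skeleton : set 'rV[R]_n.+1 :=
  (\big[setU/set0]_e (simplex (T e) `\` interior (simplex (T e)))) `\` mesh_open.

Lemma open_mesh_open : open mesh_open.
Proof. by apply: bigcup_open => e _; exact: open_interior. Qed.

Lemma mesh_open_sub : mesh_open `<=` Om.
Proof. by move=> x [e _]; exact: interior_simplex_sub. Qed.

Lemma measurable_mesh_open : measurable mesh_open.
Proof. by apply: measurable_open_rV; exact: open_mesh_open. Qed.

Lemma measurable_mesh_skeleton : measurable mesh_skeleton.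
Proof.
apply: measurableD; last exact: measurable_mesh_open.
by apply: bigsetU_measurable => e _; exact: (leb_simplex_bdry (nd e)).1.
Qed.

Lemma leb_mesh_skeleton : leb n.+1 mesh_skeleton = 0%E.
Proof.
have n0 : leb n.+1 (\big[setU/set0]_e (simplex (T e) `\` interior (simplex (T e)))) = 0%E.
  by apply: bigsetU_null => e; [exact: (leb_simplex_bdry (nd e)).1|exact: (leb_simplex_bdry (nd e)).2].
apply/eqP; rewrite eq_le measure_ge0 andbT -n0; apply: le_measure; rewrite ?inE//.
- exact: measurable_mesh_skeleton.
- by apply: bigsetU_measurable => e _; exact: (leb_simplex_bdry (nd e)).1.
- by move=> x [].
Qed.

Lemma closure_mesh x : closure Om x -> mesh_open x \/ mesh_skeleton x.
Proof.
have [_ _ _ <-] := hT; move=> [e _ hx].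
have [?|nx] := pselect (mesh_open x); [by left|right; split => //].
rewrite -bigcup_seq; exists e; first by rewrite /= mem_index_enum.
by split => // hi; apply: nx; exists e.
Qed.

Lemma measurable_Om : measurable Om.
Proof. by apply: measurable_open_rV; case: hOm. Qed.

(** Valid for every [f], so it applies to derivatives whose values on the skeleton are unknown. [B]
    is meant for the exceptional set of the almost everywhere bounds on the viscosity. *)
Lemma integral_mesh_open (B : set 'rV[R]_n.+1) (f : 'rV[R]_n.+1 -> R) : measurable B -> leb n.+1 B = 0%E ->
  \int[leb n.+1]_(x in Om) f x = \int[leb n.+1]_(x in mesh_open `\` B) f x.
Proof.
move=> mB B0; rewrite /Rintegral (@integral_null_set _ _ _ _ _ (mesh_skeleton `|` B)).
- congr (fine (integral _ _ _)); apply/seteqP; split => x.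
    move=> [Ox /not_orP[sx Bx]]; split => //.
    by case: (closure_mesh (subset_closure Ox)).
  move=> [Ox Bx]; split; first exact: mesh_open_sub.
  by move=> [[_ //]|//].
- by apply: measurableU => //; exact: measurable_mesh_skeleton.
- by rewrite null_set_setU//; [exact: measurable_mesh_skeleton|exact: leb_mesh_skeleton].
Qed.

(** Values outside the open elements are left free, so that derivatives of discrete functions
    qualify and sums and products stay in the class. *)
Definition pwpol (g : 'rV[R]_n.+1 -> R) := exists m, forall e, exists2 P, mpol m P &
  forall x, interior (simplex (T e)) x -> g x = P x.

Lemma pwpol_cst c : pwpol (fun=> c).
Proof. by exists 0%N => e; exists (fun=> c) => //; exact: mpol_cst. Qed.

Lemma pwpolD f g : pwpol f -> pwpol g -> pwpol (fun x => f x + g x).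
Proof.
move=> [m hf] [k hg]; exists (maxn m k) => e.
have [P hP fP] := hf e; have [S hS gS] := hg e.
exists (fun x => P x + S x); last by move=> x hx; rewrite fP// gS.
by apply: mpol_add; [exact: mpolW (leq_maxl _ _) hP|exact: mpolW (leq_maxr _ _) hS].
Qed.

Lemma pwpolM f g : pwpol f -> pwpol g -> pwpol (fun x => f x * g x).
Proof.
move=> [m hf] [k hg]; exists (m + k)%N => e.
have [P hP fP] := hf e; have [S hS gS] := hg e.
by exists (fun x => P x * S x); [exact: mpolM|move=> x hx; rewrite fP// gS].
Qed.

Lemma measurable_pwpol g : pwpol g -> measurable_fun mesh_open (g : _ -> measurableTypeR R).
Proof.
move=> [m hg]; move=> _ Y mY.
have -> : mesh_open `&` g @^-1` Y = \bigcup_(e in [set: 'I_N]) (interior (simplex (T e)) `&` g @^-1` Y).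
  apply/seteqP; split=> [x [[e _ hx] Yx]|x [e _ [hx Yx]]]; first by exists e.
  by split => //; exists e.
apply: fin_bigcup_measurable => // e _.
have [P hP gP] := hg e.
have -> : interior (simplex (T e)) `&` g @^-1` Y = interior (simplex (T e)) `&` P @^-1` Y.
  by apply/seteqP; split=> x [hx]; rewrite /= gP.
have mP := measurable_continuous_rV (mpol_continuous hP).
apply: measurableI; first by apply: measurable_open_rV; exact: open_interior.
by have := mP measurableT Y mY; rewrite setTI.
Qed.

Lemma bounded_mesh : exists2 M : R, 0 <= M & forall e x, simplex (T e) x -> `|x| <= M.
Proof.
have /choice[M hM] : forall e, exists M : R, forall x, simplex (T e) x -> `|x| <= M.
  move=> e; have [M [Mr hM]] := bounded_simplex (T e).
  by exists (`|M| + 1) => x hx; apply: hM => //; rewrite (le_lt_trans (ler_norm _))// ltrDl.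
exists (\sum_e `|M e|); first exact: sumr_ge0.
move=> e x hx; apply: (le_trans (hM e x hx)); apply: (le_trans (ler_norm _)).
by rewrite (bigD1 e)//= lerDl sumr_ge0.
Qed.

Lemma pwpol_bounded g : pwpol g -> exists M : R, forall x, mesh_open x -> `|g x| <= M.
Proof.
move=> [m hg]; have [M M0 hM] := bounded_mesh.
have /choice[L hL] : forall e, exists L : R, forall x, interior (simplex (T e)) x -> `|g x| <= L.
  move=> e; have [P hP gP] := hg e; have [L _ [hL _]] := mpol_lipschitz M hP.
  by exists L => x hx; rewrite gP//; apply: hL; apply: (hM e); exact: interior_subset hx.
exists (\sum_e `|L e|) => x [e _ hx]; apply: (le_trans (hL e x hx)); apply: (le_trans (ler_norm _)).
by rewrite (bigD1 e)//= lerDl sumr_ge0.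
Qed.

(** Around an interior point of an element the function coincides with its polynomial, hence so do
    the difference quotients. Values agree on the closed element, derivatives only inside. *)
Lemma lagrange_pieces k v e : Defs.lagrange Om T k v -> exists P, [/\ mpol k P,
  forall x, simplex (T e) x -> v x = P x &
  forall x, interior (simplex (T e)) x -> forall i,
    derivable v x (delta_mx 0 i) /\ pderive i v x = pderive i P x].
Proof.
move=> [_ _ /(_ e)[P [hP vP]]]; exists P; split.
- exact: polynomial_fun_mpol.
- by move=> x hx; apply: vP; rewrite inE.
move=> x hx i; have hmP := polynomial_fun_mpol hP.
have near_vP : \forall y \near x, P y = v y.
  have : nbhs x (interior (simplex (T e))) by apply: open_nbhs_nbhs; split => //; exact: open_interior.
  by apply: filterS => y /interior_subset hy; apply/esym/vP; rewrite inE.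
split; first by apply: (near_eq_derivable near_vP); exact: mpol_derivable hmP.
by apply/esym; exact: near_eq_derive near_vP.
Qed.

Lemma lagrange_pwpol k v : Defs.lagrange Om T k v -> pwpol v.
Proof.
move=> hv; exists k => e; have [P [hP vP _]] := lagrange_pieces e hv.
by exists P => // x /interior_subset; exact: vP.
Qed.

Lemma pderive_pwpol k v i : Defs.lagrange Om T k v -> pwpol (pderive i v).
Proof.
move=> hv; exists k => e; have [P [hP _ dP]] := lagrange_pieces e hv.
by exists (pderive i P); [exact: mpol_pderive|move=> x hx; have [_ ->] := dP x hx i].
Qed.

Lemma pderive_lin k v w a i x : Defs.lagrange Om T k v -> Defs.lagrange Om T k w -> mesh_open x ->
  pderive i (fun y => a * v y + w y) x = a * pderive i v x + pderive i w x.
Proof.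
move=> hv hw [e _ hx]; have [P [_ _ dP]] := lagrange_pieces e hv.
have [S [_ _ dS]] := lagrange_pieces e hw.
have [dv _] := dP x hx i; have [dw _] := dS x hx i.
by rewrite /pderive [LHS](deriveD (derivableZ (k := a) dv) dw) deriveZ.
Qed.

End Mesh.

(** * Products of square-integrable functions *)

Section SquareIntegrable.
Context {R : realType} {n : nat}.
Variable D : set 'rV[R]_n.
Hypotheses (mD : measurable D) (fD : (leb n D < +oo)%E).
Local Notation mu := (leb n).
Local Notation intg f := (mu.-integrable D (EFin \o f)).
Implicit Types f g : 'rV[R]_n -> R.

Definition sqi f := measurable_fun D (f : _ -> measurableTypeR R) /\ intg (fun x => f x ^+ 2).

Lemma sqi_mul f g : sqi f -> sqi g -> intg (fun x => f x * g x).
Proof.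
move=> [mf hf] [mg hg].
apply: (le_integrable mD _ _ (integrable_EFinD mD hf hg)).
  by apply/measurable_EFinP; exact: measurable_funM.
move=> x Dx /=; rewrite lee_fin normrM [leRHS]ger0_norm ?addr_ge0 ?sqr_ge0//.
rewrite -(real_normK (num_real (f x))) -(real_normK (num_real (g x))).
have := sqr_ge0 (`|f x| - `|g x|); have := sqr_ge0 (`|f x| + `|g x|); nra.
Qed.

Lemma bounded_sqi f (M : R) : measurable_fun D (f : _ -> measurableTypeR R) ->
  (forall x, D x -> `|f x| <= M) -> sqi f.
Proof.
move=> mf hM; split => //; apply: (@bounded_integrable _ _ _ _ (M ^+ 2)) => //.
  exact: measurable_funX.
move=> x Dx; rewrite normrX lerXn2r ?nnegrE ?hM//; exact: le_trans (hM x Dx).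
Qed.

Lemma bounded_mul_sqi b f (M : R) : measurable_fun D (b : _ -> measurableTypeR R) ->
  (forall x, D x -> `|b x| <= M) -> sqi f -> sqi (fun x => b x * f x).
Proof.
move=> mb hM [mf hf]; split; first exact: measurable_funM.
apply: (le_integrable mD _ _ (integrable_EFinZ mD (M ^+ 2) hf)).
  by apply/measurable_EFinP; apply: measurable_funX; exact: measurable_funM.
move=> x Dx; have bM : b x ^+ 2 <= M ^+ 2.
  rewrite -(real_normK (num_real (b x))).
  by rewrite lerXn2r ?nnegrE ?hM//; exact: le_trans (hM x Dx).
have p1 : 0 <= b x ^+ 2 * f x ^+ 2 by apply: mulr_ge0; exact: sqr_ge0.
have p2 : 0 <= M ^+ 2 * f x ^+ 2 by apply: mulr_ge0; exact: sqr_ge0.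
by rewrite /= lee_fin exprMn (ger0_norm p1) (ger0_norm p2) ler_wpM2r ?sqr_ge0.
Qed.

Lemma sqiD f g : sqi f -> sqi g -> sqi (fun x => f x + g x).
Proof.
move=> hf hg; split; first exact: measurable_funD hf.1 hg.1.
have -> : (fun x => (f x + g x) ^+ 2) = (fun x => (f x * f x + 2 * (f x * g x)) + g x * g x).
  by apply/funext => x; ring.
apply: integrable_EFinD => //; last exact: sqi_mul.
apply: integrable_EFinD => //; first exact: sqi_mul.
by apply: integrable_EFinZ => //; exact: sqi_mul.
Qed.

Lemma sqiZ a f : sqi f -> sqi (fun x => a * f x).
Proof.
by move=> hf; apply: (@bounded_mul_sqi (fun=> a) f `|a|).
Qed.

Lemma sqi_sum I (s : seq I) (F : I -> 'rV[R]_n -> R) : (forall i, sqi (F i)) ->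
  sqi (fun x => \sum_(i <- s) F i x).
Proof.
move=> hF; elim: s => [|i s IH].
  rewrite (_ : (fun _ => _) = fun=> 0); last by apply/funext => x; rewrite big_nil.
  by apply: (@bounded_sqi _ 0) => // x _; rewrite normr0.
rewrite (_ : (fun _ => _) = fun x => F i x + \sum_(j <- s) F j x); first exact: sqiD.
by apply/funext => x; rewrite big_cons.
Qed.

End SquareIntegrable.

(** * Mixed derivatives of conforming functions *)

Section LipschitzCover.
Context {R : realType}.

(* Jump to the last point of the closed piece containing [a], then drop that piece. *)
Lemma closed_cover_lipschitz (I : eqType) (S : I -> set R) (phi : R -> R) (L : R) (s : seq I) (a b : R) :
  0 <= L -> continuous phi -> (forall i, closed (S i)) ->
  (forall i t u, S i t -> S i u -> `|phi t - phi u| <= L * `|t - u|) ->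
  a <= b -> (forall t, a <= t <= b -> exists2 i, i \in s & S i t) ->
  `|phi a - phi b| <= L * (b - a).
Proof.
move=> L0 cphi cS lS; move: {2}(size s) (erefl (size s)) => k.
elim: k s a => [|k IH] s a sk ab hs.
  have [i] := hs a (introT andP (conj (lexx a) ab)).
  by rewrite (size0nil sk).
have [i si Sa] := hs a (introT andP (conj (lexx a) ab)).
pose E := [set t | S i t /\ a <= t <= b].
have Ea : E a by split; rewrite ?lexx.
have ubE : ubound E b by move=> t [_ /andP[]].
have supE : has_sup E by split; [exists a|exists b].
pose c := sup E.
have ac : a <= c by apply: ub_le_sup Ea; exact: supE.2.
have cb : c <= b by apply: sup_le_ub => //; exists a.
have clE : closed E.
  have -> : E = S i `&` [set t | a <= t] `&` [set t | t <= b].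
    by apply/seteqP; split=> t; [move=> [h /andP[]]|move=> [[h h1] h2]; split=> //; apply/andP].
  by apply: closedI; [apply: closedI => //; exact: closed_ge|exact: closed_le].
have [Sc _] : E c by apply: clE; apply: closure_sup; [exists a|exists b].
have h1 : `|phi a - phi c| <= L * (c - a).
  by apply: (le_trans (lS i a c Sa Sc)); rewrite distrC ger0_norm ?subr_ge0.
have h2 : `|phi c - phi b| <= L * (b - c).
  have [->|cnb] := eqVneq c b; first by rewrite !subrr normr0 mulr0.
  have {}cnb : c < b by rewrite lt_neqAle cnb.
  (* Beyond [c] the piece [i] has no point of the interval left, but at [c] it may be the only piece
     available. The induction hypothesis is therefore used from some [t > c], at the price of an
     error [e] given by continuity. *)
  apply/ler_addgt0Pr => e e0.
  have : \forall t \near c, `|phi c - phi t| < e.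
    by move/cvgr_dist_lt : (cphi c) => /(_ _ e0).
  move=> /nbhs_ballP[d /= d0 hd].
  pose t := Num.min b (c + d / 2).
  have ct : c < t by rewrite lt_min cnb ltrDl divr_gt0.
  have tb : t <= b by rewrite ge_min lexx.
  have pt : `|phi c - phi t| < e.
    apply: hd; rewrite /ball/= distrC gtr0_norm ?subr_gt0// ltrBlDl.
    apply: (@le_lt_trans _ _ (c + d / 2)); first by rewrite ge_min lexx orbT.
    by rewrite ltrD2l ltr_pdivrMr// ltr_pMr// ltr1n.
  have : `|phi t - phi b| <= L * (b - t).
    apply: (IH (rem i s)) => //; first by rewrite size_rem// sk.
    move=> u /andP[tu ub].
    have [j js Sj] := hs u (introT andP (conj (le_trans ac (le_trans (ltW ct) tu)) ub)).
    have ji : j != i.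
      apply: contraTneq (lt_le_trans ct tu) => ji; rewrite -leNgt.
      apply: ub_le_sup; first exact: supE.2.
      split; first by rewrite -ji.
      by rewrite ub andbT (le_trans ac)// (le_trans (ltW ct)).
    exists j => //; move: js; rewrite (perm_mem (perm_to_rem si)) inE (negbTE ji) //.
  move=> h; apply: (le_trans (ler_distD (phi t) _ _)); rewrite addrC; apply: lerD; last exact: ltW.
  by apply: (le_trans h); rewrite ler_wpM2l// lerD2l lerN2 ltW.
apply: (le_trans (ler_distD (phi c) _ _)); apply: (le_trans (lerD h1 h2)).
by rewrite -mulrDr addrC addrA subrK.
Qed.

End LipschitzCover.

Section Translate.
Context {R : realType} {n : nat}.

Lemma measurable_translate (b : 'rV[R]_n) : measurable_fun [set: 'rV[R]_n] (fun x => b + x).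
Proof. by have := measurable_affine 1%:M b; under eq_fun do rewrite mulmx1. Qed.

Lemma Rintegral_leb_translate (b : 'rV[R]_n) (f : 'rV[R]_n -> R) :
  measurable_fun [set: 'rV[R]_n] (f : _ -> measurableTypeR R) ->
  \int[leb n]_x f x = \int[leb n]_x f (b + x).
Proof.
move=> mf; rewrite /Rintegral; congr fine; rewrite integralE [RHS]integralE.
have mf' : measurable_fun [set: 'rV[R]_n] (EFin \o f) by exact/measurable_EFinP.
congr (_ - _)%E.
  rewrite (integral_leb_translate b)//; last exact: measurable_funepos.
  by apply: eq_integral => x _; rewrite !funeposE.
rewrite (integral_leb_translate b)//; last exact: measurable_funeneg.
by apply: eq_integral => x _; rewrite !funenegE.
Qed.

Lemma compact_support_integrable (f : 'rV[R]_n -> R) (M r : R) : 0 < r ->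
  measurable_fun [set: 'rV[R]_n] (f : _ -> measurableTypeR R) ->
  (forall x, `|f x| <= M) -> (forall x, r <= `|x| -> f x = 0) ->
  (leb n).-integrable setT (EFin \o f).
Proof.
move=> r0 mf fM fr.
have mC := measurable_cube (0 : 'rV[R]_n) r.
have iC : (leb n).-integrable (cube 0 r) (EFin \o (fun=> M)).
  apply: (@bounded_integrable _ _ _ _ `|M|) => //.
  by rewrite leb_cube// ltry.
move/(integrable_mkcond _ mC) : iC => iC.
apply: (le_integrable measurableT _ _ iC); first exact/measurable_EFinP.
move=> x _; rewrite /= patchE; case: ifPn => [_|].
  by rewrite /= lee_fin (le_trans (fM x))// ler_norm.
rewrite notin_setE cube_ball// -ball_normE /= sub0r normrN => /negP; rewrite -leNgt => /fr ->.
by rewrite normr0.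
Qed.

End Translate.

Section Korn.
Context {R : realType} {n N : nat}.
Variables (Om : set 'rV[R]_n.+1) (T : 'I_N -> 'I_n.+2 -> 'rV[R]_n.+1).
Hypothesis hOm : bounded_lipschitz_domain Om.
Hypothesis hT : triangulation Om T.
Local Notation e_ i := (delta_mx 0 i : 'rV[R]_n.+1).

(** The zero boundary values glue the continuous function on [closure Om] to its extension by
    zero. *)
Lemma lagrange0_continuous k w : Defs.lagrange Om T k w -> (forall x, bdry Om x -> w x = 0) ->
  continuous w.
Proof.
move=> [/subspace_continuousP cw w0 _] wb x; have [_ oOm _ _ _] := hOm.
have [cx|ncx] := pselect (closure Om x); last first.
  have : nbhs x (~` closure Om) by apply: open_nbhs_nbhs; split => //; exact/closed_openC/closed_closure.
  move=> nx A; rewrite (w0 _ ncx) => /nbhs_singleton A0.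
  by apply: filterS nx => y /w0; rewrite /= => ->.
move=> A Aw; have hA : \forall y \near x, closure Om y -> A (w y) := cw x cx A Aw.
have [Ox|nOx] := pselect (Om x).
  have : nbhs x Om by exact: open_nbhs_nbhs.
  by move/(filterI hA); apply: filterS => y [h Oy]; apply: h; exact: subset_closure.
have bx : bdry Om x by split=> // /interior_subset.
apply: filterS hA => y hy; have [cy|ncy] := pselect (closure Om y); first exact: hy.
rewrite /= (w0 _ ncy) -(wb _ bx); exact: nbhs_singleton.
Qed.

Lemma lagrange_bounded k w : Defs.lagrange Om T k w -> exists2 M : R, 0 <= M & forall x, `|w x| <= M.
Proof.
move=> hw; have [M M0 hM] := bounded_mesh T.
have /choice[L hL] : forall e, exists L : R, 0 <= L /\ forall x, simplex (T e) x -> `|w x| <= L.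
  move=> e; have [P [hP wP _]] := lagrange_pieces e hw.
  have [L L0 [lL _]] := mpol_lipschitz M hP; exists L; split=> // x hx.
  by rewrite wP//; apply: lL; exact: hM hx.
exists (\sum_e L e); first by apply: sumr_ge0 => e _; exact: (hL e).1.
move=> x; have [cx|ncx] := pselect (closure Om x).
  move: cx; have [_ _ _ <-] := hT; move=> [e _ hx]; apply: (le_trans ((hL e).2 x hx)).
  by rewrite (bigD1 e)//= lerDl sumr_ge0// => j _; exact: (hL j).1.
have [_ w0 _] := hw; rewrite w0// normr0; apply: sumr_ge0 => e _; exact: (hL e).1.
Qed.

(** A segment is covered by the closed elements together with the zero set of [w], indexed by
    [None], since it may leave the domain, which need not be convex. On each piece [w] is Lipschitz
    along the segment, and [closed_cover_lipschitz] joins the pieces. *)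
Lemma lagrange0_lipschitz k w : Defs.lagrange Om T k w -> (forall x, bdry Om x -> w x = 0) ->
  exists2 L : R, 0 <= L & forall x i t, `|w (x + t *: e_ i) - w x| <= L * `|t|.
Proof.
move=> hw wb; have cw := lagrange0_continuous hw wb.
have nd e : Defs.nondegenerate (T e) by case: hT.
have [M M0 hM] := bounded_mesh T.
have /choice[L hL] : forall e, exists L : R, 0 <= L /\ forall x y, simplex (T e) x -> simplex (T e) y -> `|w x - w y| <= L * `|x - y|.
  move=> e; have [P [hP wP _]] := lagrange_pieces e hw.
  have [L L0 [_ lL]] := mpol_lipschitz M hP; exists L; split=> // x y hx hy.
  by rewrite !wP//; apply: lL; [exact: hM hx|exact: hM hy].
have sL e : L e <= \sum_e L e by rewrite (bigD1 e)//= lerDl sumr_ge0// => j _; exact: (hL j).1.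
exists (\sum_e L e); first by apply: sumr_ge0 => e _; exact: (hL e).1.
have pos x i (t : R) : 0 <= t -> `|w (x + t *: e_ i) - w x| <= (\sum_e L e) * t.
  move=> t0; pose l (s : R) := x + s *: e_ i.
  have cl : continuous l.
    by move=> s; apply: cvgD; [exact: cvg_cst|apply: cvgZr_tmp; exact: cvg_id].
  pose S (o : option 'I_N) : set R := if o is Some e then l @^-1` simplex (T e) else [set s | w (l s) = 0].
  have E0 : w x = w (l 0) by rewrite /l scale0r addr0.
  rewrite distrC E0 (_ : _ * t = (\sum_e L e) * (t - 0)); last by rewrite subr0.
  apply: (@closed_cover_lipschitz R (option 'I_N) S (w \o l) _ (enum {: option 'I_N}) 0 t) => //.
  - by apply: sumr_ge0 => e _; exact: (hL e).1.
  - by move=> s; apply: continuous_comp; [exact: cl|exact: cw].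
  - move=> [e|] /=.
      by apply: preimage_closed; [move=> s _; exact: cl|exact: (closed_simplex (nd e))].
    apply: (@preimage_closed _ _ (w \o l) [set 0]); last exact: closed_eq.
    by move=> s _; apply: continuous_comp; [exact: cl|exact: cw].
  - move=> [e|] u v /=; last by move=> -> ->; rewrite subrr normr0 mulr_ge0// sumr_ge0// => e _; exact: (hL e).1.
    move=> hu hv; apply: (le_trans ((hL e).2 _ _ hu hv)); apply: ler_pM => //; first exact: (hL e).1.
    rewrite /l opprD addrACA subrr add0r -scalerBl normrZ -[leRHS]mulr1 ler_wpM2l//.
    exact: norm_delta_le1.
  - move=> s _; have [cs|ncs] := pselect (closure Om (l s)).
      have [_ _ _ hc] := hT; move: cs; rewrite -hc => -[e _ hs].
      by exists (Some e); rewrite ?mem_enum.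
    by exists None; rewrite ?mem_enum//; have [_ w0 _] := hw; exact: w0.
move=> x i t; have [t0|t0] := leP 0 t; first by rewrite [`|t|]ger0_norm// pos.
rewrite distrC [`|t|]ltr0_norm//; have := pos (x + t *: e_ i) i (- t).
by rewrite scaleNr addrK; apply; rewrite oppr_ge0 ltW.
Qed.

(* Second derivatives do not exist across element faces, so mixed derivatives are
   exchanged on difference quotients, by translation invariance. *)
Definition diffq (i : 'I_n.+1) (s : R) (w : 'rV[R]_n.+1 -> R) x : R := s^-1 * (w (s *: e_ i + x) - w x).

Lemma diffq_cvg w x i (u : R^nat) : derivable w x (e_ i) -> u @ \oo --> 0 -> (forall k, u k != 0) ->
  diffq i (u k) w x @[k --> \oo] --> pderive i w x.
Proof.
move=> dw u0 un A hA; have := dw A hA; rewrite /= nbhs_simpl /= => /u0.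
rewrite /= nbhs_simpl /within /=; apply: filterS => k; exact.
Qed.

(** Both sides expand into integrals [A a b] of [w (a + x) * z (b + x)], which depend on [b - a]
    only. Translation by minus both steps exchanges the directions and reverses the sign of the
    step. *)
Lemma diffq_integral w z (s : R) i j (M r : R) : 0 < r -> s != 0 ->
  measurable_fun [set: 'rV[R]_n.+1] (w : _ -> measurableTypeR R) ->
  measurable_fun [set: 'rV[R]_n.+1] (z : _ -> measurableTypeR R) ->
  (forall x, `|w x| <= M) -> (forall x, `|z x| <= M) ->
  (forall x, r <= `|x| -> w x = 0) ->
  \int[leb n.+1]_x (diffq i s w x * diffq j s z x) =
  \int[leb n.+1]_x (diffq j (- s) w x * diffq i (- s) z x).
Proof.
move=> r0 s0 mw mz wM zM wr.
have mT (f : 'rV[R]_n.+1 -> R) a : measurable_fun [set: 'rV[R]_n.+1] (f : _ -> measurableTypeR R) ->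
    measurable_fun [set: 'rV[R]_n.+1] (fun x => f (a + x)).
  move=> mf; exact: (measurableT_comp mf (measurable_translate a)).
pose A a b := \int[leb n.+1]_x (w (a + x) * z (b + x)).
have mA a b : measurable_fun [set: 'rV[R]_n.+1] (fun x => w (a + x) * z (b + x) : measurableTypeR R).
  by apply: measurable_funM; exact: mT.
have iA a b : (leb n.+1).-integrable setT (EFin \o (fun x => w (a + x) * z (b + x))).
  apply: (@compact_support_integrable _ _ _ (M * M) (r + `|a|)) => //; first by rewrite ltr_pwDl.
    by move=> x; rewrite normrM ler_pM.
  move=> x hx; rewrite wr ?mul0r//.
  have := ler_normB (a + x) a; rewrite [a + x - a]addrC addKr; lra.
have shift a b c : A a b = A (a + c) (b + c).
  rewrite /A (Rintegral_leb_translate c (mA a b)); apply: eq_Rintegral => x _.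
  by rewrite !addrA.
have expand (a b : 'rV[R]_n.+1) (c : R) :
   \int[leb n.+1]_x ((c * (w (a + x) - w x)) * (c * (z (b + x) - z x))) =
   c ^+ 2 * (A a b - A a 0 - (A 0 b - A 0 0)).
  rewrite /A -!RintegralB//; last 2 first.
  - by apply: integrable_EFinB => //; exact: iA.
  - by apply: integrable_EFinB => //; exact: iA.
  rewrite -RintegralZl//; last by do !apply: integrable_EFinB => //; exact: iA.
  by apply: eq_Rintegral => x _; rewrite !add0r; ring.
rewrite /diffq !expand invrN sqrrN; congr (_ * _).
have -> : A (s *: e_ i) (s *: e_ j) = A (- s *: e_ j) (- s *: e_ i).
  rewrite (shift (- s *: e_ j) _ (s *: e_ i + s *: e_ j)); congr A; rewrite scaleNr.
    by rewrite addrCA addNr addr0.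
  by rewrite addKr.
have -> : A (s *: e_ i) 0 = A 0 (- s *: e_ i).
  by rewrite (shift 0 _ (s *: e_ i)) add0r scaleNr addNr.
have -> : A 0 (s *: e_ j) = A (- s *: e_ j) 0.
  by rewrite (shift (- s *: e_ j) _ (s *: e_ j)) add0r scaleNr addNr.
by ring.
Qed.

(** Dominated convergence: the quotients are bounded by Lipschitz constants and vanish outside a
    fixed cube, and they converge to the derivatives off the skeleton, trivially so outside
    [closure Om]. *)
Lemma diffq_integral_cvg k w z i j (u : R^nat) :
  Defs.lagrange Om T k w -> (forall x, bdry Om x -> w x = 0) ->
  Defs.lagrange Om T k z -> (forall x, bdry Om x -> z x = 0) ->
  u @ \oo --> 0 -> (forall m, u m != 0) -> (forall m, `|u m| <= 1) ->
  \int[leb n.+1]_x (diffq i (u m) w x * diffq j (u m) z x) @[m --> \oo] -->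
  \int[leb n.+1]_x ((fun y => pderive i w y * pderive j z y) \_ (mesh_open T)) x.
Proof.
move=> hw wb hz zb u0 un u1.
have [M M0 hM] := bounded_mesh T.
have clM x : closure Om x -> `|x| <= M.
  by have [_ _ _ <-] := hT; move=> [e _]; exact: hM.
have [L1 L10 hL1] := lagrange0_lipschitz hw wb.
have [L2 L20 hL2] := lagrange0_lipschitz hz zb.
have mw : measurable_fun [set: 'rV[R]_n.+1] (w : _ -> measurableTypeR R).
  by apply: measurable_continuous_rV; exact: lagrange0_continuous hw wb.
have mz : measurable_fun [set: 'rV[R]_n.+1] (z : _ -> measurableTypeR R).
  by apply: measurable_continuous_rV; exact: lagrange0_continuous hz zb.
have md v (s : R) l : measurable_fun [set: 'rV[R]_n.+1] (v : _ -> measurableTypeR R) ->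
    measurable_fun [set: 'rV[R]_n.+1] (diffq l s v : _ -> measurableTypeR R).
  move=> mv; apply: measurable_funM => //; apply: measurable_funB => //.
  exact: (measurableT_comp mv (measurable_translate _)).
have bd v (s L : R) l x : s != 0 -> (forall x i t, `|v (x + t *: e_ i) - v x| <= L * `|t|) ->
    `|diffq l s v x| <= L.
  move=> s0 hv; rewrite /diffq normrM normfV mulrC ler_pdivrMr ?normr_gt0//.
  by rewrite [_ + x]addrC hv.
have mO := measurable_mesh_open T.
pose f_ m x := (diffq i (u m) w x * diffq j (u m) z x)%:E.
pose f x := (((fun y => pderive i w y * pderive j z y) \_ (mesh_open T)) x)%:E.
(* The domain lies within [M] of the origin and the steps have length at most 1, so outside this
   cube both points entering the quotient of [w] are off the domain. *)
pose C := cube (0 : 'rV[R]_n.+1) (M + 2).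
pose g := (EFin \o (fun=> L1 * L2)) \_ C.
have mC : measurable C by exact: measurable_cube.
have M2 : 0 < M + 2 by rewrite ltr_wpDl.
have dc := @dominated_convergence _ _ R (leb n.+1) setT measurableT f_ f g.
have mf_ m : measurable_fun setT (f_ m).
  by apply/measurable_EFinP; apply: measurable_funM; exact: md.
have mf : measurable_fun setT f.
  apply/measurable_EFinP; apply/(measurable_restrictT _ mO).
  by apply: measurable_funM; apply: measurable_pwpol; [exact: pderive_pwpol hw|exact: pderive_pwpol hz].
have ig : (leb n.+1).-integrable setT g.
  apply/(integrable_mkcond _ mC); apply: (@bounded_integrable _ _ _ _ (L1 * L2)) => //.
    by rewrite leb_cube// ltry.
  by move=> x _; rewrite ger0_norm// mulr_ge0.
have cv : {ae leb n.+1, forall x, setT x -> f_ x0 x @[x0 --> \oo] --> f x}.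
  exists (mesh_skeleton T); split; [exact: (measurable_mesh_skeleton hT)|exact: (leb_mesh_skeleton hT)|].
  move=> x; apply: contra_notP => nsx _; apply: cvg_EFin; first exact: nearW.
  rewrite /f patchE; case: ifPn => [|].
    rewrite inE => -[e _ hx].
    have [P1 [_ _ dw]] := lagrange_pieces e hw; have [P2 [_ _ dz]] := lagrange_pieces e hz.
    by apply: cvgM; apply: diffq_cvg => //; [exact: (dw x hx i).1|exact: (dz x hx j).1].
  rewrite notin_setE => nOx.
  have ncx : ~ closure Om x by move=> /(closure_mesh hT)[].
  have nx : nbhs x (~` closure Om) by apply: open_nbhs_nbhs; split => //; exact/closed_openC/closed_closure.
  have dv v l : Defs.lagrange Om T k v -> derivable v x (e_ l) /\ pderive l v x = 0.
    move=> [_ v0 _]; have v0' : \forall y \near x, cst 0 y = v y by apply: filterS nx => y /v0 ->.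
    split; first by apply: (near_eq_derivable v0'); exact: derivable_cst.
    by rewrite /pderive -(near_eq_derive _ v0') derive_cst.
  have [dw pw] := dv w i hw; have [dz pz] := dv z j hz.
  rewrite -[X in _ --> X](mul0r (0 : R)) -{1}pw -pz.
  by apply: cvgM; exact: diffq_cvg.
have dom : {ae leb n.+1, forall x m, setT x -> (`|f_ m x| <= g x)%E}.
  apply: aeW => x m _; rewrite /g patchE; case: ifPn => [_|].
    by rewrite /f_ /= lee_fin normrM; apply: ler_pM => //; exact: bd.
  rewrite notin_setE /C cube_ball// -ball_normE /= sub0r normrN => /negP; rewrite -leNgt => hx.
  rewrite /f_ /diffq; have [_ w0 _] := hw.
  have nx : ~ closure Om x by move=> /clM; lra.
  have nux : ~ closure Om (u m *: e_ i + x).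
    move=> /clM h; have := ler_normB (u m *: e_ i + x) (u m *: e_ i).
    rewrite addrC addKr normrZ => h'.
    have : `|u m| * `|e_ i| <= 1 * 1 by apply: ler_pM => //; exact: norm_delta_le1.
    lra.
  by rewrite !w0// subrr mulr0 mul0r normr0.
have [intf _ cvi] := dc mf_ mf cv ig dom.
have fin := integrable_fin_num measurableT intf.
by rewrite /Rintegral; apply: fine_cvg; rewrite fineK.
Qed.

(** The discrete identity is passed to the limit along steps [1/(m+1)] on one side and their
    opposites on the other; both converge to partial derivatives, so the change of sign
    disappears. *)
Lemma mixed_derivatives_integral k w z i j (B : set 'rV[R]_n.+1) :
  Defs.lagrange Om T k w -> (forall x, bdry Om x -> w x = 0) ->
  Defs.lagrange Om T k z -> (forall x, bdry Om x -> z x = 0) ->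
  measurable B -> leb n.+1 B = 0%E ->
  \int[leb n.+1]_(x in mesh_open T `\` B) (pderive i w x * pderive j z x) =
  \int[leb n.+1]_(x in mesh_open T `\` B) (pderive j w x * pderive i z x).
Proof.
move=> hw wb hz zb mB B0.
have red l m : \int[leb n.+1]_(x in mesh_open T `\` B) (pderive l w x * pderive m z x) =
    \int[leb n.+1]_x ((fun y => pderive l w y * pderive m z y) \_ (mesh_open T)) x.
  rewrite /Rintegral -(integral_null_set _ _ mB B0) integral_mkcond; congr fine.
  by apply: eq_integral => x _; rewrite !patchE; case: ifP.
pose u (m : nat) : R := m.+1%:R^-1.
have u0 : u @ \oo --> 0 by exact: cvg_harmonic.
have un m : u m != 0 by rewrite invr_eq0 pnatr_eq0.
have u1 m : `|u m| <= 1 by rewrite ger0_norm ?invr_ge0// invf_le1 ?ler1n.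
have c1 := diffq_integral_cvg (i := i) (j := j) hw wb hz zb u0 un u1.
have c2 : \int[leb n.+1]_x (diffq j (- u m) w x * diffq i (- u m) z x) @[m --> \oo] -->
  \int[leb n.+1]_x ((fun y => pderive j w y * pderive i z y) \_ (mesh_open T)) x.
  have nu0 : (fun m => - u m) @ \oo --> 0 by rewrite -oppr0; exact: cvgN.
  have nun m : - u m != 0 by rewrite oppr_eq0.
  have nu1 m : `|- u m| <= 1 by rewrite normrN.
  exact: (diffq_integral_cvg (i := j) (j := i) hw wb hz zb nu0 nun nu1).
have E m : \int[leb n.+1]_x (diffq i (u m) w x * diffq j (u m) z x) =
    \int[leb n.+1]_x (diffq j (- u m) w x * diffq i (- u m) z x).
  have [M M0 hM] := bounded_mesh T.
  have [M1 M10 hM1] := lagrange_bounded hw; have [M2 M20 hM2] := lagrange_bounded hz.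
  apply: (@diffq_integral _ _ _ _ _ (M1 + M2) (M + 1)) => //.
  - by rewrite ltr_wpDl.
  - by apply: measurable_continuous_rV; exact: lagrange0_continuous hw wb.
  - by apply: measurable_continuous_rV; exact: lagrange0_continuous hz zb.
  - by move=> x; apply: (le_trans (hM1 x)); rewrite lerDl.
  - by move=> x; apply: (le_trans (hM2 x)); rewrite lerDr.
  - move=> x hx; have [_ w0 _] := hw; apply: w0 => cx.
    have : `|x| <= M by move: cx; have [_ _ _ <-] := hT; move=> [e _]; exact: hM.
    lra.
rewrite !red; apply: (cvg_unique _ c1); first exact: Rhausdorff.
by move: c2; under eq_fun do rewrite -E.
Qed.

End Korn.

(** * Pointwise estimates *)

Section EssentialBounds.
Context {R : realType} {n : nat}.
Variable Om : set 'rV[R]_n.+1.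

Lemma Linfty_norm_ae (g : 'rV[R]_n.+1 -> R) : open Om -> Om !=set0 -> (Linfty_norm Om g < +oo)%E ->
  {ae leb n.+1, forall x, Om x -> `|g x| <= fine (Linfty_norm Om g)}.
Proof.
move=> oO O0 gfin.
(* Positive total mass selects the essential supremum in the definition of [Lnorm]. *)
have mpos : (0 < leb n.+1 [set: 'rV[R]_n.+1])%E by apply: leb_open_gt0; [exact: openT|exists 0].
have Lfin : Linfty_norm Om g \is a fin_num by rewrite ge0_fin_numE// Lnorm_ge0.
have E : Linfty_norm Om g = ess_sup (leb n.+1) (abse \o (EFin \o (g \_ Om))).
  by rewrite /Linfty_norm unlock mpos.
have := ess_sup_ge (leb n.+1) (abse \o (EFin \o (g \_ Om))).
rewrite -E; apply: filterS => x /= h Ox.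
by move: h; rewrite patchE mem_set//= -{1}(fineK Lfin) lee_fin.
Qed.

(** A violation at a point of the closure would persist, by continuity, on a nonempty open part of
    [Om], which has positive measure. In this way the boundary trace of the viscosity inherits the
    bounds valid almost everywhere. *)
Lemma ae_closure_bounds (w : 'rV[R]_n.+1 -> R) (a b : R) : open Om ->
  {within closure Om, continuous w} ->
  {ae leb n.+1, forall x, Om x -> a <= w x <= b} ->
  forall x, closure Om x -> a <= w x <= b.
Proof.
move=> oO /subspace_continuousP cw [N [mN N0 hN]] x cx; apply/negPn/negP => wx.
have oG : open [set t : R | ~~ (a <= t <= b)].
  rewrite (_ : [set t | _] = [set t | t < a] `|` [set t | t > b]).
    by apply: openU; [exact: open_lt|exact: open_gt].
  apply/seteqP; split => t /=; rewrite negb_and -!ltNge; first by move=> /orP.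
  by move=> /orP.
have := cw x cx [set t | ~~ (a <= t <= b)] (open_nbhs_nbhs (conj oG wx)).
rewrite /= nbhs_simpl /within /= nbhsE => -[U [oU Ux] UG].
have [z [Oz Uz]] := cx U (open_nbhs_nbhs (conj oU Ux)).
have oUO : open (U `&` Om) by exact: openI.
have UO0 : U `&` Om !=set0 by exists z.
have := leb_open_gt0 oUO UO0; suff : (leb n.+1 (U `&` Om) <= 0)%E by move=> /le_lt_trans h /h; rewrite ltxx.
rewrite -N0; apply: le_measure; rewrite ?inE//; first exact: measurable_open_rV.
move=> y [Uy Oy]; apply: hN => /(_ Oy) wy.
by have := UG y Uy (subset_closure Oy); rewrite /= wy.
Qed.

End EssentialBounds.

Section MatrixContinuity.
Context {R : realType} {p q : nat} {X : topologicalType}.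

Lemma mx_continuous_at (F : X -> 'M[R]_(p.+1, q.+1)) x :
  (forall i j, {for x, continuous (fun y => F y i j)}) -> {for x, continuous F}.
Proof.
move=> cF U /nbhs_ballP[e /= e0 eU].
suff : \forall y \near x, forall ij : 'I_p.+1 * 'I_q.+1, `|F x ij.1 ij.2 - F y ij.1 ij.2| < e.
  by apply: filterS => y hy; apply: eU; split=> // i j; exact: (hy (i, j)).
apply: (@filter_forall _ _ (fun (ij : 'I_p.+1 * 'I_q.+1) y => `|F x ij.1 ij.2 - F y ij.1 ij.2| < e) (nbhs x) _) => -[i j].
have := cF i j; move/cvgr_dist_lt => /(_ _ e0); exact.
Qed.

End MatrixContinuity.

Section PointwiseAlgebra.
Context {R : realType} {n : nat}.
Implicit Types (u v a : 'rV[R]_n.+1) (G H S : 'M[R]_n.+1).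

Definition symm G := 2^-1 *: (G + G^T).

Lemma frob_ge0 G : 0 <= frob G G.
Proof. by apply: sumr_ge0 => i _; apply: sumr_ge0 => j _; rewrite -expr2 sqr_ge0. Qed.

Lemma sqr_entry_le_frob G i j : G i j ^+ 2 <= frob G G.
Proof.
rewrite /frob (bigD1 i)//= (bigD1 j)//= -expr2 -addrA lerDl.
apply: addr_ge0; first by apply: sumr_ge0 => k _; rewrite -expr2 sqr_ge0.
by apply: sumr_ge0 => k _; apply: sumr_ge0 => m _; rewrite -expr2 sqr_ge0.
Qed.

Lemma frob_symm G : 2 * frob (symm G) (symm G) = frob G G + \sum_i \sum_j G i j * G j i.
Proof.
have E (f g : 'I_n.+1 -> 'I_n.+1 -> R) : \sum_i \sum_j (f i j + g i j) = \sum_i \sum_j f i j + \sum_i \sum_j g i j.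
  by rewrite -big_split; apply: eq_bigr => i _; rewrite -big_split.
have ET : \sum_i \sum_j G j i * G j i = frob G G by rewrite exchange_big.
have -> : 2 * frob (symm G) (symm G) = 2^-1 * (frob G G + \sum_i \sum_j G j i * G j i + 2 * \sum_i \sum_j G i j * G j i).
  have -> : 2 * \sum_i \sum_j G i j * G j i = \sum_i \sum_j 2 * (G i j * G j i).
    by rewrite mulr_sumr; apply: eq_bigr => i _; rewrite mulr_sumr.
  rewrite {2}/frob -!E mulr_sumr [RHS]mulr_sumr; apply: eq_bigr => i _.
  rewrite mulr_sumr [RHS]mulr_sumr; apply: eq_bigr => j _.
  by rewrite /symm !mxE; field.
by rewrite ET; field.
Qed.

(** Young's inequality by completing the square. The weight 1/4 is a quarter of the pressure term:
    this cross term, the one of [dot_Young] and the boundary term take a quarter each. *)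
Lemma dot_mulmx_frob a u G : 2 * dot a (u *m G) <= 4^-1 * dot a a + 4 * (dot u u * frob G G).
Proof.
have cs j : (u *m G) 0 j ^+ 2 <= dot u u * \sum_i G i j * G i j.
  have := dot_Cauchy_Schwarz u (\row_i G i j).
  have -> : dot u (\row_i G i j) = (u *m G) 0 j by rewrite mxE; apply: eq_bigr => i _; rewrite mxE.
  suff -> : dot (\row_i G i j) (\row_i G i j) = \sum_i G i j * G i j by [].
  by apply: eq_bigr => i _; rewrite !mxE.
have h : dot (u *m G) (u *m G) <= dot u u * frob G G.
  rewrite /frob exchange_big mulr_sumr; apply: ler_sum => j _; rewrite -expr2; exact: cs.
apply: (@le_trans _ _ (4^-1 * dot a a + 4 * dot (u *m G) (u *m G))); last first.
  by rewrite lerD2l ler_pM2l.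
rewrite -subr_ge0 (_ : _ - _ = \sum_i (2^-1 * a 0 i - 2 * (u *m G) 0 i) ^+ 2).
  by apply: sumr_ge0 => i _; exact: sqr_ge0.
rewrite /dot !mulr_sumr -big_split/= -sumrB; by apply: eq_bigr => i _; field.
Qed.

Lemma dot_Young a u (s : R) : - (4^-1 * dot a a) - s ^+ 2 * dot u u <= s * dot a u.
Proof.
rewrite -subr_ge0 (_ : _ - _ = \sum_i (2^-1 * a 0 i + s * u 0 i) ^+ 2).
  by apply: sumr_ge0 => i _; exact: sqr_ge0.
rewrite /dot !mulr_sumr -sumrN -sumrB -sumrB; by apply: eq_bigr => i _; field.
Qed.

(** In each component both factors are differences of two terms, with squares at most 4 times the
    full square. Young's inequality with weight [eta] then gives the factor 2, and the at most three
    components give 6. *)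
Lemma vprod_curl_bound a v G (nu numax eta : R) : 0 <= nu <= numax -> 0 < eta ->
  (forall i, `|v 0 i| <= 1) ->
  `|dot (vprod a v) (nu *: curl_of G)| <= 6 * eta * dot a a + 6 * numax ^+ 2 / eta * frob G G.
Proof.
move=> /andP[nu0 nuM] eta0 hv.
have term (i : 'I_(@cdim n)) : `|vprod a v 0 i * (nu *: curl_of G) 0 i| <= 2 * eta * dot a a + 2 * numax ^+ 2 / eta * frob G G.
  rewrite !mxE; set a1 := a 0 _; set a2 := a 0 _; set g1 := G _ _; set g2 := G _ _.
  have ha1 : a1 ^+ 2 <= dot a a by exact: sqr_coord_le_dot.
  have ha2 : a2 ^+ 2 <= dot a a by exact: sqr_coord_le_dot.
  have hg1 : g1 ^+ 2 <= frob G G by exact: sqr_entry_le_frob.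
  have hg2 : g2 ^+ 2 <= frob G G by exact: sqr_entry_le_frob.
  set v1 := v 0 _; set v2 := v 0 _.
  have hp : (a1 * v1 - a2 * v2) ^+ 2 <= 4 * dot a a.
    have h1 : v1 ^+ 2 <= 1 by rewrite -(real_normK (num_real v1)) expr_le1 ?hv.
    have h2 : v2 ^+ 2 <= 1 by rewrite -(real_normK (num_real v2)) expr_le1 ?hv.
    have k1 : (a1 * v1) ^+ 2 <= dot a a.
      by rewrite exprMn -[leRHS]mulr1 ler_pM ?sqr_ge0.
    have k2 : (a2 * v2) ^+ 2 <= dot a a.
      by rewrite exprMn -[leRHS]mulr1 ler_pM ?sqr_ge0.
    have := sqr_ge0 (a1 * v1 + a2 * v2); rewrite -[in X in X -> _]subr_ge0 subr0.
    move: k1 k2; generalize (a1 * v1) (a2 * v2) => x y; nra.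
  have hq : (nu * (g1 - g2)) ^+ 2 <= 4 * numax ^+ 2 * frob G G.
    rewrite exprMn.
    have k1 : nu ^+ 2 <= numax ^+ 2 by rewrite lerXn2r ?nnegrE// (le_trans nu0).
    have k2 : (g1 - g2) ^+ 2 <= 4 * frob G G by have := sqr_ge0 (g1 + g2); nra.
    rewrite [leRHS](_ : _ = numax ^+ 2 * (4 * frob G G)); last by ring.
    by apply: ler_pM => //; exact: sqr_ge0.
  move: hp hq; generalize (a1 * v1 - a2 * v2) (nu * (g1 - g2)) => x y hx hy.
  have am : `|x * y| <= eta / 2 * x ^+ 2 + (2 * eta)^-1 * y ^+ 2.
    have E : eta / 2 * x ^+ 2 + (2 * eta)^-1 * y ^+ 2 = (2 * eta)^-1 * ((eta * x) ^+ 2 + y ^+ 2).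
      by field; rewrite gt_eqF.
    rewrite E [leRHS]mulrC ler_pdivlMr ?mulr_gt0//.
    have e2 : 0 < 2 * eta by rewrite mulr_gt0.
    rewrite -[X in _ * X](gtr0_norm e2) -normrM ler_norml; apply/andP; split.
      have := sqr_ge0 (eta * x + y); lra.
    have := sqr_ge0 (eta * x - y); lra.
  apply: (le_trans am).
  have k1 : eta / 2 * x ^+ 2 <= eta / 2 * (4 * dot a a) by rewrite ler_pM2l// divr_gt0.
  have k2 : (2 * eta)^-1 * y ^+ 2 <= (2 * eta)^-1 * (4 * numax ^+ 2 * frob G G).
    by rewrite ler_pM2l// invr_gt0 mulr_gt0.
  apply: (le_trans (lerD k1 k2)).
  rewrite [eta / 2 * _](_ : _ = 2 * eta * dot a a); last by field.
  rewrite lerD2l [leLHS](_ : _ = 2 * numax ^+ 2 / eta * frob G G)//; field; by rewrite gt_eqF.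
apply: (le_trans (ler_norm_sum _ _ _)).
apply: (@le_trans _ _ (\sum_(i < @cdim n) (2 * eta * dot a a + 2 * numax ^+ 2 / eta * frob G G))).
  by apply: ler_sum => i _; exact: term.
rewrite sumr_const card_ord -[leLHS]mulr_natr.
have p0 : 0 <= 2 * eta * dot a a + 2 * numax ^+ 2 / eta * frob G G.
  have p1 : 0 <= 2 * eta by rewrite mulr_ge0// ltW.
  have p2 : 0 <= 2 * numax ^+ 2 by apply: mulr_ge0 => //; exact: sqr_ge0.
  apply: addr_ge0; first exact: mulr_ge0 p1 (dot_ge0 a).
  exact: mulr_ge0 (divr_ge0 p2 (ltW eta0)) (frob_ge0 G).
rewrite [leRHS](_ : _ = (2 * eta * dot a a + 2 * numax ^+ 2 / eta * frob G G) * 3); last by ring.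
by rewrite ler_wpM2l// ler_nat /cdim; case: ifP.
Qed.

(** Both outcomes of [xget] qualify: a unit vector, or the default value 0. *)
Lemma facet_normal_coord (b : 'I_n.+2 -> 'rV[R]_n.+1) i j : `|facet_normal b i 0 j| <= 1.
Proof.
rewrite /facet_normal; case: xgetP => [w _ [w1 _ _]|_]; last by rewrite mxE normr0.
by rewrite -w1; exact: coord_le_enorm.
Qed.

End PointwiseAlgebra.

Lemma pwpol_sum (R : realType) n N (T : 'I_N -> 'I_n.+2 -> 'rV[R]_n.+1) I (s : seq I)
  (F : I -> 'rV[R]_n.+1 -> R) : (forall i, pwpol T (F i)) -> pwpol T (fun x => \sum_(i <- s) F i x).
Proof.
move=> hF; elim: s => [|i s IH].
  by under eq_fun do rewrite big_nil; exact: pwpol_cst.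
by under eq_fun do rewrite big_cons; exact: pwpolD.
Qed.

(** * The boundary term *)

Section LinearRintegral.
Context d (X : measurableType d) (R : realType) (mu : {measure set X -> \bar R}) (D : set X).
Hypothesis mD : measurable D.

Lemma Rintegral_lin (a : R) (f g : X -> R) : mu.-integrable D (EFin \o f) -> mu.-integrable D (EFin \o g) ->
  \int[mu]_(x in D) (a * f x + g x) = a * \int[mu]_(x in D) f x + \int[mu]_(x in D) g x.
Proof.
move=> hf hg; rewrite RintegralD//; first by rewrite RintegralZl.
exact: integrable_EFinZ.
Qed.

Lemma Rintegral_sumZ I (s c : R) (r : seq I) (F : I -> X -> R) : (forall i, mu.-integrable D (EFin \o F i)) ->
  \sum_(i <- r) c * (s * \int[mu]_(x in D) F i x) = s * \int[mu]_(x in D) (\sum_(i <- r) c * F i x).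
Proof.
move=> hF; rewrite Rintegral_sum//; last by move=> i; exact: integrable_EFinZ.
rewrite mulr_sumr; apply: eq_bigr => i _.
by rewrite RintegralZl// mulrCA.
Qed.

Lemma Rintegral_sum2Z I J (s c : R) (r : seq I) (r' : seq J) (F : I -> J -> X -> R) :
  (forall i j, mu.-integrable D (EFin \o F i j)) ->
  \sum_(i <- r) \sum_(j <- r') c * (s * \int[mu]_(x in D) F i j x) =
  s * \int[mu]_(x in D) (\sum_(i <- r) \sum_(j <- r') c * F i j x).
Proof.
move=> hF; rewrite Rintegral_sum//; last first.
  by move=> i; apply: integrable_EFin_sum => // j; exact: integrable_EFinZ.
by rewrite mulr_sumr; apply: eq_bigr => i _; exact: Rintegral_sumZ.
Qed.

End LinearRintegral.

Section Boundary.
Context {R : realType} {n N : nat}.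
Variables (Om : set 'rV[R]_n.+1) (T : 'I_N -> 'I_n.+2 -> 'rV[R]_n.+1).
Hypothesis hOm : bounded_lipschitz_domain Om.
Hypothesis hT : triangulation Om T.

Let nd e : Defs.nondegenerate (T e). Proof. by case: hT. Qed.

(** Element interiors are disjoint and element boundaries are null, so that the sum can be written
    with polynomials on closed simplices, the form required by the trace inequality. *)
Lemma mesh_integral_split (B : set 'rV[R]_n.+1) g (F : 'I_N -> 'rV[R]_n.+1 -> R) :
  measurable B -> leb n.+1 B = 0%E -> pwpol T g -> (forall e, exists m, mpol m (F e)) ->
  (forall e x, interior (simplex (T e)) x -> g x = F e x) ->
  \int[leb n.+1]_(x in mesh_open T `\` B) g x = \sum_e \int[leb n.+1]_(x in simplex (T e)) F e x.
Proof.
move=> mB B0 pg hF gF.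
have mI e : measurable (interior (simplex (T e))) by apply: measurable_open_rV; exact: open_interior.
have E : mesh_open T = \big[setU/set0]_(e <- enum 'I_N) interior (simplex (T e)).
  rewrite -bigcup_seq; apply/seteqP; split => x [e _ hx]; exists e => //.
  by rewrite /= mem_enum.
have IE e : (\int[leb n.+1]_(x in interior (simplex (T e))) (g x)%:E = \int[leb n.+1]_(x in simplex (T e)) (F e x)%:E)%E.
  have [mS S0] := leb_simplex_bdry (nd e).
  rewrite [RHS](integral_null_set _ _ mS S0) setDD.
  have -> : simplex (T e) `&` interior (simplex (T e)) = interior (simplex (T e)).
    by apply/setIidPr; exact: interior_subset.
  by apply: eq_integral => x; rewrite inE => /gF ->.
have fF e : (\int[leb n.+1]_(x in simplex (T e)) (F e x)%:E)%E \is a fin_num.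
  have [m hm] := hF e; apply: integrable_fin_num; first exact: measurable_simplex.
  by apply: (mpol_integrable_bounded hm); [exact: measurable_simplex|exact: bounded_simplex].
rewrite /Rintegral -(integral_null_set _ _ mB B0) E integral_bigsetU_EFin//.
- rewrite big_enum/= (eq_bigr (fun e => (fine (\int[leb n.+1]_(x in simplex (T e)) (F e x)%:E))%:E)).
    by rewrite sumEFin.
  by move=> e _; rewrite fineK// IE.
- exact: enum_uniq.
- by move=> e e' _ _ [x [xe xe']]; apply: (interior_simplex_disjoint hT xe xe').
- by rewrite -E; apply/measurable_EFinP; exact: measurable_pwpol.
Qed.

Lemma elem_trace_grad l q e P : Defs.lagrange Om T l q -> mpol l P ->
  (forall x, interior (simplex (T e)) x -> forall i, pderive i q x = pderive i P x) ->
  forall x, simplex (T e) x -> elem_trace (T e) (grad q) x = grad P x.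
Proof.
move=> hq hP qP x hx; apply: elem_trace_eq => //.
  by move=> y hy; apply/rowP => i; rewrite !mxE qP.
apply: mx_continuous_at => i j; rewrite (_ : (fun _ => _) = pderive j P).
  exact: mpol_continuous (mpol_pderive j hP) _.
by apply/funext => y; rewrite mxE.
Qed.

Definition vgrad_of (P : 'I_n.+1 -> 'rV[R]_n.+1 -> R) x : 'M[R]_n.+1 := \matrix_(i, j) pderive j (P i) x.

Lemma elem_trace_vgrad k (u : 'rV[R]_n.+1 -> 'rV[R]_n.+1) e (P : 'I_n.+1 -> 'rV[R]_n.+1 -> R) : (forall i, mpol k (P i)) ->
  (forall x, interior (simplex (T e)) x -> forall i j, pderive j (fun y => u y 0 i) x = pderive j (P i) x) ->
  forall x, simplex (T e) x -> elem_trace (T e) (vgrad u) x = vgrad_of P x.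
Proof.
move=> hP uP x hx; apply: elem_trace_eq => //.
  by move=> y hy; apply/matrixP => i j; rewrite !mxE uP.
apply: mx_continuous_at => i j; rewrite (_ : (fun _ => _) = pderive j (P i)).
  exact: mpol_continuous (mpol_pderive j (hP i)) _.
by apply/funext => y; rewrite mxE.
Qed.

Lemma vector_pieces k (u : 'rV[R]_n.+1 -> 'rV[R]_n.+1) e : (forall i, Defs.lagrange Om T k (fun x => u x 0 i)) ->
  exists P : 'I_n.+1 -> 'rV[R]_n.+1 -> R, (forall i, mpol k (P i)) /\
  (forall x, interior (simplex (T e)) x -> forall i j, pderive j (fun y => u y 0 i) x = pderive j (P i) x).
Proof.
move=> hu; have /choice[P hP] i := lagrange_pieces e (hu i).
exists P; split=> [i|x hx i j]; first by have [] := hP i.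
by have [_ _ /(_ x hx j)[]] := hP i.
Qed.

Lemma elem_trace_grad_lin l q q' a e x : Defs.lagrange Om T l q -> Defs.lagrange Om T l q' ->
  simplex (T e) x ->
  elem_trace (T e) (grad (fun y => a * q y + q' y)) x =
  a *: elem_trace (T e) (grad q) x + elem_trace (T e) (grad q') x.
Proof.
move=> hq hq' hx.
have [P [hP _ dP]] := lagrange_pieces e hq; have [P' [hP' _ dP']] := lagrange_pieces e hq'.
rewrite (elem_trace_grad hq hP (fun x hx i => (dP x hx i).2) hx).
rewrite (elem_trace_grad hq' hP' (fun x hx i => (dP' x hx i).2) hx).
apply: (@elem_trace_eq _ _ _ _ _ (fun y => a *: grad P y + grad P' y)) => //.
  move=> y hy; apply/rowP => i; rewrite !mxE.
  have oy : mesh_open T y by exists e.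
  by rewrite (pderive_lin _ _ hq hq' oy) (dP y hy i).2 (dP' y hy i).2.
apply: mx_continuous_at => i j.
rewrite (_ : (fun _ => _) = fun y => a * pderive j P y + pderive j P' y).
  apply: (@mpol_continuous _ _ l); apply: mpol_add; last exact: mpol_pderive.
  by apply: mpol_scale; exact: mpol_pderive.
by apply/funext => y; rewrite !mxE.
Qed.

Lemma elem_trace_vgrad_lin k (u u' : 'rV[R]_n.+1 -> 'rV[R]_n.+1) a e x :
  (forall i, Defs.lagrange Om T k (fun x => u x 0 i)) ->
  (forall i, Defs.lagrange Om T k (fun x => u' x 0 i)) ->
  simplex (T e) x ->
  elem_trace (T e) (vgrad (fun y => a *: u y + u' y)) x =
  a *: elem_trace (T e) (vgrad u) x + elem_trace (T e) (vgrad u') x.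
Proof.
move=> hu hu' hx.
have [P [hP dP]] := vector_pieces e hu; have [P' [hP' dP']] := vector_pieces e hu'.
rewrite (elem_trace_vgrad hP dP hx) (elem_trace_vgrad hP' dP' hx).
apply: (@elem_trace_eq _ _ _ _ _ (fun y => a *: vgrad_of P y + vgrad_of P' y)) => //.
  move=> y hy; apply/matrixP => i j; rewrite !mxE.
  have oy : mesh_open T y by exists e.
  have -> : (fun z => (a *: u z + u' z) 0 i) = (fun z => a * u z 0 i + u' z 0 i).
    by apply/funext => z; rewrite !mxE.
  by rewrite (pderive_lin _ _ (hu i) (hu' i) oy) dP// dP'.
apply: mx_continuous_at => i j.
rewrite (_ : (fun _ => _) = fun y => a * pderive j (P i) y + pderive j (P' i) y).
  apply: (@mpol_continuous _ _ k); apply: mpol_add; last exact: mpol_pderive.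
  by apply: mpol_scale; exact: mpol_pderive.
by apply/funext => y; rewrite !mxE.
Qed.

Definition facet_density (nuG q : 'rV[R]_n.+1 -> R) (u : 'rV[R]_n.+1 -> 'rV[R]_n.+1) e i x : R :=
  dot (vprod (elem_trace (T e) (grad q) x) (facet_normal (T e) i))
      (nuG x *: curl_of (elem_trace (T e) (vgrad u) x)).

Lemma vprod_lin a (x y v : 'rV[R]_n.+1) : vprod (a *: x + y) v = a *: vprod x v + vprod y v.
Proof. by apply/rowP => i; rewrite !mxE; ring. Qed.

Lemma curl_of_lin a (G H : 'M[R]_n.+1) : curl_of (a *: G + H) = a *: curl_of G + curl_of H.
Proof. by apply/rowP => i; rewrite !mxE; ring. Qed.

Section FacetIntegral.
Variables (k l : nat) (nuG q : 'rV[R]_n.+1 -> R) (u : 'rV[R]_n.+1 -> 'rV[R]_n.+1) (numax : R).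
Variable w : 'rV[R]_n.+1 -> R.
Hypothesis cw : {within closure Om, continuous w}.
Hypothesis wb : forall x, closure Om x -> 0 <= w x <= numax.
Hypothesis nuGw : forall x, bdry Om x -> nuG x = w x.

Let param e i y := facet_base (T e) i + y *m facet_edges (T e) i.

Lemma facet_density_bound e i (P : 'rV[R]_n.+1 -> R) (Q : 'I_n.+1 -> 'rV[R]_n.+1 -> R) (eta : R) y :
  0 < eta -> facet (T e) i `<=` bdry Om -> ref_simplex y ->
  (forall x, simplex (T e) x -> elem_trace (T e) (grad q) x = grad P x) ->
  (forall x, simplex (T e) x -> elem_trace (T e) (vgrad u) x = vgrad_of Q x) ->
  `|facet_density nuG q u e i (param e i y)| <=
  \sum_j 6 * eta * (pderive j P (param e i y) ^+ 2) +
  \sum_m \sum_j 6 * numax ^+ 2 / eta * (pderive j (Q m) (param e i y) ^+ 2).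
Proof.
move=> eta0 fb hy hP hQ; have fy := facet_chart (T e) i hy.
have Sy := facet_sub_simplex fy; have by_ := fb _ fy.
have nb : 0 <= nuG (param e i y) <= numax by rewrite nuGw//; apply: wb; exact: by_.1.
rewrite /facet_density hP// hQ//.
apply: (le_trans (vprod_curl_bound _ _ nb eta0 (facet_normal_coord _ _))).
rewrite le_eqVlt; apply/orP; left; apply/eqP; congr (_ + _).
  by rewrite /dot mulr_sumr; apply: eq_bigr => j _; rewrite !mxE.
rewrite /frob mulr_sumr; apply: eq_bigr => m _.
by rewrite mulr_sumr; apply: eq_bigr => j _; rewrite !mxE.
Qed.

Hypothesis hq : Defs.lagrange Om T l q.
Hypothesis hu : forall i, Defs.lagrange Om T k (fun x => u x 0 i).

(** Domination by the polynomial of [facet_density_bound] with [eta = 1]. For measurability [nuG] is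
    replaced by [w], which is continuous within [closure Om], hence along the facet, and the traces
    by polynomials. *)
Lemma facet_density_integrable e i : facet (T e) i `<=` bdry Om ->
  (leb n).-integrable ref_simplex (EFin \o (fun y => facet_density nuG q u e i (param e i y))).
Proof.
move=> fb.
have [P [hP _ dP]] := lagrange_pieces e hq; have [S [hS dS]] := vector_pieces e hu.
have tP := elem_trace_grad hq hP (fun x hx i => (dP x hx i).2).
have tS := elem_trace_vgrad hS dS.
have mpar m g : mpol m g -> mpol m (fun y => g (param e i y)) by exact: mpol_affine.
have ipar m g : mpol m g -> (leb n).-integrable ref_simplex (EFin \o (fun y => g (param e i y))).
  move=> hg; apply: mpol_integrable_bounded (mpar _ _ hg) _ _; first exact: measurable_ref_simplex.
  exact: bounded_ref_simplex.
have msq m g : mpol m g -> mpol (m + m) (fun y => g y ^+ 2) by move=> hg; exact: mpolM.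
have mR := @measurable_ref_simplex R n.
pose D y := \sum_j 6 * 1 * (pderive j P (param e i y) ^+ 2) +
  \sum_m \sum_j 6 * numax ^+ 2 / 1 * (pderive j (S m) (param e i y) ^+ 2).
have iD : (leb n).-integrable ref_simplex (EFin \o D).
  apply: integrable_EFinD => //.
    apply: integrable_EFin_sum => // j; apply: integrable_EFinZ => //.
    by apply: (ipar _ (fun x => pderive j P x ^+ 2)); apply: msq; exact: mpol_pderive hP.
  apply: integrable_EFin_sum => // m; apply: integrable_EFin_sum => // j; apply: integrable_EFinZ => //.
  by apply: (ipar _ (fun x => pderive j (S m) x ^+ 2)); apply: msq; exact: mpol_pderive (hS m).
apply: (le_integrable mR _ _ iD); last first.
  move=> y hy; rewrite /= lee_fin; apply: le_trans (ler_norm _).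
  exact: facet_density_bound.
apply/measurable_EFinP.
have mp m g : mpol m g -> measurable_fun ref_simplex (fun y => g (param e i y) : measurableTypeR R).
  move=> hg; apply: (@measurable_funTS _ _ _ _ ref_simplex); apply: measurable_continuous_rV.
  exact: mpol_continuous (mpar _ _ hg).
have cpar : continuous (param e i).
  have := @affine_continuous _ _ _ (facet_edges (T e) i) (facet_base (T e) i) 0.
  by under eq_fun do rewrite subr0.
have mw : measurable_fun ref_simplex (fun y => w (param e i y) : measurableTypeR R).
  apply: measurable_within_continuous => //; apply/subspace_continuousP => y hy A.
  have cy : closure Om (param e i y) := (fb _ (facet_chart (T e) i hy)).1.
  move/subspace_continuousP : cw => /(_ _ cy A) h /h hA.
  have nA : nbhs (param e i y) [set z | closure Om z -> A (w z)] := hA.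
  have nA' : nbhs y [set z | closure Om (param e i z) -> A (w (param e i z))] := cpar y _ nA.
  suff : \forall z \near y, ref_simplex z -> A (w (param e i z)) by [].
  apply: (filterS _ nA') => z hz rz.
  by apply: hz; exact: (fb _ (facet_chart (T e) i rz)).1.
pose h y := \sum_(c < cdim) ((pderive (cidx1 c) P (param e i y) * facet_normal (T e) i 0 (cidx2 c)
    - pderive (cidx2 c) P (param e i y) * facet_normal (T e) i 0 (cidx1 c)) *
   (w (param e i y) * (pderive (cidx1 c) (S (cidx2 c)) (param e i y) - pderive (cidx2 c) (S (cidx1 c)) (param e i y)))).
apply: (@eq_measurable_fun _ _ _ _ _ h).
  move=> y; rewrite inE => hy; have fy := facet_chart (T e) i hy.
  have Sy := facet_sub_simplex fy; rewrite /facet_density tP// tS// nuGw; last exact: fb.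
  by apply: eq_bigr => c _; rewrite !mxE.
apply: measurable_sum => c; apply: measurable_funM.
  apply: measurable_funB; apply: measurable_funM => //; exact: mp (mpol_pderive _ hP).
apply: measurable_funM => //.
by apply: measurable_funB; [exact: mp (mpol_pderive _ (hS _))|exact: mp (mpol_pderive _ (hS _))].
Qed.

Lemma facet_integral_bound e i (P : 'rV[R]_n.+1 -> R) (S : 'I_n.+1 -> 'rV[R]_n.+1 -> R) (eta : R) :
  0 < eta -> facet (T e) i `<=` bdry Om -> mpol l P -> (forall i, mpol k (S i)) ->
  (forall x, simplex (T e) x -> elem_trace (T e) (grad q) x = grad P x) ->
  (forall x, simplex (T e) x -> elem_trace (T e) (vgrad u) x = vgrad_of S x) ->
  `|facet_integral (T e) i (facet_density nuG q u e i)| <=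
  \sum_j 6 * eta * facet_integral (T e) i (fun x => pderive j P x ^+ 2) +
  \sum_m \sum_j 6 * numax ^+ 2 / eta * facet_integral (T e) i (fun x => pderive j (S m) x ^+ 2).
Proof.
move=> eta0 fb hP hS tP tS; have mR := @measurable_ref_simplex R n.
have ipar m g c : mpol m g -> (leb n).-integrable ref_simplex (EFin \o (fun y => c * (g (param e i y) ^+ 2))).
  move=> hg; apply: integrable_EFinZ => //.
  apply: (@mpol_integrable_bounded _ _ _ (m + m)) => //; last exact: bounded_ref_simplex.
  by apply: (@mpol_affine _ _ _ _ _ _ (fun x => g x ^+ 2)); exact: mpolM.
have iP j := ipar _ _ (6 * eta) (mpol_pderive j hP).
have iS m j := ipar _ _ (6 * numax ^+ 2 / eta) (mpol_pderive j (hS m)).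
have iSs m := @integrable_EFin_sum _ _ _ (leb n) _ mR _ (index_enum _) _ (iS m).
have iPs := @integrable_EFin_sum _ _ _ (leb n) _ mR _ (index_enum _) _ iP.
have iSss := @integrable_EFin_sum _ _ _ (leb n) _ mR _ (index_enum _) _ iSs.
have idf := facet_density_integrable fb.
rewrite /facet_integral normrM ger0_norm ?sqrtr_ge0//.
set s := Num.sqrt _; have s0 : 0 <= s by exact: sqrtr_ge0.
have iP1 j : (leb n).-integrable ref_simplex (EFin \o (fun y => pderive j P (param e i y) ^+ 2)).
  by have := ipar _ _ 1 (mpol_pderive j hP); under eq_fun do rewrite mul1r.
have iS1 m j : (leb n).-integrable ref_simplex (EFin \o (fun y => pderive j (S m) (param e i y) ^+ 2)).
  by have := ipar _ _ 1 (mpol_pderive j (hS m)); under eq_fun do rewrite mul1r.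
have E1 := Rintegral_sumZ mR s (6 * eta) (index_enum _) iP1.
have E2 := Rintegral_sum2Z mR s (6 * numax ^+ 2 / eta) (index_enum _) (index_enum _) iS1.
suff : s * `|\int[leb n]_(y in ref_simplex) facet_density nuG q u e i (param e i y)| <=
  s * \int[leb n]_(y in ref_simplex) (\sum_j 6 * eta * (pderive j P (param e i y) ^+ 2)) +
  s * \int[leb n]_(y in ref_simplex) (\sum_m \sum_j 6 * numax ^+ 2 / eta * (pderive j (S m) (param e i y) ^+ 2)).
  by rewrite -E1 -E2.
rewrite -mulrDr ler_wpM2l// -RintegralD//.
apply: (le_trans (le_normr_Rintegral mR idf)); apply: le_Rintegral => //.
- exact: integrable_norm idf.
- by apply: integrable_EFinD.
- move=> y hy; exact: facet_density_bound.
Qed.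

End FacetIntegral.

Lemma elem_size_ge0 e : 0 <= elem_size T e.
Proof.
rewrite /elem_size /diam; set A := (X in sup X).
have [hA|/sup_out ->//] := pselect (has_sup A).
by have [[s [z hz zs]] _] := hA; apply: le_trans (ub_le_sup hA.2 (x := s) _); [rewrite -zs enorm_ge0|exists z].
Qed.

(** Since division by zero yields zero, the lower bound 1 on the ratio rules out an element of size
    zero. *)
Lemma quasi_uniform_gt0 Q e : quasi_uniform T Q -> 0 < mesh_size T /\ 0 < elem_size T e.
Proof.
move=> /(_ e)/andP[h1 _]; have := elem_size_ge0 e; rewrite le_eqVlt => /predU1P[he|he].
  by move: h1; rewrite -he invr0 mulr0 ler10.
split=> //; have : 0 < mesh_size T / elem_size T e by exact: lt_le_trans h1.
by rewrite pmulr_lgt0 ?invr_gt0.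
Qed.

(** Quasi-uniformity followed by shape regularity gives [h <= Q |kappa| inball_diam], which trades
    the inscribed diameter for the mesh size. Adding 1 makes the constant positive, so that it may
    be divided by. *)
Lemma mesh_trace_inequality kappa Q m C0 e i p : 0 <= Q -> 0 <= C0 ->
  (forall (a : 'I_n.+2 -> 'rV[R]_n.+1) i (p : 'rV[R]_n.+1 -> R), Defs.nondegenerate a -> mpol m p ->
    facet_integral a i (fun x => p x ^+ 2) * inball_diam (simplex a) <=
    C0 * \int[leb n.+1]_(x in simplex a) (p x ^+ 2)) ->
  shape_regular T kappa -> quasi_uniform T Q -> mpol m p ->
  facet_integral (T e) i (fun x => p x ^+ 2) <=
  (C0 * `|kappa| * Q + 1) / mesh_size T * \int[leb n.+1]_(x in simplex (T e)) (p x ^+ 2).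
Proof.
move=> Q0 C00 hC sr qu hp; have [h0 he0] := quasi_uniform_gt0 e qu.
have /andP[_ hQ] := qu e.
have {}hQ : mesh_size T <= Q * elem_size T e by rewrite -ler_pdivrMr.
have hk : elem_size T e <= `|kappa| * inball_diam (simplex (T e)).
  by apply: (le_trans (sr e)); rewrite ler_wpM2r ?inball_diam_ge0// ler_norm.
have hC' := hC (T e) i p (nd e) hp.
have f0 : 0 <= facet_integral (T e) i (fun x => p x ^+ 2).
  by apply: mulr_ge0; [exact: sqrtr_ge0|apply: Rintegral_ge0 => y _; exact: sqr_ge0].
have I0 : 0 <= \int[leb n.+1]_(x in simplex (T e)) (p x ^+ 2).
  by apply: Rintegral_ge0 => y _; exact: sqr_ge0.
rewrite mulrAC ler_pdivlMr//.
have b1 : mesh_size T <= Q * `|kappa| * inball_diam (simplex (T e)).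
  by apply: (le_trans hQ); rewrite -mulrA ler_wpM2l.
apply: (le_trans (ler_wpM2l f0 b1)).
have b2 := ler_wpM2l (mulr_ge0 Q0 (normr_ge0 kappa)) hC'.
move: b2 I0; set F := facet_integral _ _ _; set b := inball_diam _; set I := Rintegral _ _ _.
move=> b2 I0; rewrite [leLHS](_ : _ = Q * `|kappa| * (F * b)); last by ring.
apply: (le_trans b2); rewrite mulrDl mul1r [leLHS](_ : _ = C0 * `|kappa| * Q * I); last by ring.
by rewrite lerDl.
Qed.

(** An element has [n.+2] facets, and each facet integral of a squared derivative costs [C1 / h].
    With the weight [eta] chosen below, [6 eta (n+2) C1 / h] is 1/4, and [6 numax^2 / eta] times
    [(n+2) C1 / h] is [144 (n+2)^2 C1^2 numax^2 / h^2], that is, 4 times the coefficient in the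
    statement. Degree [maxn k l] covers derivatives of pressure and velocity. *)
Lemma boundary_term_bound kappa Q k l C0 (nuG q w : 'rV[R]_n.+1 -> R) (u : 'rV[R]_n.+1 -> 'rV[R]_n.+1) numax B :
  0 <= Q -> 0 <= C0 ->
  (forall (a : 'I_n.+2 -> 'rV[R]_n.+1) i (p : 'rV[R]_n.+1 -> R), Defs.nondegenerate a -> mpol (maxn k l) p ->
    facet_integral a i (fun x => p x ^+ 2) * inball_diam (simplex a) <=
    C0 * \int[leb n.+1]_(x in simplex a) (p x ^+ 2)) ->
  shape_regular T kappa -> quasi_uniform T Q -> 0 < mesh_size T ->
  {within closure Om, continuous w} ->
  (forall x, closure Om x -> 0 <= w x <= numax) ->
  (forall x, bdry Om x -> nuG x = w x) ->
  Defs.lagrange Om T l q -> (forall i, Defs.lagrange Om T k (fun x => u x 0 i)) ->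
  measurable B -> leb n.+1 B = 0%E ->
  `|boundary_term Om T nuG q u| <=
  4^-1 * \int[leb n.+1]_(x in mesh_open T `\` B) dot (grad q x) (grad q x) +
  4 * (36 * n.+2%:R ^+ 2 * (C0 * `|kappa| * Q + 1) ^+ 2 * numax ^+ 2 / mesh_size T ^+ 2) *
   \int[leb n.+1]_(x in mesh_open T `\` B) frob (vgrad u x) (vgrad u x).
Proof.
move=> Q0 C00 hC sr qu h0 cw wb nuGw hq hu mB B0.
set C1 := C0 * `|kappa| * Q + 1; set h := mesh_size T.
have C10 : 0 < C1 by rewrite ltr_wpDl// !mulr_ge0.
have n20 : 0 < n.+2%:R :> R by [].
(* Young's inequality with the weight that leaves 1/4 in front of |grad q|^2. *)
have [eta [eta0 etaE]] : exists eta, 0 < eta /\ eta = h / (24 * n.+2%:R * C1).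
  by exists (h / (24 * n.+2%:R * C1)); rewrite divr_gt0// !mulr_gt0.
have /choice[P hP] e := lagrange_pieces e hq.
have /choice[S hS] e := vector_pieces e hu.
have tP e : forall x, simplex (T e) x -> elem_trace (T e) (grad q) x = grad (P e) x.
  by have [mP _ dP] := hP e; exact: (elem_trace_grad hq mP (fun x hx i => (dP x hx i).2)).
have tS e : forall x, simplex (T e) x -> elem_trace (T e) (vgrad u) x = vgrad_of (S e) x.
  by have [mS dS] := hS e; exact: (elem_trace_vgrad mS dS).
have mP e : mpol l (P e) by have [] := hP e.
have mS e i : mpol k (S e i) by have [] := hS e.
have mpolsq m g : mpol m g -> mpol (m + m) (fun y : 'rV[R]_n.+1 => g y ^+ 2) by move=> hg; exact: mpolM.
have ipol m g e : mpol m g -> (leb n.+1).-integrable (simplex (T e)) (EFin \o (fun x => g x ^+ 2)).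
  move=> hg; apply: mpol_integrable_bounded (mpolsq _ _ hg) _ _; first exact: measurable_simplex.
  exact: bounded_simplex.
have mSi e := measurable_simplex (nd e).
pose Ie e (g : 'rV[R]_n.+1 -> R) := \int[leb n.+1]_(x in simplex (T e)) (g x ^+ 2).
have EP : \int[leb n.+1]_(x in mesh_open T `\` B) dot (grad q x) (grad q x) =
    \sum_e \sum_j Ie e (pderive j (P e)).
  rewrite (@mesh_integral_split _ _ (fun e x => \sum_j pderive j (P e) x ^+ 2))//.
  - apply: eq_bigr => e _; rewrite (Rintegral_sum (mSi e))//.
    by move=> j; exact: ipol (mpol_pderive j (mP e)).
  - have -> : (fun x => dot (grad q x) (grad q x)) = (fun x => \sum_j pderive j q x * pderive j q x).
      by apply/funext => x; apply: eq_bigr => j _; rewrite !mxE.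
    by apply: pwpol_sum => j; apply: pwpolM; exact: pderive_pwpol hq.
  - by move=> e; exists (l + l)%N; apply: mpol_sum => j; apply: mpolsq; exact: mpol_pderive.
  - move=> e x hx; apply: eq_bigr => j _; rewrite !mxE -expr2.
    by have [_ _ /(_ x hx j)[_ ->]] := hP e.
have ES : \int[leb n.+1]_(x in mesh_open T `\` B) frob (vgrad u x) (vgrad u x) =
    \sum_e \sum_m \sum_j Ie e (pderive j (S e m)).
  rewrite (@mesh_integral_split _ _ (fun e x => \sum_m \sum_j pderive j (S e m) x ^+ 2))//.
  - apply: eq_bigr => e _; rewrite (Rintegral_sum (mSi e))//.
      apply: eq_bigr => m _; rewrite (Rintegral_sum (mSi e))// => j; exact: ipol (mpol_pderive j (mS e m)).
    by move=> m; apply: integrable_EFin_sum => // j; exact: ipol (mpol_pderive j (mS e m)).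
  - have -> : (fun x => frob (vgrad u x) (vgrad u x)) = (fun x => \sum_m \sum_j pderive j (fun y => u y 0 m) x * pderive j (fun y => u y 0 m) x).
      by apply/funext => x; apply: eq_bigr => m _; apply: eq_bigr => j _; rewrite !mxE.
    by apply: pwpol_sum => m; apply: pwpol_sum => j; apply: pwpolM; exact: pderive_pwpol (hu m).
  - by move=> e; exists (k + k)%N; apply: mpol_sum => m; apply: mpol_sum => j; apply: mpolsq; exact: mpol_pderive.
  - move=> e x hx; apply: eq_bigr => m _; apply: eq_bigr => j _; rewrite !mxE -expr2.
    by have [_ /(_ x hx m j) ->] := hS e.
have Ie0 e g : 0 <= Ie e g by apply: Rintegral_ge0 => x _; exact: sqr_ge0.
pose X e := 6 * eta * \sum_j Ie e (pderive j (P e)) + 6 * numax ^+ 2 / eta * \sum_m \sum_j Ie e (pderive j (S e m)).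
have c10 : 0 <= 6 * eta by rewrite mulr_ge0// ltW.
have c20 : 0 <= 6 * numax ^+ 2 / eta by rewrite divr_ge0 ?(ltW eta0)// mulr_ge0// sqr_ge0.
have X0 e : 0 <= X e.
  by apply: addr_ge0; apply: mulr_ge0 => //; apply: sumr_ge0 => m _ //; apply: sumr_ge0.
have ftr e i m p : mpol m p -> (m <= maxn k l)%N ->
    facet_integral (T e) i (fun x => p x ^+ 2) <= C1 / h * Ie e p.
  move=> hp hm; exact: (mesh_trace_inequality e i Q0 C00 hC sr qu (mpolW hm hp)).
have fbound e i : facet (T e) i `<=` bdry Om -> `|facet_integral (T e) i (facet_density nuG q u e i)| <= C1 / h * X e.
  move=> fb.
  apply: (le_trans (facet_integral_bound cw wb nuGw hq hu eta0 fb (mP e) (mS e) (tP e) (tS e))).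
  rewrite /X mulrDr; apply: lerD.
    rewrite [leRHS]mulrCA mulr_sumr mulr_sumr; apply: ler_sum => j _.
    by apply: ler_wpM2l => //; apply: ftr (mpol_pderive j (mP e)) _; exact: leq_maxr.
  rewrite [leRHS]mulrCA mulr_sumr mulr_sumr; apply: ler_sum => m _.
  rewrite mulr_sumr mulr_sumr; apply: ler_sum => j _.
  by apply: ler_wpM2l => //; apply: ftr (mpol_pderive j (mS e m)) _; exact: leq_maxl.
have C1h : 0 <= C1 / h by rewrite divr_ge0// ltW.
have tot : `|boundary_term Om T nuG q u| <= \sum_e n.+2%:R * (C1 / h * X e).
  apply: (le_trans (ler_norm_sum _ _ _)); apply: ler_sum => e _.
  apply: (le_trans (ler_norm_sum _ _ _)).
  apply: (@le_trans _ _ (\sum_(i < n.+2) C1 / h * X e)); last first.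
    by rewrite sumr_const card_ord -[leLHS]mulr_natl.
  rewrite [leLHS]big_mkcond; apply: ler_sum => i _; case: ifP => [/asboolP fb|_]; first exact: fbound.
  exact: mulr_ge0.
apply: (le_trans tot); rewrite EP ES -!mulr_sumr big_split/= -!mulr_sumr.
rewrite le_eqVlt; apply/orP; left; apply/eqP.
have hn0 : h != 0 by rewrite gt_eqF.
have Cn0 : C1 != 0 by rewrite gt_eqF.
set x := \sum_e _; set y := \sum_e _; rewrite etaE; field.
by rewrite hn0 Cn0 -(natrD _ 2 n) pnatr_eq0.
Qed.

Lemma boundary_term_linear_l k l (nuG w q q' : 'rV[R]_n.+1 -> R) (u : 'rV[R]_n.+1 -> 'rV[R]_n.+1) numax a :
  {within closure Om, continuous w} ->
  (forall x, closure Om x -> 0 <= w x <= numax) ->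
  (forall x, bdry Om x -> nuG x = w x) ->
  Defs.lagrange Om T l q -> Defs.lagrange Om T l q' -> (forall i, Defs.lagrange Om T k (fun x => u x 0 i)) ->
  boundary_term Om T nuG (fun y => a * q y + q' y) u = a * boundary_term Om T nuG q u + boundary_term Om T nuG q' u.
Proof.
move=> cw wb nuGw hq hq' hu; rewrite /boundary_term /boundary_integral mulr_sumr -big_split/=.
apply: eq_bigr => e _; rewrite mulr_sumr -big_split/=; apply: eq_bigr => i /asboolP fb.
have iq := facet_density_integrable cw wb nuGw hq hu fb.
have iq' := facet_density_integrable cw wb nuGw hq' hu fb.
have mR := @measurable_ref_simplex R n.
rewrite /facet_integral mulrCA -mulrDr; congr (_ * _).
rewrite -(Rintegral_lin mR a iq iq').
apply: eq_Rintegral => y; rewrite inE => hy.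
have Sy := facet_sub_simplex (facet_chart (T e) i hy).
by rewrite (elem_trace_grad_lin a hq hq' Sy) vprod_lin dotDl dotZl.
Qed.

Lemma boundary_term_linear_r k l (nuG w q : 'rV[R]_n.+1 -> R) (u u' : 'rV[R]_n.+1 -> 'rV[R]_n.+1) numax a :
  {within closure Om, continuous w} ->
  (forall x, closure Om x -> 0 <= w x <= numax) ->
  (forall x, bdry Om x -> nuG x = w x) ->
  Defs.lagrange Om T l q -> (forall i, Defs.lagrange Om T k (fun x => u x 0 i)) ->
  (forall i, Defs.lagrange Om T k (fun x => u' x 0 i)) ->
  boundary_term Om T nuG q (fun y => a *: u y + u' y) = a * boundary_term Om T nuG q u + boundary_term Om T nuG q u'.
Proof.
move=> cw wb nuGw hq hu hu'; rewrite /boundary_term /boundary_integral mulr_sumr -big_split/=.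
apply: eq_bigr => e _; rewrite mulr_sumr -big_split/=; apply: eq_bigr => i /asboolP fb.
have iu := facet_density_integrable cw wb nuGw hq hu fb.
have iu' := facet_density_integrable cw wb nuGw hq hu' fb.
have mR := @measurable_ref_simplex R n.
rewrite /facet_integral mulrCA -mulrDr; congr (_ * _).
rewrite -(Rintegral_lin mR a iu iu').
apply: eq_Rintegral => y; rewrite inE => hy.
have Sy := facet_sub_simplex (facet_chart (T e) i hy).
by rewrite (elem_trace_vgrad_lin a hu hu' Sy) curl_of_lin scalerDr scalerA mulrC -scalerA dotDr dotZr.
Qed.

End Boundary.

(** * The discrete spaces *)

Section DiscreteSpaces.
Context {R : realType} {n N : nat}.
Variables (Om : set 'rV[R]_n.+1) (T : 'I_N -> 'I_n.+2 -> 'rV[R]_n.+1).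
Hypothesis hOm : bounded_lipschitz_domain Om.
Hypothesis hT : triangulation Om T.

Lemma polynomial_fun_lin k a (P S : 'rV[R]_n.+1 -> R) : polynomial_fun k P -> polynomial_fun k S ->
  polynomial_fun k (fun x => a * P x + S x).
Proof.
move=> [c Pc] [d Sd]; exists (fun al => a * c al + d al) => x.
rewrite Pc Sd mulr_sumr -big_split/=; apply: eq_bigr => al _.
by rewrite mulrDl mulrA.
Qed.

Lemma lagrange_lin k a v w : Defs.lagrange Om T k v -> Defs.lagrange Om T k w ->
  Defs.lagrange Om T k (fun x => a * v x + w x).
Proof.
move=> [cv v0 pv] [cw w0 pw]; split.
- move: cv cw => /subspace_continuousP cv /subspace_continuousP cw.
  apply/subspace_continuousP => x hx; apply: cvgD; last exact: cw.
  by apply: cvgM; [exact: cvg_cst|exact: cv].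
- by move=> x hx; rewrite v0// w0// mulr0 addr0.
move=> e; have [P [hP vP]] := pv e; have [S [hS wS]] := pw e.
exists (fun x => a * P x + S x); split; first exact: polynomial_fun_lin.
by move=> x hx; rewrite vP// wS.
Qed.

Lemma lagrange_zero k : Defs.lagrange Om T k (fun=> 0).
Proof.
split=> //; first by move=> x; exact: cst_continuous.
move=> e; exists (fun=> 0); split => //; exists (fun=> 0) => x.
by rewrite big1// => al _; rewrite mul0r.
Qed.

Lemma Xh_lin k a v w : Xh Om T k v -> Xh Om T k w -> Xh Om T k (fun x => a *: v x + w x).
Proof.
move=> [hv bv] [hw bw]; split; last by move=> x hx; rewrite bv// bw// scaler0 addr0.
move=> i; have -> : (fun x => (a *: v x + w x) 0 i) = (fun x => a * v x 0 i + w x 0 i).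
  by apply/funext => x; rewrite !mxE.
exact: lagrange_lin.
Qed.

Lemma Xh_zero k : Xh Om T k (fun=> 0).
Proof.
split=> // i; have -> : (fun x : 'rV[R]_n.+1 => (0 : 'rV[R]_n.+1) 0 i) = (fun=> 0).
  by apply/funext => x; rewrite mxE.
exact: lagrange_zero.
Qed.

Lemma leb_mesh_open_lty : (leb n.+1 (mesh_open T) < +oo)%E.
Proof.
apply: leb_bounded_lty; last exact: measurable_mesh_open.
have [M M0 hM] := bounded_mesh T; exists M; split; first exact: num_real.
by move=> x Mx y [e _ /interior_subset /hM h]; exact: le_trans h (ltW Mx).
Qed.

Lemma lagrange_integrable l q : Defs.lagrange Om T l q ->
  (leb n.+1).-integrable (mesh_open T) (EFin \o q).
Proof.
move=> /lagrange_pwpol hq; have [M hM] := pwpol_bounded hq.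
apply: (@bounded_integrable _ _ _ _ M) => //.
- exact: measurable_mesh_open.
- exact: leb_mesh_open_lty.
- exact: measurable_pwpol.
Qed.

Lemma integral_Om (f : 'rV[R]_n.+1 -> R) :
  \int[leb n.+1]_(x in Om) f x = \int[leb n.+1]_(x in mesh_open T) f x.
Proof. by rewrite (integral_mesh_open hOm hT f measurable0 (measure0 _)) setD0. Qed.

Lemma Yh_lin l a q q' : Yh Om T l q -> Yh Om T l q' -> Yh Om T l (fun x => a * q x + q' x).
Proof.
move=> [hq iq] [hq' iq']; split; first exact: lagrange_lin.
rewrite integral_Om Rintegral_lin; last 3 first.
- exact: measurable_mesh_open.
- exact: lagrange_integrable hq.
- exact: lagrange_integrable hq'.
by rewrite -!integral_Om iq iq' mulr0 addr0.
Qed.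

Lemma Yh_zero l : Yh Om T l (fun=> 0).
Proof. by split; [exact: lagrange_zero|exact: Rintegral_cst0]. Qed.

(** Monomials cut off outside one element span. They are discontinuous and lie outside the discrete
    space, which is enough because [galerkin] only asks for a list whose span contains the space. *)
Lemma lagrange_span k : exists s : seq ('rV[R]_n.+1 -> R^o),
  forall v, Defs.lagrange Om T k v -> lspan s v.
Proof.
(* Closed elements overlap on common faces; [sel] assigns each point to one element, so that the cut
   pieces add up to [v] without double counting. *)
pose sel x : option 'I_N := [pick e | `[< simplex (T e) x >]].
pose cut e (f : 'rV[R]_n.+1 -> R^o) : 'rV[R]_n.+1 -> R^o := fun x => if sel x == Some e then f x else 0.
pose s := flatten [seq [seq cut e m | m <- mons n.+1 k] | e <- enum 'I_N].
have cut_lin e : linear (cut e).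
  move=> a f g; apply/funext => x; rewrite /cut !fctE /=.
  by case: ifP => // _; rewrite scaler0 addr0.
exists s => v hv.
have /choice[P hP] e := lagrange_pieces e hv.
have -> : v = \sum_e cut e (P e).
  apply/funext => x; rewrite fct_sumE.
  have [[e he]|nx] := pselect (exists e, simplex (T e) x).
    have : sel x != None by rewrite /sel; case: pickP => // /(_ e)/asboolP.
    case E : (sel x) => [d|//] _.
    have dx : simplex (T d) x by move: E; rewrite /sel; case: pickP => // d' /asboolP ? [<-].
    rewrite (bigD1 d)//= /cut E eqxx big1 ?addr0//.
      by have [_ hd _] := hP d; exact: hd.
    by move=> j jd; case: eqP => // -[dj]; rewrite dj eqxx in jd.
  have E : sel x = None by rewrite /sel; case: pickP => // e /asboolP he; case: nx; exists e.
  rewrite big1; last by move=> e _; rewrite /cut E.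
  have [_ v0 _] := hv; apply: v0; have [_ _ _ <-] := hT => -[e _ he]; apply: nx; by exists e.
elim/big_ind: _; first exact: (lspan_subspace s).1.
  by move=> x y sx sy; have := (lspan_subspace s).2 1 x y sx sy; rewrite scale1r.
move=> e _; have [hPe _ _] := hP e.
apply: (lspan_map (cut_lin e) _ (mpol_lspan hPe)) => m hm.
apply: lspan_mem; apply/flattenP; exists [seq cut e m | m <- mons n.+1 k]; last exact: map_f.
by apply/mapP; exists e => //; rewrite mem_enum.
Qed.

Lemma Galerkin_space_span k l :
  exists s : seq (('rV[R]_n.+1 -> 'rV[R]_n.+1) * ('rV[R]_n.+1 -> R^o)),
  forall u q, Xh Om T k u -> Yh Om T l q -> lspan s (u, q).
Proof.
have [s hs] := lagrange_span k; have [t ht] := lagrange_span l.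
pose V := (('rV[R]_n.+1 -> 'rV[R]_n.+1) * ('rV[R]_n.+1 -> R^o))%type.
pose hi i (f : 'rV[R]_n.+1 -> R^o) : V := ((fun x => f x *: delta_mx 0 i), 0).
pose h2 (f : 'rV[R]_n.+1 -> R^o) : V := (0, f).
have hil i : linear (hi i).
  move=> a f g; congr pair; last by rewrite /= scaler0 addr0.
  apply/funext => x.
  change ((a * f x + g x) *: delta_mx 0 i = a *: (f x *: delta_mx 0 i) + g x *: delta_mx 0 i :> 'rV[R]_n.+1).
  by rewrite scalerDl scalerA.
have h2l : linear h2 by move=> a f g; congr pair; rewrite /= scaler0 addr0.
pose s1 := flatten [seq [seq hi i m | m <- s] | i <- enum 'I_n.+1].
exists (s1 ++ [seq h2 m | m <- t]) => u q [hu _] [hq _].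
have -> : (u, q) = (u, 0) + (0, q) :> V by congr pair; rewrite /= ?addr0 ?add0r.
apply: lspan_cat; last first.
  by apply: (lspan_map h2l) (ht _ hq) => m hm; apply: lspan_mem; exact: map_f.
have -> : (u, 0) = \sum_i hi i (fun x => u x 0 i) :> V.
  have E (F : 'I_n.+1 -> V) : (\sum_i F i).1 = \sum_i (F i).1 by rewrite (big_morph _ (id1 := 0) (op1 := +%R)).
  have E2 (F : 'I_n.+1 -> V) : (\sum_i F i).2 = \sum_i (F i).2 by rewrite (big_morph _ (id1 := 0) (op1 := +%R)).
  rewrite [RHS]surjective_pairing E E2; congr pair; last by rewrite big1.
  by apply/funext => x; rewrite fct_sumE /= [LHS]row_sum_delta.
elim/big_ind: _; first exact: (lspan_subspace s1).1.
  by move=> x y sx sy; have := (lspan_subspace s1).2 1 x y sx sy; rewrite scale1r.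
move=> i _; apply: (lspan_map (hil i)) (hs _ (hu i)) => m hm; apply: lspan_mem.
apply/flattenP; exists [seq hi i m | m <- s]; last exact: map_f.
by apply/mapP; exists i => //; rewrite mem_enum.
Qed.

End DiscreteSpaces.

(** * The stabilised bilinear form *)

Section StabilisedForm.
Context {R : realType} {n N : nat}.
Variables (Om : set 'rV[R]_n.+1) (T : 'I_N -> 'I_n.+2 -> 'rV[R]_n.+1).
Hypothesis hOm : bounded_lipschitz_domain Om.
Hypothesis hT : triangulation Om T.
Variable B : set 'rV[R]_n.+1.
Hypotheses (mB : measurable B) (B0 : leb n.+1 B = 0%E).
Variables (k l : nat) (sigma delta numin numax gmax : R).
Variables (nu : 'rV[R]_n.+1 -> R) (gnu f : 'rV[R]_n.+1 -> 'rV[R]_n.+1).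
Variables (nuG w : 'rV[R]_n.+1 -> R).
Local Notation mu := (leb n.+1).
Local Notation D := (mesh_open T `\` B).
Hypothesis numin_gt0 : 0 < numin.
Hypothesis nuD : forall x, D x -> numin <= nu x <= numax.
Hypothesis gnuD : forall x, D x -> enorm (gnu x) <= gmax.
Hypotheses (mnu : measurable_fun Om nu) (mgnu : measurable_fun Om gnu) (hf : in_L2v Om f).
Hypothesis cw : {within closure Om, continuous w}.
Hypothesis wb : forall x, closure Om x -> 0 <= w x <= numax.
Hypothesis nuGw : forall x, bdry Om x -> nuG x = w x.
Hypotheses (sigma_gt0 : 0 < sigma) (delta_gt0 : 0 < delta).
Implicit Types (u v : 'rV[R]_n.+1 -> 'rV[R]_n.+1) (p q : 'rV[R]_n.+1 -> R).
Local Notation X := (Xh Om T k).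
Local Notation Y := (Yh Om T l).
Local Notation intD f := (mu.-integrable D (EFin \o f)).

Let mD : measurable D. Proof. by apply: measurableD => //; exact: measurable_mesh_open. Qed.

Let DOm : D `<=` Om. Proof. by move=> x [/(mesh_open_sub hOm hT)]. Qed.

Let Dmesh : D `<=` mesh_open T. Proof. by move=> x []. Qed.

Let fD : (mu D < +oo)%E.
Proof.
apply: (@le_lt_trans _ _ (mu (mesh_open T))); last exact: leb_mesh_open_lty.
by apply: le_measure; rewrite ?inE//; exact: measurable_mesh_open.
Qed.

(** The transposed velocity gradient applied to the viscosity gradient, for vectors written as
    rows. *)
Definition convection u x : 'rV[R]_n.+1 := gnu x *m vgrad u x.

Lemma convectionE u x : ((vgrad u x)^T *m (gnu x)^T)^T = convection u x.
Proof. by rewrite -trmx_mul trmxK. Qed.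

Lemma sqi_pwpol g : pwpol T g -> sqi D g.
Proof.
move=> hg; have [M hM] := pwpol_bounded hg.
apply: (@bounded_sqi _ _ _ mD fD _ M); last by move=> x /Dmesh; exact: hM.
by apply: measurable_funS (measurable_pwpol hg) => //; exact: measurable_mesh_open.
Qed.

Lemma measurable_coord_fun (g : 'rV[R]_n.+1 -> 'rV[R]_n.+1) i : measurable_fun Om g ->
  measurable_fun D (fun x => g x 0 i : measurableTypeR R).
Proof.
move=> mg; apply: (measurable_funS (measurable_Om hOm) DOm).
exact: (measurableT_comp (measurable_coord i)).
Qed.

Lemma sqi_f i : sqi D (fun x => f x 0 i).
Proof.
have [mf ff] := hf; have mOm := measurable_Om hOm; split; first exact: measurable_coord_fun.
have mfi j : measurable_fun Om (fun x => f x 0 j : measurableTypeR R).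
  exact: (measurableT_comp (measurable_coord j)).
have me : measurable_fun Om (fun x => (enorm (f x) ^+ 2)%:E).
  apply/measurable_EFinP; under eq_fun do rewrite sqr_enorm.
  have ms : measurable_fun Om (fun x => \sum_j f x 0 j * f x 0 j : measurableTypeR R).
    by apply: measurable_sum => j; apply: measurable_funM; exact: mfi.
  exact: ms.
have ie : mu.-integrable Om (fun x => (enorm (f x) ^+ 2)%:E).
  apply/integrableP; split => //.
  by under eq_integral do rewrite gee0_abs ?lee_fin ?sqr_ge0//.
apply: (integrableS mOm mD DOm).
apply: (le_integrable mOm _ _ ie).
  by apply/measurable_EFinP; exact: measurable_funX (mfi i).
move=> x _ /=; rewrite lee_fin !ger0_norm ?sqr_ge0// sqr_enorm; exact: sqr_coord_le_dot.
Qed.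

Lemma dot_integrable (F G : 'rV[R]_n.+1 -> 'rV[R]_n.+1) :
  (forall i, sqi D (fun x => F x 0 i)) -> (forall i, sqi D (fun x => G x 0 i)) ->
  intD (fun x => dot (F x) (G x)).
Proof.
move=> hF hG; apply: integrable_EFin_sum => // i; exact: sqi_mul.
Qed.

Lemma frob_integrable (F G : 'rV[R]_n.+1 -> 'M[R]_n.+1) :
  (forall i j, sqi D (fun x => F x i j)) -> (forall i j, sqi D (fun x => G x i j)) ->
  intD (fun x => frob (F x) (G x)).
Proof.
move=> hF hG; apply: integrable_EFin_sum => // i; apply: integrable_EFin_sum => // j.
exact: sqi_mul.
Qed.

Lemma sqi_coord u i : X u -> sqi D (fun x => u x 0 i).
Proof. by move=> [hu _]; apply: sqi_pwpol; exact: lagrange_pwpol (hu i). Qed.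

Lemma sqi_vgrad u i j : X u -> sqi D (fun x => vgrad u x i j).
Proof.
move=> [hu _]; have -> : (fun x => vgrad u x i j) = pderive j (fun y => u y 0 i).
  by apply/funext => x; rewrite mxE.
by apply: sqi_pwpol; exact: pderive_pwpol (hu i).
Qed.

Lemma sqi_sgrad u i j : X u -> sqi D (fun x => sgrad u x i j).
Proof.
move=> hu; have -> : (fun x => sgrad u x i j) = (fun x => 2^-1 * (vgrad u x i j + vgrad u x j i)).
  by apply/funext => x; rewrite /sgrad; move: (vgrad u x) => G; rewrite !mxE.
by apply: sqiZ => //; apply: sqiD => //; exact: sqi_vgrad.
Qed.

Lemma sqi_diverg u : X u -> sqi D (diverg u).
Proof. by move=> hu; apply: sqi_sum => // i; exact: sqi_vgrad. Qed.

Lemma sqi_grad q i : Y q -> sqi D (fun x => grad q x 0 i).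
Proof.
move=> [hq _]; have -> : (fun x => grad q x 0 i) = pderive i q by apply/funext => x; rewrite mxE.
by apply: sqi_pwpol; exact: pderive_pwpol hq.
Qed.

Lemma sqi_pressure q : Y q -> sqi D q.
Proof. by move=> [hq _]; apply: sqi_pwpol; exact: lagrange_pwpol hq. Qed.

Lemma sqi_stress u i j : X u -> sqi D (fun x => ((2 * nu x) *: sgrad u x) i j).
Proof.
move=> hu; have -> : (fun x => ((2 * nu x) *: sgrad u x) i j) = (fun x => (2 * nu x) * sgrad u x i j).
  by apply/funext => x; move: (sgrad u x) => G; rewrite mxE.
apply: (@bounded_mul_sqi _ _ _ mD (fun x => 2 * nu x) _ (2 * numax)); last exact: sqi_sgrad.
  by apply: measurable_funM => //; exact: measurable_funS (measurable_Om hOm) DOm mnu.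
move=> x /nuD/andP[h1 h2]; rewrite normrM !ger0_norm// ?ler_pM2l//.
by rewrite (le_trans _ h1)// ltW.
Qed.

Lemma sqi_convection u i : X u -> sqi D (fun x => convection u x 0 i).
Proof.
move=> hu; have -> : (fun x => convection u x 0 i) = (fun x => \sum_j gnu x 0 j * vgrad u x j i).
  by apply/funext => x; rewrite /convection; move: (vgrad u x) => G; rewrite mxE.
apply: sqi_sum => // j; apply: (@bounded_mul_sqi _ _ _ mD _ _ gmax); last exact: sqi_vgrad.
  exact: measurable_coord_fun.
by move=> x /gnuD; apply: le_trans; exact: coord_le_enorm.
Qed.

Definition residual u p x : 'rV[R]_n.+1 := grad p x + sigma *: u x - 2 *: convection u x.

Lemma sqi_residual u p i : X u -> Y p -> sqi D (fun x => residual u p x 0 i).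
Proof.
move=> hu hp; have -> : (fun x => residual u p x 0 i) =
    (fun x => (grad p x 0 i + sigma * u x 0 i) + (- 2) * convection u x 0 i).
  apply/funext => x; rewrite /residual; move: (grad p x) (convection u x) => a b.
  by rewrite !mxE mulNr.
apply: sqiD => //; last by apply: sqiZ => //; exact: sqi_convection.
by apply: sqiD => //; [exact: sqi_grad|apply: sqiZ => //; exact: sqi_coord].
Qed.

(** The volume terms of the two equations added, under a single integral, so that coercivity becomes
    a pointwise inequality in which the pressure terms cancel before integration. *)
Definition bulk u p v q x : R :=
  sigma * dot (u x) (v x) + frob ((2 * nu x) *: sgrad u x) (sgrad v x) - p x * diverg v x
  + q x * diverg u x + delta * dot (grad q x) (residual u p x).

Section Integrability.
Variables (u v : 'rV[R]_n.+1 -> 'rV[R]_n.+1) (p q : 'rV[R]_n.+1 -> R).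
Hypotheses (hu : X u) (hv : X v) (hp : Y p) (hq : Y q).

Lemma mass_integrable : intD (fun x => dot (u x) (v x)).
Proof. by apply: dot_integrable => i; exact: sqi_coord. Qed.

Lemma stress_integrable : intD (fun x => frob ((2 * nu x) *: sgrad u x) (sgrad v x)).
Proof. by apply: frob_integrable => i j; [exact: sqi_stress|exact: sqi_sgrad]. Qed.

Lemma pressure_integrable : intD (fun x => p x * diverg v x).
Proof. by apply: sqi_mul => //; [exact: sqi_pressure|exact: sqi_diverg]. Qed.

Lemma residual_integrable : intD (fun x => dot (grad q x) (residual u p x)).
Proof. by apply: dot_integrable => i; [exact: sqi_grad|exact: sqi_residual]. Qed.

Lemma load_integrable : intD (fun x => dot (v x) (f x)).
Proof. by apply: dot_integrable => i; [exact: sqi_coord|exact: sqi_f]. Qed.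

Lemma grad_load_integrable : intD (fun x => dot (grad q x) (f x)).
Proof. by apply: dot_integrable => i; [exact: sqi_grad|exact: sqi_f]. Qed.

End Integrability.

Lemma bulk_integrable u p v q : X u -> Y p -> X v -> Y q -> intD (bulk u p v q).
Proof.
move=> hu hp hv hq; rewrite /bulk; apply: integrable_EFinD => //; last first.
  by apply: integrable_EFinZ => //; exact: residual_integrable.
apply: integrable_EFinD => //; last exact: pressure_integrable.
apply: integrable_EFinB => //; last exact: pressure_integrable.
apply: integrable_EFinD => //; last exact: stress_integrable.
by apply: integrable_EFinZ => //; exact: mass_integrable.
Qed.

Definition stab_form u p v q : R :=
  \int[mu]_(x in D) bulk u p v q x + delta * boundary_term Om T nuG q u.

Definition load v q : R :=
  \int[mu]_(x in D) dot (v x) (f x) + delta * \int[mu]_(x in D) dot (grad q x) (f x).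

Lemma L2sE g g' : L2s Om g g' = \int[mu]_(x in D) (g x * g' x).
Proof. exact: (integral_mesh_open hOm hT). Qed.
Lemma L2vE g g' : L2v Om g g' = \int[mu]_(x in D) dot (g x) (g' x).
Proof. exact: (integral_mesh_open hOm hT). Qed.
Lemma L2mE g g' : L2m Om g g' = \int[mu]_(x in D) frob (g x) (g' x).
Proof. exact: (integral_mesh_open hOm hT). Qed.

Lemma bulk_split u p v q : X u -> Y p -> X v -> Y q ->
  \int[mu]_(x in D) bulk u p v q x =
  sigma * L2v Om u v + L2m Om (fun x => (2 * nu x) *: sgrad u x) (sgrad v) - L2s Om p (diverg v)
  + L2s Om q (diverg u) + delta * L2v Om (grad q) (residual u p).
Proof.
move=> hu hp hv hq; rewrite !L2vE L2mE !L2sE /bulk.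
have i1 := mass_integrable hu hv; have i2 := stress_integrable hu hv.
have i3 := pressure_integrable hv hp; have i4 := pressure_integrable hu hq.
have i5 := residual_integrable hu hp hq.
have i1' := integrable_EFinZ mD sigma i1; have i5' := integrable_EFinZ mD delta i5.
have i12 := integrable_EFinD mD i1' i2; have i123 := integrable_EFinB mD i12 i3.
have i1234 := integrable_EFinD mD i123 i4.
rewrite (RintegralD mD i1234 i5') (RintegralD mD i123 i4) (RintegralB mD i12 i3) (RintegralD mD i1' i2).
by rewrite (RintegralZl sigma mD i1) (RintegralZl delta mD i5).
Qed.

Lemma grad_lin a q q' x : Y q -> Y q' -> D x ->
  grad (fun y => a * q y + q' y) x = a *: grad q x + grad q' x.
Proof.
move=> [hq _] [hq' _] /Dmesh hx; apply/rowP => i; rewrite !mxE; exact: (pderive_lin _ _ hq hq' hx).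
Qed.

Lemma vgrad_lin a u u' x : X u -> X u' -> D x ->
  vgrad (fun y => a *: u y + u' y) x = a *: vgrad u x + vgrad u' x.
Proof.
move=> [hu _] [hu' _] /Dmesh hx; apply/matrixP => i j; rewrite !mxE.
have -> : (fun y => (a *: u y + u' y) 0 i) = (fun y => a * u y 0 i + u' y 0 i).
  by apply/funext => y; rewrite !mxE.
exact: (pderive_lin _ _ (hu i) (hu' i) hx).
Qed.

Lemma sgrad_lin a u u' x : X u -> X u' -> D x ->
  sgrad (fun y => a *: u y + u' y) x = a *: sgrad u x + sgrad u' x.
Proof.
move=> hu hu' hx; rewrite /sgrad vgrad_lin//; move: (vgrad u x) (vgrad u' x) => G H.
by apply/matrixP => i j; rewrite !mxE; ring.
Qed.

Lemma diverg_lin a u u' x : X u -> X u' -> D x ->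
  diverg (fun y => a *: u y + u' y) x = a * diverg u x + diverg u' x.
Proof. by move=> hu hu' hx; rewrite /diverg vgrad_lin// mxtraceD mxtraceZ. Qed.

Lemma residual_lin a u u' p p' x : X u -> X u' -> Y p -> Y p' -> D x ->
  residual (fun y => a *: u y + u' y) (fun y => a * p y + p' y) x = a *: residual u p x + residual u' p' x.
Proof.
move=> hu hu' hp hp' hx; rewrite /residual grad_lin// /convection vgrad_lin// mulmxDr -scalemxAr.
move: (gnu x *m _) (gnu x *m _) (grad p x) (grad p' x) => G H b c.
by apply/rowP => i; rewrite !mxE; ring.
Qed.

Lemma frobDl (G H K : 'M[R]_n.+1) a : frob (a *: G + H) K = a * frob G K + frob H K.
Proof.
rewrite /frob mulr_sumr -big_split; apply: eq_bigr => i _.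
by rewrite mulr_sumr -big_split; apply: eq_bigr => j _; rewrite !mxE mulrDl mulrA.
Qed.

Lemma frobDr (G H K : 'M[R]_n.+1) a : frob K (a *: G + H) = a * frob K G + frob K H.
Proof.
rewrite /frob mulr_sumr -big_split; apply: eq_bigr => i _.
by rewrite mulr_sumr -big_split; apply: eq_bigr => j _; rewrite !mxE mulrDr mulrCA.
Qed.

Let lin_comb (a d x y b c : R) : (a * x + y) + d * (a * b + c) = a * (x + d * b) + (y + d * c).
Proof. by ring. Qed.

Lemma stab_form_linear_r u p a v v' q q' : X u -> Y p -> X v -> X v' -> Y q -> Y q' ->
  stab_form u p (fun y => a *: v y + v' y) (fun y => a * q y + q' y) = a * stab_form u p v q + stab_form u p v' q'.
Proof.
move=> hu hp hv hv' hq hq'; rewrite /stab_form.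
rewrite (boundary_term_linear_l hT a cw wb nuGw hq.1 hq'.1 hu.1).
have E : \int[mu]_(x in D) bulk u p (fun y => a *: v y + v' y) (fun y => a * q y + q' y) x =
    a * \int[mu]_(x in D) bulk u p v q x + \int[mu]_(x in D) bulk u p v' q' x.
  rewrite -(Rintegral_lin mD a (bulk_integrable hu hp hv hq) (bulk_integrable hu hp hv' hq')).
  apply: eq_Rintegral => x; rewrite inE => hx; rewrite /bulk sgrad_lin// diverg_lin// grad_lin//.
  by rewrite frobDr !dotDl !dotDr !dotZl !dotZr; ring.
by apply: etrans (lin_comb _ _ _ _ _ _); congr (_ + _); exact: E.
Qed.

Lemma stab_form_linear_l u u' p p' a v q : X u -> X u' -> Y p -> Y p' -> X v -> Y q ->
  stab_form (fun y => a *: u y + u' y) (fun y => a * p y + p' y) v q = a * stab_form u p v q + stab_form u' p' v q.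
Proof.
move=> hu hu' hp hp' hv hq; rewrite /stab_form.
rewrite (boundary_term_linear_r hT a cw wb nuGw hq.1 hu.1 hu'.1).
have E : \int[mu]_(x in D) bulk (fun y => a *: u y + u' y) (fun y => a * p y + p' y) v q x =
    a * \int[mu]_(x in D) bulk u p v q x + \int[mu]_(x in D) bulk u' p' v q x.
  rewrite -(Rintegral_lin mD a (bulk_integrable hu hp hv hq) (bulk_integrable hu' hp' hv hq)).
  apply: eq_Rintegral => x; rewrite inE => hx; rewrite /bulk sgrad_lin// diverg_lin// residual_lin//.
  move: (residual u p x) (residual u' p' x) => r r'.
  move: (sgrad u x) (sgrad u' x) => S S'.
  have -> : (2 * nu x) *: (a *: S + S') = a *: ((2 * nu x) *: S) + (2 * nu x) *: S'.
    by rewrite scalerDr !scalerA mulrC.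
  by rewrite frobDl dotDl dotDr dotZl dotZr; ring.
by apply: etrans (lin_comb _ _ _ _ _ _); congr (_ + _); exact: E.
Qed.

Lemma load_linear a v v' q q' : X v -> X v' -> Y q -> Y q' ->
  load (fun y => a *: v y + v' y) (fun y => a * q y + q' y) = a * load v q + load v' q'.
Proof.
move=> hv hv' hq hq'; rewrite /load.
have E1 : \int[mu]_(x in D) dot (a *: v x + v' x) (f x) =
    a * \int[mu]_(x in D) dot (v x) (f x) + \int[mu]_(x in D) dot (v' x) (f x).
  rewrite -(Rintegral_lin mD a (load_integrable hv) (load_integrable hv')).
  by apply: eq_Rintegral => x _; rewrite dotDl dotZl.
have E2 : \int[mu]_(x in D) dot (grad (fun y => a * q y + q' y) x) (f x) =
    a * \int[mu]_(x in D) dot (grad q x) (f x) + \int[mu]_(x in D) dot (grad q' x) (f x).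
  rewrite -(Rintegral_lin mD a (grad_load_integrable hq) (grad_load_integrable hq')).
  by apply: eq_Rintegral => x; rewrite inE => hx; rewrite grad_lin// dotDl dotZl.
by apply: etrans (lin_comb _ _ _ _ _ _); congr (_ + _ * _); [exact: E1|exact: E2].
Qed.

Lemma grad0 x : grad (fun=> 0 : R) x = 0 :> 'rV[R]_n.+1.
Proof. by apply/rowP => i; rewrite !mxE /pderive derive_cst. Qed.

Lemma vgrad0 (x : 'rV[R]_n.+1) : vgrad (fun=> 0) x = 0.
Proof.
have E i : (fun y : 'rV[R]_n.+1 => (0 : 'rV[R]_n.+1) 0 i) = fun=> 0 by apply/funext => y; rewrite mxE.
apply/matrixP => i j; rewrite mxE [RHS]mxE E; exact: derive_cst.
Qed.

Lemma boundary_term0 u : X u -> boundary_term Om T nuG (fun=> 0) u = 0.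
Proof.
move=> hu; have h0 := lagrange_zero Om T l.
have := boundary_term_linear_l hT 1 cw wb nuGw h0 h0 hu.1.
rewrite (_ : (fun y => 1 * 0 + 0) = fun=> 0); last by apply/funext => y; rewrite mul1r addr0.
by rewrite mul1r => /eqP; rewrite -subr_eq0 opprD addrA subrr sub0r oppr_eq0 => /eqP.
Qed.

Let combine (M S P L Q Rr Lg b : R) : M + S - P = L -> Q + delta * (Rr - Lg) + delta * b = 0 ->
  M + S - P + Q + delta * Rr + delta * b = L + delta * Lg.
Proof. by move=> <- E; apply/eqP; rewrite -subr_eq0 -E; apply/eqP; ring. Qed.

Let separate (Q Rr Lg b : R) : Q + delta * Rr + delta * b = delta * Lg ->
  Q + delta * (Rr - Lg) + delta * b = 0.
Proof. by rewrite mulrBr => <-; ring. Qed.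

(** Adding the two equations gives the single one; testing the latter with [q = 0] or with [v = 0]
    gives them back. *)
Lemma stabilised_solutionP u p : stabilised_solution Om T k l sigma delta nu gnu nuG f u p <->
  [/\ X u, Y p & forall v q, X v -> Y q -> stab_form u p v q = load v q].
Proof.
have dot0 (a : 'rV[R]_n.+1) : dot 0 a = 0 by rewrite -(scale0r 0) dotZl mul0r.
have dot0r (a : 'rV[R]_n.+1) : dot a 0 = 0 by rewrite dotC.
have res_split q : X u -> Y p -> Y q -> L2v Om (grad q) (fun x => grad p x + sigma *: u x
            - 2 *: ((vgrad u x)^T *m (gnu x)^T)^T - f x) =
    L2v Om (grad q) (residual u p) - L2v Om (grad q) f.
  move=> hu hp hq; rewrite !L2vE -(RintegralB mD (residual_integrable hu hp hq) (grad_load_integrable hq)).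
  apply: eq_Rintegral => x _; rewrite convectionE -/(residual u p x).
  by rewrite -[- f x]scaleN1r dotDr dotZr mulN1r.
split=> [[hu hp h1 h2]|[hu hp h]].
  split=> // v q hv hq; have := h1 v hv; have := h2 q hq.
  rewrite res_split// /stab_form /load bulk_split// -!L2vE => E2 E1; exact: combine E1 E2.
split=> // [v hv|q hq].
  have := h v (fun=> 0) hv (Yh_zero Om T l).
  rewrite /stab_form /load bulk_split//; last exact: Yh_zero.
  rewrite (boundary_term0 hu) -!L2vE.
  have E g : L2v Om (grad (fun=> 0)) g = 0.
    by rewrite L2vE; under eq_Rintegral do rewrite grad0 dot0; exact: Rintegral_cst0.
  rewrite !E.
  have -> g : L2s Om (fun=> 0) g = 0.
    by rewrite L2sE; under eq_Rintegral do rewrite mul0r; exact: Rintegral_cst0.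
  by rewrite !mulr0 !addr0.
have := h (fun=> 0) q (Xh_zero Om T k) hq.
rewrite /stab_form /load bulk_split//; last exact: Xh_zero.
rewrite res_split// -!L2vE.
have -> : L2v Om u (fun=> 0) = 0.
  by rewrite L2vE; under eq_Rintegral do rewrite dot0r; exact: Rintegral_cst0.
have -> : L2v Om (fun=> 0) f = 0.
  by rewrite L2vE; under eq_Rintegral do rewrite dot0; exact: Rintegral_cst0.
have -> : L2s Om p (diverg (fun=> 0)) = 0.
  by rewrite L2sE; under eq_Rintegral do rewrite /diverg vgrad0 mxtrace0 mulr0; exact: Rintegral_cst0.
have -> : L2m Om (fun x => 2 * nu x *: sgrad u x) (sgrad (fun=> 0)) = 0.
  rewrite L2mE (_ : (fun x => _) = fun=> 0); first exact: Rintegral_cst0.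
  apply/funext => x; rewrite /sgrad vgrad0 trmx0 addr0 scaler0 /frob big1// => i _.
  by rewrite big1// => j _; rewrite [X in _ * X]mxE mulr0.
rewrite mulr0 addr0 subr0 !add0r; exact: separate.
Qed.

Lemma vgrad_integrable u : X u -> intD (fun x => frob (vgrad u x) (vgrad u x)).
Proof. by move=> hu; apply: frob_integrable => i j; exact: sqi_vgrad. Qed.

Lemma sgrad_integrable u : X u -> intD (fun x => frob (sgrad u x) (sgrad u x)).
Proof. by move=> hu; apply: frob_integrable => i j; exact: sqi_sgrad. Qed.

Lemma grad_integrable p : Y p -> intD (fun x => dot (grad p x) (grad p x)).
Proof. by move=> hp; apply: dot_integrable => i; exact: sqi_grad. Qed.

(* 2|sym G|^2 = |G|^2 + sum_ij G_ij G_ji, and the integral of the last sum is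
   that of (div u)^2, as d_j u_i d_i u_j and d_i u_i d_j u_j have the same integral. *)
Lemma Korn u : X u -> \int[mu]_(x in D) frob (vgrad u x) (vgrad u x) <=
  2 * \int[mu]_(x in D) frob (sgrad u x) (sgrad u x).
Proof.
move=> hu; have iG := vgrad_integrable hu; have iS := sgrad_integrable hu.
have icross i j i' j' : intD (fun x => vgrad u x i j * vgrad u x i' j').
  by apply: sqi_mul => //; exact: sqi_vgrad.
have icr : intD (fun x => \sum_i \sum_j vgrad u x i j * vgrad u x j i).
  by apply: integrable_EFin_sum => // i; exact: integrable_EFin_sum.
rewrite -(RintegralZl 2 mD iS).
have -> : \int[mu]_(x in D) (2 * frob (sgrad u x) (sgrad u x)) =
    \int[mu]_(x in D) frob (vgrad u x) (vgrad u x) +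
    \int[mu]_(x in D) (\sum_i \sum_j vgrad u x i j * vgrad u x j i).
  rewrite -(RintegralD mD iG icr); apply: eq_Rintegral => x _; exact: frob_symm.
rewrite lerDl.
have -> : \int[mu]_(x in D) (\sum_i \sum_j vgrad u x i j * vgrad u x j i) =
    \int[mu]_(x in D) (\sum_i \sum_j vgrad u x i i * vgrad u x j j).
  rewrite !(Rintegral_sum mD); last 2 first.
  - by move=> i; exact: integrable_EFin_sum.
  - by move=> i; exact: integrable_EFin_sum.
  apply: eq_bigr => i _; rewrite !(Rintegral_sum mD)//; apply: eq_bigr => j _.
  have ub m x : bdry Om x -> u x 0 m = 0 by move=> /hu.2 ->; rewrite mxE.
  have := mixed_derivatives_integral hOm hT j i (hu.1 i) (ub i) (hu.1 j) (ub j) mB B0.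
  have E m m' : (fun x => vgrad u x m m') = pderive m' (fun y => u y 0 m).
    by apply/funext => x; rewrite mxE.
  have E' m m' a a' : \int[mu]_(x in D) (pderive m' (fun y => u y 0 m) x * pderive a' (fun y => u y 0 a) x) =
    \int[mu]_(x in D) (vgrad u x m m' * vgrad u x a a').
    by apply: eq_Rintegral => x _; rewrite -!E.
  by rewrite !E'.
apply: Rintegral_ge0 => x _; under eq_bigr do rewrite -mulr_sumr.
by rewrite -mulr_suml -expr2 sqr_ge0.
Qed.

(** The two Young inequalities cost a quarter of [A] each and leave [A / 2], while [d * s <= 3^-1]
    reduces [d s^2 U] to a third of [s U]. *)
Let pointwise_bound (s d nx nm gm U Sg A cu cc Gg pd : R) :
  0 <= d -> 0 <= s -> d * s <= 3^-1 -> 0 <= U -> 0 <= Sg -> nm <= nx ->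
  - (4^-1 * A) - s ^+ 2 * U <= s * cu -> 2 * cc <= 4^-1 * A + 4 * (gm ^+ 2 * Gg) ->
  2 / 3 * s * U + (2 * nm * Sg + (d / 2 * A + (- (4 * d * gm ^+ 2)) * Gg)) <=
  s * U + 2 * nx * Sg - pd + pd + d * (A + s * cu - 2 * cc).
Proof.
move=> d0 s0 ds U0 S0 hn h1 h2.
have k1 : nm * Sg <= nx * Sg by rewrite ler_wpM2r.
have k2 : d * s * (s * U) <= 3^-1 * (s * U) by rewrite ler_wpM2r// mulr_ge0.
have k3 := ler_wpM2l d0 h1; have k4 := ler_wpM2l d0 h2.
rewrite subrK; nra.
Qed.

(** The multiples of [Gg] add up to [4 d (gm^2 + K) Gg], at most [nm / 3 * Gg] and, by Korn's
    inequality, at most [2 / 3 * nm * Sg]; the term [2 nm Sg] absorbs this. The boundary term takes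
    another quarter of [A]. *)
Let final_bound (d K gm nm M Sg A Gg bt bk : R) :
  0 < d -> 0 <= Gg -> d * (gm ^+ 2 + K) <= nm / 12 -> 0 <= nm -> Gg <= 2 * Sg ->
  `|bt| <= 4^-1 * A + 4 * K * Gg ->
  M + (2 * nm * Sg + (d / 2 * A + (- (4 * d * gm ^+ 2)) * Gg)) <= bk ->
  M + d / 4 * A <= bk + d * bt.
Proof.
move=> d0 G0 hd n0 GS; rewrite ler_norml => /andP[hb _] hbk.
have k1 := ler_wpM2l (ltW d0) hb.
have k2 : d * (gm ^+ 2 + K) * Gg <= nm / 12 * Gg by rewrite ler_wpM2r.
have k3 : nm * Gg <= nm * (2 * Sg) by rewrite ler_wpM2l.
have k4 : 0 <= nm * Gg by rewrite mulr_ge0.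
lra.
Qed.

Lemma stab_form_coercive u p K : X u -> Y p -> delta * sigma <= 3^-1 ->
  delta * (gmax ^+ 2 + K) <= numin / 12 ->
  `|boundary_term Om T nuG p u| <= 4^-1 * \int[mu]_(x in D) dot (grad p x) (grad p x) +
     4 * K * \int[mu]_(x in D) frob (vgrad u x) (vgrad u x) ->
  2 / 3 * sigma * \int[mu]_(x in D) dot (u x) (u x) +
  delta / 4 * \int[mu]_(x in D) dot (grad p x) (grad p x) <= stab_form u p u p.
Proof.
move=> hu hp ds hd hb.
have iU := mass_integrable hu hu; have iS := sgrad_integrable hu.
have iA := grad_integrable hp; have iG := vgrad_integrable hu.
have iG' := integrable_EFinZ mD (- (4 * delta * gmax ^+ 2)) iG.
have iAG := integrable_EFinD mD (integrable_EFinZ mD (delta / 2) iA) iG'.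
have iSAG := integrable_EFinD mD (integrable_EFinZ mD (2 * numin) iS) iAG.
have iL := integrable_EFinD mD (integrable_EFinZ mD (2 / 3 * sigma) iU) iSAG.
have low : \int[mu]_(x in D) (2 / 3 * sigma * dot (u x) (u x) + (2 * numin * frob (sgrad u x) (sgrad u x) +
    (delta / 2 * dot (grad p x) (grad p x) + (- (4 * delta * gmax ^+ 2)) * frob (vgrad u x) (vgrad u x))))
    <= \int[mu]_(x in D) bulk u p u p x.
  apply: (le_Rintegral mD iL (bulk_integrable hu hp hu hp)) => x hx.
  have /andP[n1 n2] := nuD hx.
  have fE : frob ((2 * nu x) *: sgrad u x) (sgrad u x) = 2 * nu x * frob (sgrad u x) (sgrad u x).
    have := frobDl (sgrad u x) 0 (sgrad u x) (2 * nu x).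
    have -> : frob 0 (sgrad u x) = 0.
      by rewrite /frob big1// => i _; rewrite big1// => j _; rewrite [X in X * _]mxE mul0r.
    by rewrite !addr0.
  have rE : dot (grad p x) (residual u p x) = dot (grad p x) (grad p x) + sigma * dot (grad p x) (u x)
      - 2 * dot (grad p x) (convection u x).
    by rewrite /residual -[- _]scaleNr dotDr dotDr !dotZr mulNr.
  rewrite /bulk fE rE; apply: pointwise_bound => //.
  - exact: ltW.
  - exact: ltW.
  - exact: dot_ge0.
  - exact: frob_ge0.
  - exact: dot_Young.
  - apply: (le_trans (dot_mulmx_frob _ _ _)); rewrite lerD2l ler_pM2l// ler_wpM2r ?frob_ge0//.
    by rewrite -sqr_enorm lerXn2r ?nnegrE ?enorm_ge0 ?gnuD// (le_trans _ (gnuD hx))// enorm_ge0.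
rewrite (Rintegral_lin mD _ iU iSAG) (Rintegral_lin mD _ iS iAG) (Rintegral_lin mD _ iA iG') (RintegralZl _ mD iG) in low.
apply: (final_bound delta_gt0 _ hd (ltW numin_gt0) (Korn hu) hb low).
by apply: Rintegral_ge0 => x _; exact: frob_ge0.
Qed.

End StabilisedForm.

(** * Definiteness *)

Section Kernel.
Context {R : realType} {n N : nat}.
Variables (Om : set 'rV[R]_n.+1) (T : 'I_N -> 'I_n.+2 -> 'rV[R]_n.+1).
Hypothesis hOm : bounded_lipschitz_domain Om.
Hypothesis hT : triangulation Om T.
Variable B : set 'rV[R]_n.+1.
Hypotheses (mB : measurable B) (B0 : leb n.+1 B = 0%E).
Local Notation mu := (leb n.+1).
Local Notation D := (mesh_open T `\` B).

Let nd e : Defs.nondegenerate (T e). Proof. by case: hT. Qed.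

(** The integral is a sum over elements of integrals of sums of squares of polynomials, so each of
    them is zero. The polynomials vanish first in the core and then, being continuous, on the closed
    element. *)
Lemma mesh_sqr_eq0 m g (F : 'I_N -> 'I_n.+1 -> 'rV[R]_n.+1 -> R) :
  (forall e i, mpol m (F e i)) ->
  (forall e x, interior (simplex (T e)) x -> g x = \sum_i F e i x ^+ 2) ->
  \int[mu]_(x in D) g x = 0 ->
  forall e i x, simplex (T e) x -> F e i x = 0.
Proof.
move=> hF gF; have hS e : mpol (m + m) (fun x => \sum_i F e i x ^+ 2).
  by apply: mpol_sum => i; exact: mpolM.
have pg : pwpol T g by exists (m + m)%N => e; exists (fun x => \sum_i F e i x ^+ 2) => //; exact: gF.
rewrite (mesh_integral_split hT mB B0 pg (fun e => ex_intro _ _ (hS e)) gF) => /eqP.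
rewrite psumr_eq0; last by move=> e _; apply: Rintegral_ge0 => x _; apply: sumr_ge0 => i _; exact: sqr_ge0.
move=> /allP h e i x hx; have /= /eqP he := h e (mem_index_enum _).
have mS := measurable_simplex (nd e).
have z y : simplex_core (T e) y -> F e i y = 0.
  move=> hy; have /eqP : \sum_i F e i y ^+ 2 = 0.
    have s0 z : simplex (T e) z -> 0 <= \sum_i F e i z ^+ 2.
      by move=> _; apply: sumr_ge0 => j _; exact: sqr_ge0.
    have sc z : simplex_core (T e) z -> {for z, continuous (fun z => \sum_i F e i z ^+ 2)}.
      by move=> _; exact: mpol_continuous (hS e) z.
    have si := mpol_integrable_bounded (hS e) mS (bounded_simplex (T e)).
    by rewrite (Rintegral_eq0_open mS (@open_simplex_core _ _ (T e)) (simplex_core_sub (nd e)) s0 sc si he hy).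
  rewrite psumr_eq0; last by move=> j _; exact: sqr_ge0.
  by move=> /allP/(_ i (mem_index_enum _)); rewrite /= sqrf_eq0 => /eqP.
apply: (vanish_on_closure z); first exact: closure_simplex_core.
exact: mpol_continuous (hF e i) x.
Qed.

Lemma velocity_eq0 k u : Xh Om T k u -> \int[mu]_(x in D) dot (u x) (u x) = 0 -> u = fun=> 0.
Proof.
move=> [hu ub] u0; have /choice[P hP] e : exists P : 'I_n.+1 -> 'rV[R]_n.+1 -> R, forall i,
    mpol k (P i) /\ forall x, simplex (T e) x -> u x 0 i = P i x.
  have /choice[P hP] i := lagrange_pieces e (hu i).
  by exists P => i; have [hp h _] := hP i; split=> // x hx; exact: h.
have z := @mesh_sqr_eq0 k (fun x => dot (u x) (u x)) P (fun e i => (hP e i).1) _ u0.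
apply/funext => x; apply/rowP => i; rewrite mxE.
have [cx|ncx] := pselect (closure Om x); last by have [_ h _] := hu i; exact: h.
move: cx; have [_ _ _ <-] := hT => -[e _ hx]; rewrite (hP e i).2// z// => d y hy.
by apply: eq_bigr => j _; rewrite (hP d j).2 ?expr2//; exact: interior_subset.
Qed.

Lemma gradient_eq0_constant l p : Defs.lagrange Om T l p ->
  \int[mu]_(x in D) dot (grad p x) (grad p x) = 0 ->
  exists c : 'I_N -> R, forall e x, simplex (T e) x -> p x = c e.
Proof.
move=> hp p0; have /choice[P hP] e := lagrange_pieces e hp.
have mP e : mpol l (P e) by have [] := hP e.
have z : forall e i x, simplex (T e) x -> pderive i (P e) x = 0.
  apply: (@mesh_sqr_eq0 l (fun x => dot (grad p x) (grad p x)) (fun e i => pderive i (P e)) _ _ p0).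
    by move=> e i; exact: mpol_pderive.
  move=> e x hx; apply: eq_bigr => j _; rewrite !mxE -expr2.
  by have [_ _ /(_ x hx j)[_ ->]] := hP e.
(* A base point in each core: segments inside the convex core stay where the gradient vanishes, and
   the rest of the element follows by continuity. *)
have /choice[c hc] e : exists x, simplex_core (T e) x.
  have [y [hy _]] := closure_simplex_core (nd e) (vertex_simplex (T e) ord0) (@filterT _ _ _).
  by exists y.
exists (fun e => P e (c e)) => e x hx; have [_ h _] := hP e; rewrite (h x hx).
apply/eqP; rewrite -subr_eq0; apply/eqP.
have zero y : simplex_core (T e) y -> P e y - P e (c e) = 0.
  move=> hy; apply/eqP; rewrite subr_eq0; apply/eqP; apply: segment_derive_cst.
    by move=> w; exact: mpol_differentiable (mP e).
  move=> t ht i; apply: (z e); apply: (simplex_core_sub (nd e)).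
  exact: simplex_core_convex.
have cP := mpol_continuous (mpol_sub (mP e) (mpol_cst l (P e (c e)))).
exact: (vanish_on_closure zero (closure_simplex_core (nd e) hx) (@cP x)).
Qed.

(* A function that is constant on each closed simplex takes each value on a
   closed set, whose trace on Om is also open since the other values are taken on
   a closed set too; so connectedness of Om makes it constant. *)
Lemma pressure_eq0 l p : Yh Om T l p -> \int[mu]_(x in D) dot (grad p x) (grad p x) = 0 -> p = fun=> 0.
Proof.
move=> [hp ip] p0; have [c hc] := gradient_eq0_constant hp p0.
have [[x0 Ox0] oOm conn _ _] := hOm; have [_ _ _ cov] := hT.
have inS x : Om x -> exists e, simplex (T e) x.
  by move=> /(@subset_closure _ Om); rewrite -cov => -[e _]; exists e.
pose U (b : pred 'I_N) := \bigcup_(e in [set e | b e]) simplex (T e).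
have clU b : closed (U b).
  by apply: closed_bigcup => [|e _]; [exact: finite_finset|exact: closed_simplex].
pose A := Om `&` U (fun e => c e == p x0).
have pA : A = Om.
  apply: conn.
  - have [e he] := inS x0 Ox0; exists x0; split=> //; exists e => //=.
    by rewrite (hc e x0).
  - exists (~` U (fun e => c e != p x0)); first exact/closed_openC/clU.
    apply/seteqP; split=> x [Ox].
      move=> [e /eqP ce he]; split=> // -[d /= cd hd]; move: cd.
      by rewrite -(hc d x hd) (hc e x he) ce eqxx.
    move=> nU; split=> //; have [e he] := inS x Ox; exists e => //=.
    by apply/negPn/negP => ce; apply: nU; exists e.
  - by exists (U (fun e => c e == p x0)).
have pc x : Om x -> p x = p x0.
  by rewrite -{1}pA => -[_ [e /eqP ce he]]; rewrite (hc e x he).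
(* The zero mean is [p x0] times the measure of [mesh_open T], a nonempty open set. *)
have p00 : p x0 = 0.
  have fO : (mu (mesh_open T) < +oo)%E := leb_mesh_open_lty T.
  have mO := measurable_mesh_open T.
  move: ip; rewrite (integral_Om hOm hT) (@eq_Rintegral _ _ _ mu _ (fun=> p x0)); last first.
    by move=> x; rewrite inE => /(mesh_open_sub hOm hT)/pc.
  rewrite Rintegral_cst// => /eqP; rewrite mulf_eq0 => /orP[/eqP//|/eqP m0].
  have [e he] := inS x0 Ox0.
  have [y hy] : exists y, simplex_core (T e) y.
    have [y [hy _]] := closure_simplex_core (nd e) he (@filterT _ _ _); by exists y.
  have ne : mesh_open T !=set0 by exists y; exists e => //; exact: (simplex_core_interior (nd e)).
  have pos := leb_open_gt0 (@open_mesh_open _ _ _ T) ne.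
  have : (0 < fine (mu (mesh_open T))) by apply: fine_gt0; rewrite pos.
  by rewrite m0 ltxx.
(* At a point of the closure the value is the one taken in the core of an element containing it, and
   that core lies in [Om]. *)
apply/funext => x; have [cx|ncx] := pselect (closure Om x); last by have [_ h _] := hp; exact: h.
move: cx; rewrite -cov => -[e _ hx]; rewrite (hc e x hx).
have [y [hy _]] := closure_simplex_core (nd e) hx (@filterT _ _ _).
have Oy : Om y by apply: (mesh_open_sub hOm hT); exists e => //; exact: (simplex_core_interior (nd e)).
by rewrite -(hc e y (simplex_core_sub (nd e) hy)) pc.
Qed.

End Kernel.

(** * Choice of the constant and solvability of the linear system *)

Theorem lemma4p1 (R : realType) (n : nat) (hn : n = 1%N \/ n = 2%N)
    (Om : set 'rV[R]_n.+1) (hOm : bounded_lipschitz_domain Om)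
    (kappa Q : R) (hQ : 1 <= Q) (k l : nat) (hk : (1 <= k)%N) (hl : (1 <= l)%N) :
  exists C : R, 0 < C /\
    forall (N : nat) (T : 'I_N -> 'I_n.+2 -> 'rV[R]_n.+1),
      triangulation Om T -> shape_regular T kappa -> quasi_uniform T Q ->
    forall (sigma : R) (f : 'rV[R]_n.+1 -> 'rV[R]_n.+1)
      (nu : 'rV[R]_n.+1 -> R) (gnu : 'rV[R]_n.+1 -> 'rV[R]_n.+1)
      (nuG : 'rV[R]_n.+1 -> R) (numin numax delta : R),
      0 < sigma ->
      in_L2v Om f ->
      W1infty Om nu gnu -> boundary_trace Om nu nuG ->
      0 < numin ->
      {ae leb n.+1, forall x, Om x -> numin <= nu x <= numax} ->
      0 < delta ->
      (let h := mesh_size T in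
       delta <= Num.min (1 / (3 * sigma))
         ((numin * h ^+ 2 / 12) /
          (h ^+ 2 * fine (Linfty_norm Om (enorm \o gnu)) ^+ 2
           + C * numax ^+ 2))) ->
      exists! up : ('rV[R]_n.+1 -> 'rV[R]_n.+1) * ('rV[R]_n.+1 -> R),
        stabilised_solution Om T k l sigma delta nu gnu nuG f up.1 up.2.
Proof.
(* Fixed before any mesh is given, with a degree that serves both velocity and pressure. *)
have [C0 C00 hC] := @trace_inequality R n (maxn k l).
set C1 := C0 * `|kappa| * Q + 1.
have Q0 : 0 <= Q by exact: le_trans hQ.
have C10 : 0 < C1 by rewrite ltr_wpDl// !mulr_ge0.
(* The factor of [numax ^+ 2 / h ^+ 2] in [boundary_term_bound], apart from the 4 in front of it,
   which is paid for by the 12 in the bound on [delta]. *)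
pose C := 36 * n.+2%:R ^+ 2 * C1 ^+ 2.
have C_gt0 : 0 < C.
  have n2 : 0 < n.+2%:R :> R by [].
  have := exprn_gt0 2 n2; have := exprn_gt0 2 C10; rewrite /C => a b; apply: mulr_gt0 => //; exact: mulr_gt0.
exists C; split=> // N T hT hsr hqu sigma f nu gnu nuG numin numax delta sigma0 hf.
move=> [[mnu mgnu] _ gfin _] [w [cw wnu nuGw]] numin0 hae delta0 /=.
set h := mesh_size T; set gmax := fine _; rewrite le_min => /andP[hd1 hd2].
have [Om0 oOm _ _ _] := hOm.
have [x0 Ox0] := Om0.
have h0 : 0 < h.
  have := subset_closure Ox0; have [_ _ _ <-] := hT => -[e _ _].
  exact: (quasi_uniform_gt0 e hqu).1.
(* Off a null set the a.e. bounds hold pointwise; B is removed from every domain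
   of integration. *)
have [B [mB B0 hB]] : {ae leb n.+1, forall x, Om x -> (numin <= nu x <= numax) /\ enorm (gnu x) <= gmax}.
  have := Linfty_norm_ae oOm Om0 gfin; apply: filterS2 hae => x hx gx Ox; split; first exact: hx.
  by have := gx Ox; rewrite /= ger0_norm ?enorm_ge0.
have good x : (mesh_open T `\` B) x -> (numin <= nu x <= numax) /\ enorm (gnu x) <= gmax.
  move=> [mx nBx]; apply: contrapT => ng; apply: nBx; apply: hB => gx; apply: ng.
  by apply: gx; exact: (mesh_open_sub hOm hT).
have nuD x hx := (good x hx).1; have gnuD x hx := (good x hx).2.
have wb' : forall x, closure Om x -> numin <= w x <= numax.
  apply: ae_closure_bounds => //; apply: filterS2 wnu hae => x wx nx Ox.
  by rewrite wx//; exact: nx.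
have wb x : closure Om x -> 0 <= w x <= numax.
  by move=> /wb' /andP[a ->]; rewrite (le_trans (ltW numin0) a).
have numax0 : 0 < numax.
  by have /andP[a b] := wb' x0 (subset_closure Ox0); exact: lt_le_trans numin0 (le_trans a b).
(* Chosen so that cancelling [h ^+ 2] in the second bound on [delta] gives
   [delta * (gmax ^+ 2 + K) <= numin / 12]. *)
pose K := C * numax ^+ 2 / h ^+ 2.
have ds : delta * sigma <= 3^-1.
  move: hd1; rewrite ler_pdivlMr ?mulr_gt0// => hd1; lra.
have dK : delta * (gmax ^+ 2 + K) <= numin / 12.
  have h2 : 0 < h ^+ 2 by exact: exprn_gt0.
  have den : 0 < h ^+ 2 * gmax ^+ 2 + C * numax ^+ 2.
    apply: ltr_wpDl; first by apply: mulr_ge0; exact: sqr_ge0.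
    by apply: mulr_gt0 => //; exact: exprn_gt0.
  move: hd2; rewrite ler_pdivlMr// => hd2.
  have E : delta * (h ^+ 2 * gmax ^+ 2 + C * numax ^+ 2) = h ^+ 2 * (delta * (gmax ^+ 2 + K)).
    by rewrite /K; field; rewrite gt_eqF.
  rewrite -(ler_pM2l h2) -E; apply: (le_trans hd2); rewrite le_eqVlt; apply/orP; left; apply/eqP; ring.
have bt u p (hu : Xh Om T k u) (hp : Yh Om T l p) :=
  boundary_term_bound hT Q0 C00 hC hsr hqu h0 cw wb nuGw hp.1 hu.1 mB B0.
pose V := (('rV[R]_n.+1 -> 'rV[R]_n.+1) * ('rV[R]_n.+1 -> R^o))%type.
pose W : set V := fun z => Xh Om T k z.1 /\ Yh Om T l z.2.
pose form (y z : V) := stab_form Om T B sigma delta nu gnu nuG y.1 y.2 z.1 z.2.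
pose F (z : V) := load T B delta f z.1 z.2.
have subW : subspace_of W.
  split; first by split; [exact: Xh_zero|exact: Yh_zero].
  by move=> a y z [h1 h2] [h3 h4]; split; [exact: Xh_lin|exact: Yh_lin].
have [s hs] := Galerkin_space_span hT k l.
have Ws : W `<=` lspan s by move=> [u p] [/= hu hp]; exact: hs.
have bform : bilinear_on W form.
  split=> [y [h1 h2] a z z' [h3 h4] [h5 h6]|y [h1 h2] a z z' [h3 h4] [h5 h6]].
    exact: (stab_form_linear_r hOm hT mB sigma delta numin0 nuD gnuD mnu mgnu cw wb nuGw a h1 h2 h3 h5 h4 h6).
  exact: (stab_form_linear_l hOm hT mB sigma delta numin0 nuD gnuD mnu mgnu cw wb nuGw a h3 h5 h4 h6 h1 h2).
have linF : linear_on W F.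
  by move=> a z z' [h1 h2] [h3 h4]; exact: (load_linear hOm hT mB delta hf a h1 h3 h2 h4).
have definite z : W z -> form z z = 0 -> z = 0.
  case: z => u p [/= hu hp]; rewrite /form /= => z0.
  have := stab_form_coercive hOm hT mB B0 numin0 nuD gnuD mnu mgnu sigma0 delta0 hu hp ds dK (bt u p hu hp).
  rewrite z0; set a := Rintegral _ _ _; set b := Rintegral _ _ _ => ab.
  have a0 : 0 <= a by apply: Rintegral_ge0 => x _; exact: dot_ge0.
  have b0 : 0 <= b by apply: Rintegral_ge0 => x _; exact: dot_ge0.
  have sa : 0 <= 2 / 3 * sigma * a by rewrite !mulr_ge0// ltW.
  have sb : 0 <= delta / 4 * b by rewrite !mulr_ge0// ltW.
  have /eqP : 2 / 3 * sigma * a = 0 by apply/eqP; rewrite eq_le sa andbT; lra.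
  rewrite mulf_eq0 (gt_eqF (mulr_gt0 _ sigma0))//= => /eqP az.
  have /eqP : delta / 4 * b = 0 by apply/eqP; rewrite eq_le sb andbT; lra.
  rewrite mulf_eq0 (gt_eqF (divr_gt0 delta0 _))//= => /eqP bz.
  by congr pair; [exact: (velocity_eq0 hT mB B0 hu)|exact: (pressure_eq0 hOm hT mB B0 hp)].
have solP u p := stabilised_solutionP hOm hT mB B0 k l sigma delta numin0 nuD gnuD mnu mgnu hf cw wb nuGw u p.
have [[u p] [[/= hu hp] sol]] := galerkin subW Ws bform linF definite.
exists (u, p); split.
  by apply/solP; split=> // v q hv hq; exact: (sol (v, q)).
move=> [u' p'] /solP /= [hu' hp' sol'].
(* The difference of two solutions satisfies the homogeneous equation, which is then tested with
   this difference. *)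
have Wd : W ((-1) *: (u', p' : 'rV[R]_n.+1 -> R^o) + (u, p)) by apply: subW.2; split.
have Wu : W (u, p) by split.
have Wu' : W (u', p') by split.
have : (-1) *: (u', p' : 'rV[R]_n.+1 -> R^o) + (u, p) = 0 :> V.
  apply: definite => //; rewrite (bform.2 _ Wd)//.
  by rewrite (sol _ Wd) [form (u', p') _](sol' _ _ Wd.1 Wd.2) mulN1r addNr.
by rewrite scaleN1r addrC => /eqP; rewrite subr_eq0 => /eqP.
Qed.
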